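(* Let $\mathcal X_s$ be the star-shaped quiver variety and $\tilde{\mathcal Z}_s$ the variety (GIT quotient of the critical locus of the potential) of the quiver obtained from it by the quiver mutation at the center node $5$, both with the action of $S=(\mathbb C^* )^{N_8+N_9}$, as defined in the context, and put $N_5'=N_6+N_7-N_5$. Their $S$-equivariant quasimap small $I$-functions satisfy the following relations (equality being understood through restriction to corresponding $S$-fixed points, as explained in the context). (a) If $N_6+N_7\ge N_3+N_4+2$, then $$I^{\mathcal X_s,S}(\vec q)=I^{\tilde{\mathcal Z}_s,S}(\vec q\,')$$ under the change of Kähler variables $q_5'=q_5^{-1}$, $q_6'=q_6q_5$, $q_7'=q_7q_5$, $q_i'=q_i$ for $i\ne 5,6,7$. (b) If $N_6+N_7=N_3+N_4+1$, then $$I^{\mathcal X_s,S}(\vec q)=e^{(-1)^{N_5'-1}q_5}\,I^{\tilde{\mathcal Z}_s,S}(\vec q\,')$$ under the same change of Kähler variables as in (a), i.e. $q_5'=q_5^{-1}$, $q_6'=q_6q_5$, $q_7'=q_7q_5$, $q_i'=q_i$ for $i\neq 5,6,7$. (c) If $N_6+N_7=N_3+N_4$, then $$I^{\mathcal X_s,S}(\vec q)=\bigl(1+(-1)^{N_5'}q_5\bigr)^{\sum_{i=3,4}\sum_{A=1}^{N_i}x^i_A-\sum_{j=6,7}\sum_{B=1}^{N_j}x^j_B+N_5'}\,I^{\tilde{\mathcal Z}_s,S}(\vec q\,')$$ under the change of Kähler variables $q_3'=q_3(1+(-1)^{N_5'}q_5)$, $q_4'=q_4(1+(-1)^{N_5'}q_5)$,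 $q_5'=q_5^{-1}$, $q_6'=\dfrac{q_6q_5}{1+(-1)^{N_5'}q_5}$, $q_7'=\dfrac{q_7q_5}{1+(-1)^{N_5'}q_5}$, and $q_i'=q_i$ for $i=1,2$.
   Context: **Quiver varieties.** For a quiver with gauge nodes $Q_0\setminus Q_f$, framed nodes $Q_f$, and a positive integer $N_i$ at each node, put $V=\bigoplus_{i\to j}\mathbb C^{N_i\times N_j}$ and $G=\prod_{i\in Q_0\setminus Q_f}GL(N_i)$, acting by $g\cdot(A_{i\to j})=(g_iA_{i\to j}g_j^{-1})$ with $g_i=1$ at framed nodes. A character is $\theta(g)=\prod_{i}\det(g_i)^{\sigma_i}$. A point $x\in V$ is $\theta$-semistable iff for every one-parameter subgroup $g(\lambda)$ of $G$ such that $\lim_{\lambda\to0}g(\lambda)x$ exists, the exponent of $\lambda$ in $\theta(g(\lambda))$ is $\ge 0$. For a closed $G$-invariant $Z\subset V$, $Z/\!/_\theta G=Z^{ss}/G$ with $Z^{ss}=Z\cap V^{ss}$. A matrix is non-degenerate if it has maximal rank. **$\mathcal X_s$.** Gauge nodes $1,\dots,7$, framed nodes $8,9$, arrows $1\to3$, $2\to4$, $3\to5$, $4\to5$, $5\to6$, $5\to7$, $6\to8$, $7\to9$, one each. Assumptions: $N_j>N_i$ for each arrow $i\to j$ with $i\ne5$; $N_6+N_7>N_5$; $N_6+N_7\ge N_3+N_4$. Phase: $\sigma_i>0$ for all $i=1,\dots,7$. The semistable locus consists of the points where $A_{1\to3},A_{2\to4},A_{3\to5},A_{4\to5},A_{6\to8},A_{7\to9}$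 and $[A_{5\to6}\ A_{5\to7}]$ are non-degenerate. $\mathcal X_s=V/\!/_\theta G$. **$\tilde{\mathcal Z}_s$.** Mutation at node $5$: same nodes and integers except that node $5$ carries $N_5'=N_6+N_7-N_5$; arrows $1\to3$, $2\to4$, $5\to3$, $5\to4$, $6\to5$, $7\to5$, $3\to6$, $3\to7$, $4\to6$, $4\to7$, $6\to8$, $7\to9$; potential $\tilde W_s=\sum_{a\in\{3,4\}}\sum_{b\in\{6,7\}}\mathrm{tr}(A_{a\to b}A_{b\to5}A_{5\to a})$. Phase: $\sigma_i>0$ for $i\ne5,6,7$, $\sigma_5<0$, $\sigma_5+\sigma_6>0$, $\sigma_5+\sigma_7>0$. $\tilde{\mathcal Z}_s$ is the GIT quotient of $\{d\tilde W_s=0\}$; its semistable locus is given by $A_{5\to3}=0$, $A_{5\to4}=0$, $A_{a\to6}A_{6\to5}+A_{a\to7}A_{7\to5}=0$ for $a=3,4$, with $A_{1\to3},A_{2\to4},A_{6\to8},A_{7\to9}$, $[A_{3\to6}\ A_{3\to7}]$, $[A_{4\to6}\ A_{4\to7}]$ and $\begin{bmatrix}A_{6\to5}\\ A_{7\to5}\end{bmatrix}$ non-degenerate. Thus $\tilde{\mathcal Z}_s$ is cut out, in the quiver variety of the quiver with the arrows $5\to3,5\to4$ deleted, by these two matrix relations, whose weights are $x^a_I-x^5_J$, $a=3,4$. **Torus and $I$-functions.** $S=(\mathbb C^* )^{N_8}\times(\mathbb C^* )^{N_9}$ acts by $A_{6\to8}\mapsto A_{6\to8}t^{-1}$, $A_{7\to9}\mapsto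 A_{7\to9}t^{-1}$ ($t$ viewed as a diagonal matrix). Equivariant parameters are $\lambda_1,\dots,\lambda_{N_8+N_9}$; set $x^8_I=\lambda_I$, $x^9_J=\lambda_{N_8+J}$. For a gauge node $i$, $x^i_1,\dots,x^i_{N_i}$ are the $S$-equivariant Chern roots of the tautological bundle at $i$ (for the mutated quiver $N_5$ is replaced by $N_5'$). Write $[y]_a=\prod_{l\le a}(y+l)/\prod_{l\le0}(y+l)$ for $a\in\mathbb Z$. With $u=1$, the equivariant quasimap small $I$-function of the variety is (pulled back to $V^{ss}/T$, $T$ the maximal torus of $G$; abelian/nonabelian correspondence) $$I(\vec q)=\sum_{(n^i_I)}\ \prod_{i\text{ gauge}}\prod_{I\ne J}[x^i_I-x^i_J]_{n^i_I-n^i_J}\prod_{i\to j}\prod_{I,J}\frac1{[x^i_I-x^j_J]_{n^i_I-n^j_J}}\prod_{\text{relation weights }x^a_I-x^b_J}[x^a_I-x^b_J]_{n^a_I-n^b_J}\prod_{i\text{ gauge}}q_i^{\sum_In^i_I},$$ where the arrows are those of the quiver (for $\tilde{\mathcal Z}_s$: with $5\to3,5\to4$ deleted), the relation product is present only for $\tilde{\mathcal Z}_s$, $n^i_I=0$ at framed nodes, and the sum is over integer vectors $(n^i_I)$ for which there is a semistable point of the variety with $(A_{i\to j})_{IJ}=0$ whenever $n^i_I<n^j_J$. **Meaning of equality.** $S$-fixed points of $\mathcal X_s$ correspond to tuples of sets $(C_i)_{1\le i\le7}$, $|C_i|=N_i$, with $C_1\subset C_3\subset C_5$, $C_2\subset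 C_4\subset C_5$, $C_5\subset C_6\sqcup C_7$, $C_6\subset\{1,\dots,N_8\}$, $C_7\subset\{N_8+1,\dots,N_8+N_9\}$, where the roots $x^i_I$ restrict to the $\lambda_f$, $f\in C_i$. $S$-fixed points of $\tilde{\mathcal Z}_s$ are described likewise by their weight sets, and there is a bijection $\iota_s$ from the fixed points of $\mathcal X_s$ to those of $\tilde{\mathcal Z}_s$ keeping $C_i$ for $i\ne5$ and replacing $C_5$ by $(C_6\sqcup C_7)\setminus C_5$. An identity between the two $I$-functions means, for every fixed point $P$, the identity between the restriction of the left side to $P$ and the restriction of the right side to $\iota_s(P)$ (the prefactor involves only nodes whose roots restrict equally). Powers $(1\pm q_5)^c$ are expanded as binomial series in $q_5$.
   Formalization: In part (b) the prefactor is corrected to e^{(-1)^{N_5'} q_5}; with the printed sign (-1)^{N_5'-1} the identity already fails at the coefficient of q_5. *)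

(* Defs.v *)
From HB Require Import structures.
From mathcomp Require Import all_boot all_order all_algebra.
From mathcomp Require Import boolp classical_sets fsbigop reals.
From mathcomp.real_closed Require Import complex.
From mathcomp Require Import mpoly.

Set Implicit Arguments.
Unset Strict Implicit.
Unset Printing Implicit Defensive.

Import Order.TTheory GRing.Theory Num.Theory.
Local Open Scope classical_set_scope.
Local Open Scope ring_scope.

Structure quiver := Quiver {
  node : finType;
  framed : pred node;
  arrow : finType;
  src : arrow -> node;
  tgt : arrow -> node }.

Section QuiverVariety.
Variables (Q : quiver) (N : node Q -> nat).

Definition rep (A : Type) := forall a : arrow Q, 'M[A]_(N (src a), N (tgt a)).

Variable C : numClosedFieldType.

(* Elements of G carry a component at every node, the ones at framed nodes
   being 1 (see [one_param_subgroup]). *)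
Definition act (g : forall i, 'M[C]_(N i)) (x : rep C) : rep C :=
  fun a => g (src a) *m x a *m invmx (g (tgt a)).

Definition character (sigma : node Q -> int) (g : forall i, 'M[C]_(N i)) : C :=
  \prod_(i | ~~ framed i) (\det (g i)) ^ (sigma i).

(* Homomorphisms of algebraic groups C^* -> G: the matrix coefficients are
   Laurent polynomials in t.  The value of g at t = 0 is irrelevant. *)
Definition one_param_subgroup (g : C -> forall i, 'M[C]_(N i)) :=
  [/\ forall i I J, exists (m : nat) (p : {poly C}),
        forall t, t != 0 -> g t i I J = p.[t] / t ^+ m,
      forall i, g 1 i = 1%:M,
      forall s t i, s != 0 -> t != 0 -> g (s * t) i = g s i *m g t i
    & forall t i, framed i -> t != 0 -> g t i = 1%:M].

(* lim_{t -> 0} g(t) x exists iff the morphism t |-> g(t) x from C^* to V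
   extends to the affine line. *)
Definition limit_exists (g : C -> forall i, 'M[C]_(N i)) (x : rep C) :=
  forall a I J, exists p : {poly C},
    forall t, t != 0 -> act (g t) x a I J = p.[t].

Definition semistable (sigma : node Q -> int) (x : rep C) :=
  forall g, one_param_subgroup g -> limit_exists g x ->
  forall k : int, (forall t, t != 0 -> character sigma (g t) = t ^ k) ->
  0 <= k.

End QuiverVariety.

(* A series in variables q_i is the family of its coefficients, the monomials
   being indexed by integer exponent vectors. *)
Section Series.
Variables (T : finType) (K : fieldType).

Definition expo := {ffun T -> int}.
Definition series := expo -> K.

Definition qvar (i : T) : expo := [ffun j => (j == i)%:Z].

Definition monomial (m : expo) : series := fun e => (e == m)%:R.

(* (\sum_k p_k q_v^k) * F *)
Definition mul_pseries (v : T) (p : nat -> K) (F : series) : series :=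
  fun e => \sum_(k \in [set: nat]) p k * F (e - qvar v *+ k).

(* exp (s q) *)
Definition exp_series (s : K) (k : nat) : K := s ^+ k / (k`!)%:R.

(* (1 + eps q)^c *)
Definition binomial_series (eps c : K) (k : nat) : K :=
  (\prod_(j < k) (c - j%:R)) / (k`!)%:R * eps ^+ k.

(* The expression q^(kmon) * (1 + eps q_v)^(kbin); eps and v are fixed by the
   context, see [kahler_power]. *)
Record kahler_var := KahlerVar { kmon : expo; kbin : int }.

(* \prod_i (q'_i)^(d i), expanded as a series in the variables q *)
Definition kahler_power (v : T) (eps : K) (q' : T -> kahler_var) (d : expo)
    : series :=
  mul_pseries v (binomial_series eps (\sum_i kbin (q' i) * d i)%:~R)
    (monomial (\sum_i kmon (q' i) *~ d i)).

End Series.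

Arguments mul_pseries {T K} v p F e.

Section IFunction.
Variable K : fieldType.

(* [y]_a = \prod_(l <= a) (y + l) / \prod_(l <= 0) (y + l).  For a < 0 and
   y + l = 0 with a < l <= 0 this is a pole, to which the conventions of the
   library assign the value 0; its inverse is then also 0, which is the true
   value of 1 / [y]_a. *)
Definition bracket (y : K) (a : int) : K :=
  match a with
  | Posz m => \prod_(1 <= l < m.+1) (y + l%:R)
  | Negz m => (\prod_(0 <= l < m.+1) (y - l%:R))^-1
  end.

Variables (Q : quiver) (N : node Q -> nat).

Definition degrees := {dffun forall i : node Q, {ffun 'I_(N i) -> int}}.

Definition total_degree (n : degrees) : expo (node Q) :=
  [ffun i => \sum_I n i I].

(* The integer vectors for which Z contains a semistable point with vanishing
   entries A_IJ whenever n^i_I < n^j_J *)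
Definition effective (C : numClosedFieldType) (sigma : node Q -> int)
    (Z : set (rep N C)) : set degrees :=
  [set n : degrees | (forall i I, framed i -> n i I = 0) /\
    exists x : rep N C, [/\ Z x, semistable sigma x
      & forall (a : arrow Q) I J,
          n (src a) I < n (tgt a) J -> x a I J = 0]].

Definition I_term (x : forall i, 'I_(N i) -> K) (arrows : pred (arrow Q))
    (relations : seq (node Q * node Q)) (n : degrees) : K :=
  (\prod_(i | ~~ framed i) \prod_I \prod_(J | I != J)
      bracket (x i I - x i J) (n i I - n i J))
  * (\prod_(a | arrows a) \prod_I \prod_J
      (bracket (x (src a) I - x (tgt a) J) (n (src a) I - n (tgt a) J))^-1)
  * (\prod_(r <- relations) \prod_(I < N r.1) \prod_(J < N r.2)
      bracket (x r.1 I - x r.2 J) (n r.1 I - n r.2 J)).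

(* [qpow d] is the expansion of \prod_i q_i^(d i), or of its image under a
   change of variables. *)
Definition I_function (supp : set degrees) (x : forall i, 'I_(N i) -> K)
    (arrows : pred (arrow Q)) (relations : seq (node Q * node Q))
    (qpow : expo (node Q) -> series (node Q) K) : series (node Q) K :=
  fun e => \sum_(n \in supp)
    I_term x arrows relations n * qpow (total_degree n) e.

End IFunction.

Inductive star_node := v1 | v2 | v3 | v4 | v5 | v6 | v7 | v8 | v9.

Definition star_nodes := [:: v1; v2; v3; v4; v5; v6; v7; v8; v9].
Definition star_node_code (v : star_node) : 'I_9 :=
  inord match v with
  | v1 => 0 | v2 => 1 | v3 => 2 | v4 => 3 | v5 => 4
  | v6 => 5 | v7 => 6 | v8 => 7 | v9 => 8
  end.
Lemma star_node_codeK :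
  cancel star_node_code (fun k : 'I_9 => nth v1 star_nodes k).
Proof. by case; rewrite /star_node_code /= inordK. Qed.
HB.instance Definition _ := Finite.copy star_node (can_type star_node_codeK).

Definition star_framed (v : star_node) :=
  match v with v8 | v9 => true | _ => false end.

Inductive star_arrow := a13 | a24 | a35 | a45 | a56 | a57 | a68 | a79.

Definition star_arrows := [:: a13; a24; a35; a45; a56; a57; a68; a79].
Definition star_arrow_code (a : star_arrow) : 'I_8 :=
  inord match a with
  | a13 => 0 | a24 => 1 | a35 => 2 | a45 => 3
  | a56 => 4 | a57 => 5 | a68 => 6 | a79 => 7
  end.
Lemma star_arrow_codeK :
  cancel star_arrow_code (fun k : 'I_8 => nth a13 star_arrows k).
Proof. by case; rewrite /star_arrow_code /= inordK. Qed.
HB.instance Definition _ := Finite.copy star_arrow (can_type star_arrow_codeK).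

Definition star_src (a : star_arrow) :=
  match a with
  | a13 => v1 | a24 => v2 | a35 => v3 | a45 => v4
  | a56 => v5 | a57 => v5 | a68 => v6 | a79 => v7
  end.
Definition star_tgt (a : star_arrow) :=
  match a with
  | a13 => v3 | a24 => v4 | a35 => v5 | a45 => v5
  | a56 => v6 | a57 => v7 | a68 => v8 | a79 => v9
  end.

Definition star : quiver := Quiver star_framed star_src star_tgt.

Inductive mut_arrow :=
  b13 | b24 | b53 | b54 | b65 | b75 | b36 | b37 | b46 | b47 | b68 | b79.

Definition mut_arrows :=
  [:: b13; b24; b53; b54; b65; b75; b36; b37; b46; b47; b68; b79].
Definition mut_arrow_code (b : mut_arrow) : 'I_12 :=
  inord match b with
  | b13 => 0 | b24 => 1 | b53 => 2 | b54 => 3 | b65 => 4 | b75 => 5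
  | b36 => 6 | b37 => 7 | b46 => 8 | b47 => 9 | b68 => 10 | b79 => 11
  end.
Lemma mut_arrow_codeK :
  cancel mut_arrow_code (fun k : 'I_12 => nth b13 mut_arrows k).
Proof. by case; rewrite /mut_arrow_code /= inordK. Qed.
HB.instance Definition _ := Finite.copy mut_arrow (can_type mut_arrow_codeK).

Definition mut_src (b : mut_arrow) :=
  match b with
  | b13 => v1 | b24 => v2 | b53 | b54 => v5 | b65 => v6 | b75 => v7
  | b36 | b37 => v3 | b46 | b47 => v4 | b68 => v6 | b79 => v7
  end.
Definition mut_tgt (b : mut_arrow) :=
  match b with
  | b13 => v3 | b24 => v4 | b53 => v3 | b54 => v4 | b65 | b75 => v5
  | b36 | b46 => v6 | b37 | b47 => v7 | b68 => v8 | b79 => v9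
  end.

Definition mut : quiver := Quiver star_framed mut_src mut_tgt.

Definition mut_rank (N : star_node -> nat) (v : star_node) : nat :=
  if v is v5 then (N v6 + N v7 - N v5)%N else N v.

Section Mutated.
Variable N : node mut -> nat.

Definition potential (A : comNzRingType) (x : rep N A) : A :=
    \tr (x b36 *m x b65 *m x b53) + \tr (x b37 *m x b75 *m x b53)
  + \tr (x b46 *m x b65 *m x b54) + \tr (x b47 *m x b75 *m x b54).

(* dW_x(v) is the coefficient of the indeterminate e in W (x + e v). *)
Definition critical (C : numClosedFieldType) : set (rep N C) :=
  [set x | forall v : rep N C,
    (potential (fun b => map_mx polyC (x b) + 'X *: map_mx polyC (v b)))`_1
    = 0].

End Mutated.

(* The relations A_{a6} A_{65} + A_{a7} A_{75} = 0, a = 3, 4, which cut out the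
   critical locus once the arrows 5 -> 3 and 5 -> 4 vanish *)
Definition mut_relations : seq (node mut * node mut) := [:: (v3, v5); (v4, v5)].
Definition mut_kept (b : arrow mut) : bool :=
  match b with b53 | b54 => false | _ => true end.

Definition star_phase (sigma : star_node -> int) :=
  forall i, ~~ star_framed i -> 0 < sigma i.

Definition mut_phase (sigma : star_node -> int) :=
  [/\ forall i, ~~ star_framed i -> i \notin [:: v5; v6; v7] -> 0 < sigma i,
      sigma v5 < 0, 0 < sigma v5 + sigma v6 & 0 < sigma v5 + sigma v7].

(* Weight sets of the torus fixed points.  At the framed nodes, C v8 and C v9
   are the two blocks of equivariant parameters. *)
Definition star_fixed_point (N : star_node -> nat)
    (C : star_node -> {set 'I_(N v8 + N v9)}) :=
  [/\ forall i, ~~ star_framed i -> #|C i| = N i,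
      [/\ C v1 \subset C v3, C v3 \subset C v5, C v2 \subset C v4
        & C v4 \subset C v5],
      C v5 \subset C v6 :|: C v7,
      C v6 \subset C v8 /\ C v7 \subset C v9
    & C v8 = [set lshift (N v9) I | I in 'I_(N v8)]%SET /\
      C v9 = [set rshift (N v8) J | J in 'I_(N v9)]%SET].

Definition mut_fixed_point (L : finType) (C : star_node -> {set L})
    (v : star_node) : {set L} :=
  if v is v5 then (C v6 :|: C v7) :\: C v5 else C v.

(* A numbering of the roots at a fixed point with weight sets C *)
Definition root_labels (M : star_node -> nat) (L : finType)
    (C : star_node -> {set L}) (c : forall i, 'I_(M i) -> L) :=
  forall i, injective (c i) /\ C i = [set c i I | I in 'I_(M i)]%SET.

Section EquivariantIFunctions.
Variables (R : realType) (L : nat).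

Definition equiv_field : fieldType := {fraction {mpoly R[i][L]}}.

Definition lambda (f : 'I_L) : equiv_field := FracField.tofrac 'X_f.

Variable N : star_node -> nat.

Definition star_I_function (sigma : star_node -> int)
    (x : forall i, 'I_(N i) -> equiv_field) : series star_node equiv_field :=
  @I_function equiv_field star N
    (@effective star N R[i] sigma [set: rep (Q := star) N R[i]])
    x predT [::] (@monomial star_node equiv_field).

(* The I-function of the mutated variety at the variables q', given as
   functions of the variables q *)
Definition mut_I_function (sigma : star_node -> int)
    (x : forall i, 'I_(mut_rank N i) -> equiv_field)
    (eps : equiv_field) (q' : star_node -> kahler_var star_node) :
    series star_node equiv_field :=
  @I_function equiv_field mut (mut_rank N)
    (@effective mut (mut_rank N) R[i] sigma (@critical (mut_rank N) R[i]))
    x mut_kept mut_relations (kahler_power v5 eps q').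

End EquivariantIFunctions.

Definition kahler_mut (i : star_node) : kahler_var star_node :=
  match i with
  | v5 => KahlerVar (- qvar v5) 0
  | v6 => KahlerVar (qvar v6 + qvar v5) 0
  | v7 => KahlerVar (qvar v7 + qvar v5) 0
  | _ => KahlerVar (qvar i) 0
  end.

Definition kahler_mut_binomial (i : star_node) : kahler_var star_node :=
  match i with
  | v3 | v4 => KahlerVar (qvar i) 1
  | v5 => KahlerVar (- qvar v5) 0
  | v6 => KahlerVar (qvar v6 + qvar v5) (-1)
  | v7 => KahlerVar (qvar v7 + qvar v5) (-1)
  | _ => KahlerVar (qvar i) 0
  end.

(* Main.v *)
Require Import Defs.
From HB Require Import structures.
From mathcomp Require Import all_boot all_order all_algebra perm.
From mathcomp Require Import boolp classical_sets functions fsbigop reals.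
From mathcomp.real_closed Require Import complex.
From mathcomp Require Import mpoly.
From mathcomp Require Import ring zify.

Set Implicit Arguments.
Unset Strict Implicit.
Unset Printing Implicit Defensive.

Import Order.TTheory GRing.Theory Num.Theory.
Local Open Scope ring_scope.

(** Why the identities hold.

    At a torus fixed point every factor of a term is a bracket
    [x_f - x_g]_(n_f - n_g) of weights f, g.  Since 1/[0]_a = 0 for a < 0, a
    term vanishes unless its degrees decrease along each arrow between roots
    of the same weight.  When they do decrease, the torus fixed point itself,
    whose matrices are the inclusions of weight sets, is a semistable point
    that makes the degree vector effective ([star_effective],
    [mut_effective]).  So both sums may be taken over explicit families: an
    outer part, namely the degrees at all nodes but the centre, which is
    common to the two sides, and shifts d_f >= 0 at the centre.  If n_f is the
    degree at node 6 or 7 of the weight f, the central degree of f is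
    n_f + d_f for f in C_5 on the star side, and n_f - d_f for f in the
    complement of C_5 on the mutated side ([star_series], [mut_series]).

    Fix the outer part.  Put z_f = x_f + n_f for the N weights f of nodes 6
    and 7, a_j = x_j + n_j for the m roots j of nodes 3 and 4, r = N_5 and
    r' = N - r.  The gauge factors of the centre are a ratio of Vandermonde
    products ([gauge_vandermonde]), and a Vandermonde product turns a sum over
    vectors of shifts into a determinant of one-variable series
    ([det_series]).  In the variable t = - (-1)^r' q_5, the central sum on the
    star side becomes the Wronskian of r solutions, with exponents z_f for f
    in C_5, of the hypergeometric equation
      prod_f (theta - z_f) phi = (-1)^(N + m) t prod_j (theta - a_j) phi,
      theta = t d/dt,
    and the one on the mutated side becomes the Wronskian of r' solutions of
    the adjoint equation, with exponents - z_f for the other f.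

    The matrix of pairings between derivatives of the solutions and of the
    adjoint solutions is triangular up to the order of its columns: each
    coefficient of an entry is the sum of all the residues of a rational
    function, hence is read off at infinity ([kernel_sum]).  So complementary
    minors of the two matrices of solutions are proportional, and the ratio is
    the full Wronskian, times (1 - t)^r' when m = N ([duality]).  By
    Liouville's formula the full Wronskian satisfies a first-order equation
    ([wronskian_rec]); normalized to 1 at t = 0 it is 1 when N >= m + 2,
    exp (- t) when N = m + 1, and (1 - t)^(sum_j a_j - sum_f z_f) when N = m
    ([star_sum_convolution]).  In the last case the exponent is the sum of a
    part that depends on the x only, which is the prefactor of the theorem,
    and of a part in the degrees n, which is what the change of variables
    produces on each term ([mutation_identity]). *)


(** * Divided differences and determinants of truncated series *)
Section DividedDifference.
Variables (K : fieldType) (I : finType) (p : I -> K).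
Hypothesis p_inj : injective p.

(** The sum of the residues of F / prod_i ('X - p i) is read off at infinity.
    By Lagrange interpolation F is a combination of the products
    prod_(j != i) ('X - p j), and the top coefficients are compared. *)
Lemma divided_difference (F : {poly K}) : (size F <= #|I|)%N ->
  \sum_i F.[p i] / \prod_(j | j != i) (p i - p j) = F`_(#|I|.-1).
Proof.
move=> sF.
pose B i := \prod_(j | j != i) ('X - (p j)%:P).
pose D i := \prod_(j | j != i) (p i - p j).
have sB i : size (B i) = #|I|.
  have -> : B i = \prod_(j <- enum (predC1 i)) ('X - (p j)%:P) by rewrite big_enum.
  by rewrite size_prod_XsubC -cardE cardC1 prednK //; apply/card_gt0P; exists i.
have BE i k : (B i).[p k] = if k == i then D i else 0.
  rewrite horner_prod; case: eqP => [->|/eqP ki].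
    by apply: eq_bigr => j _; rewrite !hornerE.
  by rewrite (bigD1 k) //= !hornerE subrr mul0r.
have D0 i : D i != 0.
  by apply/prodf_neq0 => j ji; rewrite subr_eq0 (inj_eq p_inj) eq_sym.
have -> : F = \sum_i (F.[p i] / D i) *: B i.
  apply/eqP; rewrite -subr_eq0; apply/eqP.
  apply: (@roots_geq_poly_eq0 _ _ (map p (enum I))).
  - apply/allP => _ /mapP[i _ ->]; rewrite /root !hornerE horner_sum.
    rewrite (bigD1 i) //= big1 => [|j ji]; last first.
      by rewrite !hornerE BE eq_sym (negPf ji) mulr0.
    by rewrite !hornerE BE eqxx divfK // subrr.
  - by rewrite map_inj_uniq ?enum_uniq.
  - rewrite size_map -cardE (leq_trans (size_polyD _ _)) // geq_max sF size_polyN.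
    apply/(leq_trans (size_sum _ _ _))/bigmax_leqP => i _.
    by rewrite (leq_trans (size_scale_leq _ _)) // sB.
rewrite coef_sum; apply: eq_bigr => i _.
rewrite coefZ horner_sum (bigD1 i) //= big1 => [|j ji]; last first.
  by rewrite !hornerE BE eq_sym (negPf ji) mulr0.
rewrite !hornerE BE eqxx divfK // -[#|I|](sB i).
have /monicP := monic_prod_XsubC (index_enum I) (fun j => j != i) p.
by rewrite lead_coefE -/(B i) => ->; rewrite mulr1.
Qed.

End DividedDifference.

Section TruncatedEquality.
Variables (A : comNzRingType) (n : nat).
Implicit Types p q : {poly A}.

(** Power series are represented by polynomials, up to a power of 'X. *)
Definition eq_upto p q := forall k, (k < n)%N -> p`_k = q`_k.

Lemma eq_uptoM p q p' q' :
  eq_upto p p' -> eq_upto q q' -> eq_upto (p * q) (p' * q').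
Proof.
move=> pp' qq' k kn; rewrite !coefM; apply: eq_bigr => i _.
rewrite pp' ?qq' // (leq_ltn_trans _ kn) ?leq_subr //.
by rewrite -ltnS.
Qed.

Lemma eq_upto_prod (I : finType) (f g : I -> {poly A}) :
  (forall i, eq_upto (f i) (g i)) -> eq_upto (\prod_i f i) (\prod_i g i).
Proof.
by move=> fg; elim/big_ind2: _ => // p q p' q' ? ?; apply: eq_uptoM.
Qed.

Lemma eq_upto_det m (B B' : 'M[{poly A}]_m) :
  (forall i j, eq_upto (B i j) (B' i j)) -> eq_upto (\det B) (\det B').
Proof.
move=> BB' k kn; rewrite !coef_sum; apply: eq_bigr => s _.
by apply: eq_uptoM kn => //; apply: eq_upto_prod.
Qed.

End TruncatedEquality.

Section Vandermonde.
Variables (K : comNzRingType).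

Definition vandermonde q (y : 'I_q -> K) :=
  \prod_(i < q) \prod_(j < q | (i < j)%N) (y j - y i).

Lemma det_powers q (y : 'I_q -> K) :
  \det (\matrix_(i < q, b < q) y b ^+ i) = vandermonde y.
Proof.
rewrite -[LHS]/(\det _) (_ : (\matrix_(i, b) _) = Vandermonde q (\row_b y b)).
  by rewrite det_Vandermonde; do 2!apply: eq_bigr => ? _; rewrite !mxE.
by apply/matrixP => i j; rewrite !mxE.
Qed.

(** The multi-index sums of the I-functions are determinants: the column b of
    the matrix is a series in one index d b, and by multilinearity the
    determinant is a sum over all the choices of these indices. *)
Lemma det_series q n (c y : 'I_q -> nat -> K) (e : 'I_q -> nat) :
  \det (\matrix_(i < q, b < q) \poly_(d < n) (c b d * y b d ^+ e i)) =
  \sum_(d : {ffun 'I_q -> 'I_n})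
     (\prod_b c b (d b) * \det (\matrix_(i < q, b < q) y b (d b) ^+ e i))
     *: 'X^(\sum_b d b).
Proof.
rewrite -det_tr {1}/determinant.
transitivity (\sum_(s : 'S_q) ((-1) ^+ s : {poly K}) *
   \sum_(d : {ffun 'I_q -> 'I_n})
   \prod_b ((c b (d b) * y b (d b) ^+ e (s b)) *: 'X^(d b))).
  apply: eq_bigr => s _; congr (_ * _).
  rewrite -(bigA_distr_bigA (fun b (d : 'I_n) =>
    (c b d * y b d ^+ e (s b)) *: 'X^d)) /=.
  by apply: eq_bigr => b _; rewrite !mxE poly_def.
under eq_bigr do rewrite mulr_sumr.
rewrite exchange_big /=; apply: eq_bigr => d _.
rewrite -det_tr mulr_sumr scaler_suml; apply: eq_bigr => s _.
rewrite scaler_prod big_split /= prodrXr -scalerAr.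
have -> : \prod_b y b (d b) ^+ e (s b) =
    \prod_i (\matrix_(i < q, b < q) y b (d b) ^+ e i)^T i (s i).
  by apply: eq_bigr => b _; rewrite !mxE.
rewrite mulrCA -scalerA.
rewrite -[(-1) ^+ s in LHS](rmorph_sign (@polyC K)) scalerAr -mul_polyC.
by rewrite -!mul_polyC !polyCM mulrCA !mulrA.
Qed.

End Vandermonde.

(** * Solutions of a hypergeometric equation and of its adjoint *)
Section Pochhammer.
Variable K : comNzRingType.

Definition poch (y : K) (d : nat) := \prod_(l < d) (y + l%:R).

Lemma poch0 y : poch y 0 = 1. Proof. by rewrite /poch big_ord0. Qed.

Lemma pochS y d : poch y d.+1 = poch y d * (y + d%:R).
Proof. by rewrite /poch big_ord_recr. Qed.

(** The factors below and above position d of a product over consecutive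
    shifts of y are Pochhammer symbols in y and in - y.  This lemma and the
    next merge a coefficient of a solution and one of an adjoint solution into
    a single rational function. *)
Lemma poch_reflect y d e :
  \prod_(l < d + e) (y + d%:R - l.+1%:R) =
  poch y d * ((-1) ^+ e * poch (1 - y) e).
Proof.
rewrite big_split_ord /=; congr (_ * _).
  rewrite [RHS](reindex_inj rev_ord_inj) /=; apply: eq_bigr => l _.
  by rewrite natrB // addrA.
rewrite -[X in (-1) ^+ X](card_ord e) -prodrN; apply: eq_bigr => l _.
by rewrite -addnS natrD -natr1; ring.
Qed.

Lemma poch_reflect_omit y d e :
  \prod_(l < (d + e).+1 | l != d :> nat) (y + d%:R - l%:R) =
  poch (1 + y) d * ((-1) ^+ e * poch (1 - y) e).
Proof.
rewrite -addSn big_mkcond big_split_ord /= big_ord_recr /= eqxx mulr1.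
congr (_ * _).
  rewrite [RHS](reindex_inj rev_ord_inj) /=; apply: eq_bigr => l _.
  by rewrite ltn_eqF // natrB // -natr1; ring.
rewrite -[X in (-1) ^+ X](card_ord e) -prodrN; apply: eq_bigr => l _.
by rewrite addSn eqn_leq ltnNge leq_addr /= -natr1 natrD; ring.
Qed.

End Pochhammer.

Section Core.
Variables (K : fieldType) (N m : nat) (z : 'I_N -> K) (a : 'I_m -> K).
Hypothesis char0 : forall k, k.+1%:R != 0 :> K.
Hypothesis z_generic : forall b b' (k : nat), b != b' -> z b - z b' + k%:R != 0.

Definition parity_sign : K := (-1) ^+ (N + m).

(** The coefficients of t^(z b) sum_d star_coef b d t^d, the solution of
      prod_b (theta - z b) phi = (-1)^(N + m) t prod_j (theta - a j) phi
    with exponent z b, where theta = t d/dt; see [star_coef_step]. *)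
Definition star_coef b d : K :=
  parity_sign ^+ d * (\prod_j poch (z b - a j) d) / \prod_b' poch (1 + (z b - z b')) d.
(** The coefficients of the solution with exponent - z b of the adjoint
    equation. *)
Definition mut_coef b d : K :=
  (\prod_j poch (1 + (a j - z b)) d) / \prod_b' poch (1 + (z b' - z b)) d.
(** The residue at z b of 1 / prod_b' (w - z b'), by which the solutions are
    paired with the adjoint solutions. *)
Definition residue b : K := (\prod_(b' | b' != b) (z b - z b'))^-1.

Lemma natr_neq0 k : (0 < k)%N -> k%:R != 0 :> K.
Proof. by case: k. Qed.

Lemma z_sub_neq0 b b' : b != b' -> z b - z b' != 0.
Proof. by move/z_generic => /(_ 0%N); rewrite addr0. Qed.

Section Kernel.
Variable k : nat.

Definition string_point (p : 'I_N * 'I_k.+1) : K := z p.1 + p.2%:R.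

Lemma string_point_inj : injective string_point.
Proof.
move=> [b l] [b' l'] /eqP; rewrite /string_point /= -subr_eq0 => /eqP E.
have [bb'|bb'] := eqVneq b b'.
  move: E; rewrite bb' opprD addrACA subrr add0r => /eqP E.
  congr (_, _); apply: val_inj => /=; move: E.
  wlog le_l : l l' / (l <= l')%N.
    move=> H E; case/orP: (leq_total l l') => le; first exact: H.
    by apply/esym/H => //; rewrite -opprB oppr_eq0.
  rewrite -opprB oppr_eq0 -natrB //.
  case: (posnP (l' - l)) => [/eqP|]; last by move/natr_neq0/negPf ->.
  by rewrite subn_eq0 => le' _; apply/eqP; rewrite eqn_leq le_l.
case/orP: (leq_total l l') => le.
  have := z_generic (l' - l) (_ : b' != b); rewrite eq_sym => /(_ bb').
  rewrite natrB // -oppr_eq0 => /eqP[].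
  by rewrite -[RHS]E; ring.
have := z_generic (l - l') bb'; rewrite natrB // => /eqP[].
by rewrite -[RHS]E; ring.
Qed.

(** The product of two coefficients of total degree k, one of a solution and
    one of an adjoint solution, is the residue at w = z b + d of one rational
    function of w, whose poles are the z b' + l for 0 <= l <= k and whose
    numerator is prod_j prod_(1 <= l <= k) (w - a j - l). *)
Lemma kernel_residue b (d : 'I_k.+1) :
  star_coef b d * (residue b * mut_coef b (k - d)) =
  parity_sign ^+ k * (\prod_j \prod_(l < k) (string_point (b, d) - (a j + l.+1%:R)))
  / \prod_(p | p != (b, d)) (string_point (b, d) - string_point p).
Proof.
have ke : (d + (k - d))%N = k by rewrite subnKC // -ltnS.
move: (k - d)%N ke => e ke.
have numE : \prod_j \prod_(l < k) (string_point (b, d) - (a j + l.+1%:R)) =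
    \prod_j (poch (z b - a j) d * ((-1) ^+ e * poch (1 + (a j - z b)) e)).
  apply: eq_bigr => j _; rewrite -[a j - z b]opprB -poch_reflect ke.
  by apply: eq_bigr => l _; rewrite /string_point /=; ring.
have denE : \prod_(p | p != (b, d)) (string_point (b, d) - string_point p) =
   (\prod_(b' | b' != b) (z b - z b')) *
   \prod_b' (poch (1 + (z b - z b')) d * ((-1) ^+ e * poch (1 + (z b' - z b)) e)).
  have rowE b' : \prod_(l < k.+1 | l != d) (string_point (b, d) - string_point (b', l)) =
      poch (1 + (z b - z b')) d * ((-1) ^+ e * poch (1 + (z b' - z b)) e).
    rewrite -[z b' - z b]opprB -poch_reflect_omit ke.
    by apply: eq_bigr => l _; rewrite /string_point /=; ring.
  rewrite (bigID (fun p => p.1 == b)) /= [X in _ = _ * X](bigD1 b) //= mulrCA.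
  congr (_ * _).
    rewrite -rowE (reindex_onto (fun l => (b, l)) snd) /=; last first.
      by move=> [b' l] /andP[_ /eqP /= ->].
    by apply: eq_bigl => l; rewrite xpair_eqE !eqxx !andbT.
  rewrite -big_split /=.
  transitivity (\prod_(p | predC1 b p.1 && xpredT p.2) (string_point (b, d) - string_point p)).
    apply: eq_bigl => -[b' l] /=; rewrite xpair_eqE andbT.
    by case: (b' == b); rewrite ?andbF.
  rewrite -(pair_big (predC1 b) xpredT (fun b' l => string_point (b, d) - string_point (b', l))) /=.
  apply: eq_bigr => b' _; rewrite (bigD1 d) //= rowE; congr (_ * _).
  by rewrite /string_point /=; ring.
rewrite numE denE /star_coef /mut_coef /residue !big_split /= !prodr_const !card_ord.
have sgnE : parity_sign ^+ k = parity_sign ^+ d * ((-1) ^+ e ^+ N * (-1) ^+ e ^+ m).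
  transitivity (parity_sign ^+ (d + e)); first by rewrite ke.
  rewrite exprD; congr (_ * _).
  by rewrite /parity_sign -!exprM -exprD -mulnDr mulnC.
have sq l : ((-1) ^+ e ^+ l)^-1 = (-1) ^+ e ^+ l :> K.
  by rewrite -exprM -signr_odd; case: odd; rewrite ?expr1 ?expr0 ?invrN invr1.
have ss l : (-1) ^+ e ^+ l * (-1) ^+ e ^+ l = 1 :> K.
  by rewrite -expr2 -[_ ^+ e ^+ l]exprM sqrr_sign.
rewrite sgnE !invfM sq.
move: (ss N) (ss m).
move: ((-1) ^+ e ^+ N) ((-1) ^+ e ^+ m) => EN Em EN2 Em2.
move: (parity_sign ^+ d) (_^-1) (_^-1) (_^-1) => sd v r v'.
move: (\prod_j _) (\prod_j _) => u u'.
transitivity ((EN * EN) * (Em * Em) * (sd * u' * v' * (r * (u * v)))).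
  by rewrite EN2 Em2 !mul1r.
ring.
Qed.

End Kernel.

Lemma parity_sign_balanced : m = N -> parity_sign = 1.
Proof. by move=> mN; rewrite /parity_sign mN -signr_odd oddD addbb. Qed.

(** The left side is the coefficient of t^k in the pairing of the i-th
    derivatives of the solutions with the j-th derivatives of the adjoint
    ones.  With w = z b + d one has k - d - z b = k - w, so it is the sum of
    all the residues of w^i (k - w)^j times the rational function of
    [kernel_residue].  The degree of this function is at most -1, so only a
    leading coefficient can contribute. *)
Lemma kernel_sum k i j : (i + j < N)%N -> (m <= N)%N ->
  \sum_b \sum_(d < k.+1) (star_coef b d * (z b + d%:R) ^+ i) *
     (residue b * (mut_coef b (k - d) * ((k - d)%:R - z b) ^+ j)) =
  (-1) ^+ j *+ (((i + j).+1 == N) && ((m == N) || (k == 0)%N)).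
Proof.
move=> ijN mN.
pose G : {poly K} := \prod_(jl : 'I_m * 'I_k) ('X - (a jl.1 + jl.2.+1%:R)%:P).
pose F : {poly K} := 'X^i * ('X - k%:R%:P) ^+ j * G.
have Gm : G \is monic by rewrite monic_prod_XsubC.
have Fm : F \is monic by rewrite !monicMl ?monicXn ?monic_exp ?monicXsubC.
have sG : size G = (m * k).+1.
  by rewrite size_prod_XsubC /index_enum -enumT -cardE card_prod !card_ord.
have sF : size F = (i + j + m * k).+1.
  rewrite size_Mmonic // ?monic_neq0 ?monicMl ?monicXn ?monic_exp ?monicXsubC //.
  rewrite size_monicM ?monicXn ?monic_neq0 ?monic_exp ?monicXsubC //.
  by rewrite size_polyXn size_exp_XsubC sG; lia.
have card_str : #|{: 'I_N * 'I_k.+1}| = (N * k.+1)%N by rewrite card_prod !card_ord.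
have Nk : (i + j + m * k <= (N * k.+1).-1)%N by nia.
transitivity (parity_sign ^+ k * (-1) ^+ j * F`_(N * k.+1).-1).
  rewrite -card_str -(divided_difference (@string_point_inj k)); last first.
    by rewrite sF card_str; nia.
  rewrite pair_big /= mulr_sumr; apply: eq_bigr => -[b d] _ /=.
  have wE : (k - d)%:R - z b = - (string_point (b, d) - k%:R).
    by rewrite /string_point /= natrB -1?ltnS //; ring.
  have -> : F.[string_point (b, d)] = (z b + d%:R) ^+ i * (string_point (b, d) - k%:R) ^+ j
      * \prod_l \prod_(l0 < k) (string_point (b, d) - (a l + l0.+1%:R)).
    rewrite /F /G !hornerE horner_prod; congr (_ * _).
    by rewrite pair_big /=; apply: eq_bigr => l _; rewrite !hornerE.
  rewrite wE [(- (_ - _)) ^+ j]exprNn.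
  set x := _ ^+ i; set y := (_ - _) ^+ j.
  transitivity (star_coef b d * (residue b * mut_coef b (k - d)) * (x * ((-1) ^+ j * y))).
    by ring.
  by rewrite kernel_residue; ring.
(* The degree is -1 exactly when i + j = N - 1 and (N - m) k = 0. *)
have [kN|kN] := boolP ((i + j + m * k)%N == (N * k.+1).-1).
  rewrite -(eqP kN) (_ : F`_ _ = lead_coef F); last by rewrite lead_coefE sF.
  rewrite (monicP Fm) mulr1.
  have -> : ((i + j).+1 == N) = true by apply/eqP; nia.
  have [mE|mE] := eqVneq m N; first by rewrite parity_sign_balanced // expr1n mul1r.
  have k0 : k = 0%N by move/eqP: kN => kN; move/eqP: mE => mE; nia.
  by rewrite k0 expr0 mul1r.
rewrite nth_default; last by rewrite sF ltn_neqAle kN.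
rewrite mulr0; case: eqP => // ij; case: eqP => mE /=; first by exfalso; nia.
by case: eqP => k0 //; exfalso; nia.
Qed.


Section Sums.
Variables (n q : nat) (f : 'I_q -> 'I_N).

(** The Wronskian of the solutions with exponents z (f b), without its power
    of t, divided by its value at t = 0; only coefficients of degree at most n
    are meaningful. *)
Definition star_sum : {poly K} := \sum_(d : {ffun 'I_q -> 'I_n.+1})
  (\prod_b star_coef (f b) (d b) *
   (vandermonde (fun b => z (f b) + (d b)%:R) / vandermonde (z \o f))) *: 'X^(\sum_b d b).

Definition mut_sum : {poly K} := \sum_(d : {ffun 'I_q -> 'I_n.+1})
  (\prod_b mut_coef (f b) (d b) *
   (vandermonde (fun b => z (f b) - (d b)%:R) / vandermonde (z \o f))) *: 'X^(\sum_b d b).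

Hypothesis f_inj : injective f.

Lemma vandermonde_neq0 : vandermonde (z \o f) != 0.
Proof.
apply/prodf_neq0 => i _; apply/prodf_neq0 => j ij; apply: z_sub_neq0.
by rewrite (inj_eq f_inj) -val_eqE gtn_eqF.
Qed.

Lemma vandermonde_opp_ratio (y y' : 'I_q -> K) :
  vandermonde (fun b => - y b) / vandermonde (fun b => - y' b) = vandermonde y / vandermonde y'.
Proof.
rewrite /vandermonde -!prodf_div; apply: eq_bigr => i _; rewrite -!prodf_div.
by apply: eq_bigr => j _; rewrite -!opprD invrN mulrNN.
Qed.

Lemma det_star_coef :
  \det (\matrix_(i < q, b < q)
     \poly_(d < n.+1) (star_coef (f b) d * (z (f b) + d%:R) ^+ i))
  = (vandermonde (z \o f))%:P * star_sum.
Proof.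
rewrite (det_series n.+1 (fun b => star_coef (f b)) (fun b d => z (f b) + d%:R) val) /=.
rewrite mulr_sumr; apply: eq_bigr => d _.
rewrite det_powers mul_polyC scalerA; congr (_ *: _).
by rewrite mulrCA [vandermonde (z \o f) * _]mulrCA divff ?mulr1 // vandermonde_neq0.
Qed.

(** The value at t = 0 of the determinant of [det_mut_coef].  Its columns run
    through decreasing powers, whence the sign of the reversal. *)
Definition mut_norm : K := (\prod_b residue (f b)) *
  ((-1) ^+ perm (@rev_ord_inj q) * vandermonde (fun b => - z (f b))).

Lemma mut_norm_neq0 : mut_norm != 0.
Proof.
rewrite !mulf_neq0 ?signr_eq0 //.
  apply/prodf_neq0 => b _; rewrite invr_eq0; apply/prodf_neq0 => b' bb'.
  by rewrite z_sub_neq0 // eq_sym.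
apply: contraNneq vandermonde_neq0 => /eqP v0; apply/eqP.
have := vandermonde_opp_ratio (z \o f) (z \o f); rewrite /comp (eqP v0) mul0r.
by move/esym/eqP; rewrite mulf_eq0 invr_eq0 orbb => /eqP.
Qed.

Lemma det_mut_coef :
  \det (\matrix_(b < q, j < q) \poly_(d < n.+1)
     (residue (f b) * (mut_coef (f b) d * (d%:R - z (f b)) ^+ rev_ord j)))
  = mut_norm%:P * mut_sum.
Proof.
rewrite -det_tr (_ : _^T = \matrix_(i < q, b < q) \poly_(d < n.+1)
  (residue (f b) * mut_coef (f b) d * (d%:R - z (f b)) ^+ rev_ord i)); last first.
  by apply/matrixP => i j; rewrite !mxE; apply: eq_poly => d _; rewrite mulrA.
rewrite (det_series n.+1 (fun b d => residue (f b) * mut_coef (f b) d)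
  (fun b d => d%:R - z (f b)) (fun i => val (rev_ord i))) /=.
rewrite mulr_sumr; apply: eq_bigr => d _.
rewrite mul_polyC scalerA; congr (_ *: _).
set y := fun b => (d b)%:R - z (f b).
rewrite (_ : (\matrix_(i, b) _) =
    row_perm (perm (@rev_ord_inj q)) (\matrix_(i < q, b < q) y b ^+ i)); last first.
  by apply/matrixP => i j; rewrite !mxE permE.
rewrite row_permE det_mulmx det_perm det_powers big_split /=.
rewrite -(vandermonde_opp_ratio _ (z \o f)) /mut_norm.
rewrite (_ : vandermonde (fun b => - (z (f b) - (d b)%:R)) = vandermonde y); last first.
  by do 2!apply: eq_bigr => ? _; rewrite /y !opprB.
have : vandermonde (fun b => - z (f b)) != 0.
  by have := mut_norm_neq0; rewrite /mut_norm !mulf_eq0 !negb_or => /andP[_ /andP[_]].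
rewrite -[fun b => - (z \o f) b]/(fun b => - z (f b)).
move: (vandermonde _) => v v0; rewrite -!mulrA; congr (_ * _).
by rewrite [v * _]mulrC -!mulrA mulVf // mulr1 mulrCA.
Qed.

End Sums.

End Core.

Lemma coef_multisum (K : fieldType) q n (F : {ffun 'I_q -> 'I_n} -> K) k :
  (\sum_(d : {ffun 'I_q -> 'I_n}) F d *: 'X^(\sum_b d b))`_k =
  \sum_(d : {ffun 'I_q -> 'I_n} | (\sum_b d b == k)%N) F d.
Proof.
rewrite coef_sum [RHS]big_mkcond; apply: eq_bigr => d _.
by rewrite coefZ coefXn eq_sym; case: eqP; rewrite ?mulr1 ?mulr0.
Qed.

(** * Duality of complementary Wronskians *)
Section Duality.
Variables (K : fieldType) (r r' m n : nat).
Variables (z : 'I_(r + r') -> K) (a : 'I_m -> K).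
Hypothesis char0 : forall k, k.+1%:R != 0 :> K.
Hypothesis z_generic : forall b b' (k : nat), b != b' -> z b - z b' + k%:R != 0.
Hypothesis m_le : (m <= r + r')%N.

Lemma coef0_star_sum q (f : 'I_q -> 'I_(r + r')) : injective f -> (star_sum z a n f)`_0 = 1.
Proof.
move=> f_inj; rewrite coef_multisum (big_pred1 [ffun=> ord0]).
  rewrite big1 => [|b _]; last first.
    rewrite ffunE /star_coef expr0 !big1 ?mul1r ?invr1 // => *; exact: poch0.
  rewrite mul1r (_ : vandermonde _ = vandermonde (z \o f)) ?divff //.
    exact: vandermonde_neq0.
  by apply: eq_bigr => i _; apply: eq_bigr => j _; rewrite !ffunE !addr0.
move=> d; rewrite sum_nat_eq0; apply/forallP/eqP => [d0|-> b].
  by apply/ffunP => b; rewrite ffunE; apply/val_inj/eqP/d0.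
by rewrite ffunE.
Qed.

Lemma coef0_mut_sum q (f : 'I_q -> 'I_(r + r')) : injective f -> (mut_sum z a n f)`_0 = 1.
Proof.
move=> f_inj; rewrite coef_multisum (big_pred1 [ffun=> ord0]).
  rewrite big1 => [|b _]; last first.
    rewrite ffunE /mut_coef !big1 ?mul1r ?invr1 // => *; exact: poch0.
  rewrite mul1r (_ : vandermonde _ = vandermonde (z \o f)) ?divff //.
    exact: vandermonde_neq0.
  by apply: eq_bigr => i _; apply: eq_bigr => j _; rewrite !ffunE !subr0.
move=> d; rewrite sum_nat_eq0; apply/forallP/eqP => [d0|-> b].
  by apply/ffunP => b; rewrite ffunE; apply/val_inj/eqP/d0.
by rewrite ffunE.
Qed.

(* The series 1 / (1 - t) if m = r + r', and 1 otherwise *)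
Let u : {poly K} := \poly_(k < n.+1) ((m == r + r')%N || (k == 0)%N)%:R.

Let M := \matrix_(i < r + r', b < r + r')
  \poly_(d < n.+1) (star_coef z a b d * (z b + d%:R) ^+ i).
Let P := \matrix_(b < r + r', j < r') \poly_(d < n.+1)
  (residue z b * (mut_coef z a b d * (d%:R - z b) ^+ rev_ord j)).

Lemma coef_pairing (i : 'I_(r + r')) (j : 'I_r') k : (k < n.+1)%N -> (i + rev_ord j < r + r')%N ->
  ((M *m P) i j)`_k =
  (-1) ^+ rev_ord j *+ (((i + rev_ord j).+1 == r + r')%N && ((m == r + r')%N || (k == 0)%N)).
Proof.
move=> kn ij; rewrite -(kernel_sum a char0 z_generic) //.
rewrite mxE coef_sum; apply: eq_bigr => b _.
rewrite coefM; apply: eq_bigr => d _; rewrite !mxE !coef_poly.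
have dk := ltn_ord d; rewrite ltnS in dk.
by rewrite (leq_ltn_trans dk kn) (leq_ltn_trans (leq_subr d k) kn).
Qed.

Let T := \matrix_(i < r', j < r')
  if (i < j)%N then 0
  else if i == j then (-1) ^+ rev_ord j *: u else (M *m P) (rshift r i) j.

(** All pairings of orders i < r and r' - 1 - j < r' vanish, as the orders add
    up to at most r + r' - 2.  The remaining r' x r' block is lower triangular
    because the adjoint derivatives are listed in decreasing order. *)
Lemma pairing_block_triangular : forall i j, eq_upto n.+1
  ((M *m row_mx (col_mx 1%:M 0) P) i j)
  (block_mx (ulsubmx M) 0 (dlsubmx M) T i j).
Proof.
have ltr (j : 'I_r') : (r' = (rev_ord j + j).+1)%N.
  by rewrite /= -addnS subnK.
move=> i j; rewrite mul_mx_row block_mxEh.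
rewrite (_ : M *m col_mx 1%:M 0 = col_mx (ulsubmx M) (dlsubmx M)); last first.
  rewrite -[M in LHS]hsubmxK mul_row_col mulmx1 mulmx0 addr0.
  by rewrite -[lsubmx M in LHS]vsubmxK; congr col_mx; apply/matrixP => ? ?; rewrite !mxE.
rewrite -(splitK j) /unsplit; case: (fintype.split j) => {}j; first by rewrite !row_mxEl.
rewrite !row_mxEr -(splitK i) /unsplit; case: (fintype.split i) => {}i k kn.
  rewrite col_mxEu [in RHS]mxE coef0 coef_pairing //=.
    rewrite (_ : (_ == _) = false) //.
    by have := ltr j; have := ltn_ord i; move=> /=; lia.
  by have := ltr j; have := ltn_ord i; move=> /=; lia.
rewrite col_mxEd [in RHS]mxE; case: ifP => ij.
  rewrite coef0 coef_pairing //=; first rewrite (_ : (_ == _) = false) //.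
    by have := ltr j; move=> /=; lia.
  by have := ltr j; move=> /=; lia.
case: eqP => [<-|//]; rewrite coefZ coef_poly kn coef_pairing //=.
  rewrite (_ : (_ == _) = true) /=; last by have := ltr i; move=> /=; lia.
  by case: (_ || _); rewrite ?mulr1 ?mulr0.
by have := ltr i; move=> /=; lia.
Qed.

(** Jacobi's theorem on complementary minors.  Let M be the matrix of the
    derivatives of all the solutions, and P the one of the derivatives of
    order < r' of the adjoint solutions.  Multiplying M by the matrix with
    block columns (1, 0) and P gives a block triangular matrix, whose upper
    left block is the r x r corner of M.  Hence det M times the lower r' x r'
    minor of P is the r x r minor of M times the determinant of a triangular
    block with diagonal entries +u or -u. *)
Lemma duality : eq_upto n.+1
  (star_sum z a n id * mut_sum z a n (@rshift r r'))
  (star_sum z a n (@lshift r r') * u ^+ r').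
Proof.
have id_inj : injective (@id 'I_(r + r')) by [].
have l_inj := @lshift_inj r r'; have r_inj := @rshift_inj r r'.
pose c1 := vandermonde (z \o id); pose c2 := mut_norm z (@rshift r r').
pose c3 := vandermonde (z \o @lshift r r').
pose c4 : K := \prod_(j < r') (-1) ^+ rev_ord j.
have E : eq_upto n.+1
    ((c1%:P * star_sum z a n id) * (c2%:P * mut_sum z a n (@rshift r r')))
    ((c3%:P * star_sum z a n (@lshift r r')) * (c4%:P * u ^+ r')).
  rewrite -!det_star_coef // -det_mut_coef //.
  have := eq_upto_det pairing_block_triangular.
  rewrite det_mulmx det_lblock.
  have -> : \det T = c4%:P * u ^+ r'.
    rewrite det_trig; last first.
      by apply/is_trig_mxP => i j ij; rewrite mxE ij.
    rewrite mul_polyC -[X in u ^+ X](card_ord r') -prodr_const -scaler_prod.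
    by apply: eq_bigr => j _; rewrite mxE ltnn eqxx.
  have -> : \det (row_mx (col_mx 1%:M 0) P) = \det (dsubmx P).
    by rewrite -{1}[P]vsubmxK -block_mxEh det_ublock det1 mul1r.
  have -> : ulsubmx M = \matrix_(i < r, b < r) \poly_(d < n.+1)
      (star_coef z a (lshift r' b) d * (z (lshift r' b) + d%:R) ^+ i).
    by apply/matrixP => i b; rewrite !mxE.
  have -> : dsubmx P = \matrix_(b < r', j < r') \poly_(d < n.+1)
      (residue z (rshift r b) * (mut_coef z a (rshift r b) d *
        (d%:R - z (rshift r b)) ^+ rev_ord j)).
    by apply/matrixP => b j; rewrite !mxE.
  by [].
have c12 : c1 * c2 != 0.
  by rewrite mulf_neq0 ?vandermonde_neq0 ?mut_norm_neq0.
have u0 : u`_0 = 1 by rewrite coef_poly orbT.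
have ur0 : (u ^+ r')`_0 = 1.
  by elim: (r') => [|l IHl]; rewrite ?expr0 ?coef1 // exprS coef0M u0 mul1r.
(* The constants agree because all the series start with 1. *)
have c1234 : c1 * c2 = c3 * c4.
  have := E 0%N isT; rewrite !coef0M !coefC /= !coef0_star_sum // coef0_mut_sum //.
  by rewrite ur0 !mulr1.
move=> k kn; apply: (mulfI c12); rewrite {2}c1234.
have := E k kn.
by rewrite mulrACA -polyCM coefCM mulrACA -polyCM coefCM.
Qed.

End Duality.

(** * The full Wronskian *)
Section Normalization.
Variables (K : fieldType).

(** Up to a sign that depends only on I, the variable X I occurs in a
    Vandermonde product through prod_(J != I) (X I - X J). *)
Lemma vandermonde_factor q (X : 'I_q -> K) (I : 'I_q) :
  vandermonde X = (-1) ^+ #|[pred j : 'I_q | (I < j)%N]| *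
   (\prod_(i < q | i != I) \prod_(j < q | (i < j)%N && (j != I)) (X j - X i)) *
   \prod_(J | J != I) (X I - X J).
Proof.
rewrite /vandermonde (bigD1 I) //=.
have -> : \prod_(i < q | i != I) \prod_(j < q | (i < j)%N) (X j - X i) =
    (\prod_(i < q | i != I) \prod_(j < q | (i < j)%N && (j != I)) (X j - X i)) *
    \prod_(i < q | (i < I)%N) (X I - X i).
  transitivity (\prod_(i | i != I)
     ((if (i < I)%N then X I - X i else 1) *
      \prod_(j < q | (i < j)%N && (j != I)) (X j - X i))).
    apply: eq_bigr => i iI; case: ifP => iltI; first by rewrite (bigD1 I).
    rewrite mul1r; apply: eq_bigl => j.
    by case: eqP => [->|_]; rewrite ?iltI ?andbT.
  rewrite big_split mulrC /= -big_mkcondr; congr (_ * _).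
  by apply: eq_bigl => i; rewrite -val_eqE /= andbC; case: ltngtP.
rewrite [X in _ = _ * X](bigID (fun J : 'I_q => (J < I)%N)) /=.
have -> : \prod_(j < q | (I < j)%N) (X j - X I) =
    (-1) ^+ #|[pred j : 'I_q | (I < j)%N]| * \prod_(j < q | (I < j)%N) (X I - X j).
  by rewrite -prodrN; apply: eq_bigr => j _; rewrite opprB.
have -> : \prod_(i < q | (i != I) && (i < I)%N) (X I - X i) =
   \prod_(i < q | (i < I)%N) (X I - X i).
  by apply: eq_bigl => i; rewrite -val_eqE /= ; case: ltngtP.
have -> : \prod_(i < q | (i != I) && ~~ (i < I)%N) (X I - X i) =
   \prod_(i < q | (I < i)%N) (X I - X i).
  by apply: eq_bigl => i; rewrite -val_eqE /= ; case: ltngtP.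
by ring.
Qed.

Lemma vandermonde_shift q (X Y : 'I_q -> K) (I : 'I_q) :
  (forall J, J != I -> X J = Y J) ->
  vandermonde X * \prod_(J | J != I) (Y I - Y J) = vandermonde Y * \prod_(J | J != I) (X I - X J).
Proof.
move=> XY; rewrite !(vandermonde_factor _ I).
have -> : \prod_(i < q | i != I) \prod_(j < q | (i < j)%N && (j != I)) (X j - X i) =
   \prod_(i < q | i != I) \prod_(j < q | (i < j)%N && (j != I)) (Y j - Y i).
  by apply: eq_bigr => i iI; apply: eq_bigr => j /andP[_ jI]; rewrite !XY.
by rewrite mulrAC.
Qed.

Lemma lagrange_sum_lt N m (X : 'I_N -> K) (y : 'I_m -> K) :
  injective X -> (m < N)%N ->
  \sum_I (\prod_j (X I - y j)) / \prod_(J | J != I) (X I - X J) = (m.+1 == N)%:R.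
Proof.
move=> X_inj mN; pose F := \prod_j ('X - (y j)%:P).
have sF : size F = m.+1 by rewrite size_prod_XsubC /index_enum -enumT size_enum_ord.
have := divided_difference X_inj (F := F); rewrite card_ord sF => /(_ mN).
under eq_bigr do rewrite horner_prod; under eq_bigr do under eq_bigr do rewrite !hornerE.
move=> ->; case: eqP => [mE|mE]; last by rewrite nth_default // sF; lia.
have /monicP : F \is monic by rewrite monic_prod_XsubC.
by rewrite lead_coefE sF -mE.
Qed.

Lemma lagrange_sum_eq N (X y : 'I_N -> K) :
  injective X ->
  \sum_I (\prod_j (X I - y j)) / \prod_(J | J != I) (X I - X J) =
  \sum_I X I - \sum_I y I.
Proof.
case: N X y => [|N] X y X_inj; first by rewrite !big_ord0 subrr.
pose G (x : 'I_N.+1 -> K) := \prod_j ('X - (x j)%:P).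
have sG x : size (G x) = N.+2.
  by rewrite size_prod_XsubC /index_enum -enumT size_enum_ord.
have cG x : (G x)`_N = - \sum_I x I.
  have -> : G x = \prod_(p <- map x (enum 'I_N.+1)) ('X - p%:P).
    by rewrite big_map big_enum.
  have := @coefPn_prod_XsubC _ (map x (enum 'I_N.+1)).
  by rewrite size_map size_enum_ord /= => ->; rewrite // big_map big_enum.
have lG x : (G x)`_N.+1 = 1.
  have /monicP : G x \is monic by rewrite monic_prod_XsubC.
  by rewrite lead_coefE sG.
(* Subtracting G X lowers the degree and changes no value at the X I. *)
have := divided_difference X_inj (F := G y - G X); rewrite card_ord /=.
have -> : \sum_I X I - \sum_I y I = (G y - G X)`_N.
  by rewrite coefB !cG opprK addrC.
move=> <-; last first.
  apply/leq_sizeP => j; rewrite leq_eqVlt => /predU1P[<-|lt_j].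
    by rewrite coefB !lG subrr.
  by rewrite coefB !nth_default ?subrr // sG.
apply: eq_bigr => I _; rewrite hornerD hornerN !horner_prod.
rewrite [X in _ - X](bigD1 I) //= hornerXsubC subrr mul0r subr0.
by under [in RHS]eq_bigr do rewrite hornerXsubC.
Qed.

End Normalization.


Section WronskianRecurrence.
Variables (K : fieldType) (N m n : nat) (z : 'I_N -> K) (a : 'I_m -> K).
Hypothesis char0 : forall k, k.+1%:R != 0 :> K.
Hypothesis z_generic : forall b b' (k : nat), b != b' -> z b - z b' + k%:R != 0.

Let X (d : {ffun 'I_N -> 'I_n.+1}) b := z b + (d b)%:R.
Let w (d : {ffun 'I_N -> 'I_n.+1}) :=
  \prod_b star_coef z a b (d b) * (vandermonde (X d) / vandermonde (z \o id)).
Let deg (d : {ffun 'I_N -> 'I_n.+1}) := (\sum_b d b)%N.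

Lemma shifted_inj d : injective (X d).
Proof.
by move=> b b' /(@string_point_inj _ _ _ char0 z_generic n (b, d b) (b', d b')) [].
Qed.

(** The hypergeometric equation, read on coefficients. *)
Lemma star_coef_step b d :
  star_coef z a b d.+1 * \prod_b' (z b + d.+1%:R - z b') =
  parity_sign K N m * star_coef z a b d * \prod_j (z b + d%:R - a j).
Proof.
rewrite /star_coef exprS; under eq_bigr do rewrite pochS.
under [\prod_b' poch _ d.+1]eq_bigr do rewrite pochS.
have E : \prod_(b' < N) (1 + (z b - z b') + d%:R) = \prod_b' (z b + d.+1%:R - z b').
  by apply: eq_bigr => b' _; rewrite -natr1; ring.
have E0 : \prod_b' (z b + d.+1%:R - z b') != 0.
  apply/prodf_neq0 => b' _; rewrite addrAC.
  by have [->|bb'] := eqVneq b b'; rewrite ?subrr ?add0r // z_generic.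
have Ea : \prod_j (z b - a j + d%:R) = \prod_j (z b + d%:R - a j).
  by apply: eq_bigr => b' _; ring.
rewrite !big_split /= E Ea invfM.
by rewrite !mulrA mulfVK //; ring.
Qed.

(* The I-th part of the d-th term of theta W, see [term_sum] *)
Let term d I := w d * ((\prod_b (X d I - z b)) / \prod_(J | J != I) (X d I - X d J)).

Definition incr (I : 'I_N) (d : {ffun 'I_N -> 'I_n.+1}) : {ffun 'I_N -> 'I_n.+1} :=
  [ffun b => if b == I then inord (d b).+1 else d b].
Definition decr (I : 'I_N) (d : {ffun 'I_N -> 'I_n.+1}) : {ffun 'I_N -> 'I_n.+1} :=
  [ffun b => if b == I then inord (d b).-1 else d b].

(** Raising d I by one trades prod_b (X I - z b) for prod_j (X I - a j), by
    [star_coef_step]; the rest of the term does not involve X I, by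
    [vandermonde_shift]. *)
Lemma term_incr (d : {ffun 'I_N -> 'I_n.+1}) I : (d I < n)%N ->
  term (incr I d) I =
  parity_sign K N m * (w d * ((\prod_j (X d I - a j)) / \prod_(J | J != I) (X d I - X d J))).
Proof.
move=> dIn; rewrite /term /w.
have dI : incr I d I = (d I).+1 :> nat by rewrite ffunE eqxx inordK.
have dJ J : J != I -> incr I d J = d J by rewrite ffunE => /negPf ->.
have nz e : \prod_(J | J != I) (X e I - X e J) != 0.
  apply/prodf_neq0 => J JI; rewrite subr_eq0 (inj_eq (@shifted_inj e)) eq_sym //.
have V : vandermonde (X (incr I d)) / \prod_(J | J != I) (X (incr I d) I - X (incr I d) J)
   = vandermonde (X d) / \prod_(J | J != I) (X d I - X d J).
  apply/eqP; rewrite eqr_div //; apply/eqP/vandermonde_shift => J JI.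
  by rewrite /X dJ.
rewrite (bigD1 I) //= (eq_bigr (fun b => star_coef z a b (d b))); last first.
  by move=> J JI; rewrite dJ.
rewrite [\prod_b star_coef z a b (d b)](bigD1 I) //=.
have S := star_coef_step I (d I); rewrite -dI -/(X (incr I d) I) -/(X d I) in S.
set rest := \prod_(i | i != I) _; set cd := star_coef _ _ _ _; set cd' := star_coef z a I (d I).
transitivity ((cd * \prod_b (X (incr I d) I - z b)) * rest / vandermonde (z \o id) *
  (vandermonde (X (incr I d)) / \prod_(J | J != I) (X (incr I d) I - X (incr I d) J))).
  by ring.
by rewrite V S -/cd'; ring.
Qed.

Lemma term_sum d : \sum_I term d I = w d * (deg d)%:R.
Proof.
rewrite -mulr_sumr lagrange_sum_eq; last exact: shifted_inj.
by rewrite /X big_split /= [\sum_b z b + _]addrC addrK /deg natr_sum.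
Qed.

(** The bound k < n ensures that no shift reaches the end of 'I_n.+1. *)
Lemma reindex_incr k I (F : {ffun 'I_N -> 'I_n.+1} -> K) : (k < n)%N ->
  \sum_(d : {ffun 'I_N -> 'I_n.+1} | (deg d == k.+1) && (0 < d I)%N) F d =
  \sum_(d | deg d == k) F (incr I d).
Proof.
move=> kn.
have decrK (d : {ffun 'I_N -> 'I_n.+1}) : (0 < d I)%N -> incr I (decr I d) = d.
  move=> d0; apply/ffunP => b; rewrite !ffunE; case: eqP => // ->.
  have E : ((d I).-1 < n.+1)%N by rewrite (leq_ltn_trans (leq_pred _)).
  by apply: val_inj; rewrite /= (inordK E) prednK // inordK.
rewrite (reindex_onto (incr I) (decr I)) => [|d /andP[_ /decrK //]].
apply: eq_bigl => d.
have [dn|dn] := ltnP (d I) n.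
  have dI : incr I d I = (d I).+1 :> nat by rewrite ffunE eqxx inordK.
  have dK : decr I (incr I d) = d.
    apply/ffunP => b; rewrite !ffunE; case: eqP => // ->.
    by apply: val_inj; rewrite /= !inordK //= ltnW.
  rewrite dK eqxx andbT dI andbT /deg (bigD1 I) //= dI [in RHS](bigD1 I) //=.
  rewrite (eq_bigr (fun b => d b : nat)) => [|J /negPf JI]; last by rewrite ffunE JI.
  by rewrite addSn eqSS.
rewrite ffunE eqxx (_ : inord _ = ord0); last first.
  by apply: val_inj; rewrite /= /inord /insubd insubF //= ltnNge ltnS dn.
rewrite andbF /=; apply/esym/negP => /eqP E.
by move: kn; rewrite -E ltnNge (leq_trans dn) // /deg (bigD1 I) //= leq_addr.
Qed.

(** Liouville's formula theta W = t (...): the sum over I of the residues of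
    prod_b (w - z b) / prod_J (w - X J) multiplies a term of W by its degree,
    and each of these residues comes from a term of degree one less. *)
Lemma wronskian_rec k : (k < n)%N ->
  k.+1%:R * (star_sum z a n id)`_k.+1 =
  parity_sign K N m * \sum_(d | deg d == k) w d *
    \sum_I (\prod_j (X d I - a j)) / \prod_(J | J != I) (X d I - X d J).
Proof.
move=> kn; rewrite coef_multisum.
transitivity (\sum_(d | deg d == k.+1) \sum_I term d I).
  by rewrite mulr_sumr; apply: eq_bigr => d /eqP dk; rewrite term_sum /deg dk mulrC.
rewrite exchange_big /= mulr_sumr.
under [in RHS]eq_bigr do rewrite mulr_sumr mulr_sumr.
rewrite [RHS]exchange_big /=; apply: eq_bigr => I _.
rewrite (bigID (fun d : {ffun 'I_N -> 'I_n.+1} => (0 < d I)%N)) /=.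
rewrite [X in _ + X]big1 ?addr0 => [|d /andP[_ d0]]; last first.
  rewrite /term (bigD1 I) //= {1}/X (_ : d I = 0%N :> nat); last first.
    by apply/eqP; rewrite -leqn0 leqNgt.
  by rewrite addr0 subrr !mul0r mulr0.
rewrite reindex_incr //; apply: eq_bigr => d /eqP dk; rewrite term_incr //.
by rewrite (leq_ltn_trans _ kn) // -dk /deg (bigD1 I) //= leq_addr.
Qed.

Lemma wronskian_rec_lt k : (m < N)%N -> (k < n)%N ->
  k.+1%:R * (star_sum z a n id)`_k.+1 = - ((m.+1 == N)%:R * (star_sum z a n id)`_k).
Proof.
move=> mN kn; rewrite wronskian_rec // coef_multisum.
under eq_bigr => d _ do rewrite (lagrange_sum_lt _ (@shifted_inj d)) //.
have sgnE : m.+1 = N -> parity_sign K N m = -1.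
  by move=> <-; rewrite /parity_sign addSn exprS -signr_odd oddD addbb mulr1.
rewrite -mulr_suml mulrCA mulrC -mulrA; case: eqP => [/sgnE ->|_].
  by rewrite mulN1r.
by rewrite !mul0r oppr0 mulr0.
Qed.

End WronskianRecurrence.

Lemma wronskian_rec_eq (K : fieldType) (N n : nat) (z a : 'I_N -> K)
  (char0 : forall k, k.+1%:R != 0 :> K)
  (z_generic : forall b b' (k : nat), b != b' -> z b - z b' + k%:R != 0) k : (k < n)%N ->
  k.+1%:R * (star_sum z a n id)`_k.+1 =
  (k%:R - (\sum_j a j - \sum_b z b)) * (star_sum z a n id)`_k.
Proof.
move=> kn; rewrite wronskian_rec // coef_multisum parity_sign_balanced // mul1r mulr_sumr.
apply: eq_bigr => d /eqP dk.
rewrite lagrange_sum_eq; last exact: shifted_inj.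
rewrite mulrC; congr (_ * _); rewrite big_split /= -dk natr_sum; ring.
Qed.


(** * Power series determined by first-order recurrences *)
Section Binomial.
Variables (K : fieldType).
Hypothesis char0 : forall k, k.+1%:R != 0 :> K.

(** The coefficients of (1 - t)^c. *)
Definition pow_coef (c : K) k := (\prod_(j < k) (c - j%:R)) / k`!%:R * (-1) ^+ k.
(** The coefficients of exp (- t). *)
Definition expN_coef k : K := (-1) ^+ k / k`!%:R.

Lemma pow_coef0 c : pow_coef c 0 = 1.
Proof. by rewrite /pow_coef big_ord0 fact0 expr0 divr1 mulr1. Qed.

Lemma pow_coefS c k : k.+1%:R * pow_coef c k.+1 = (k%:R - c) * pow_coef c k.
Proof.
rewrite /pow_coef big_ord_recr factS natrM invfM exprS /=.
move: (\prod_(_ < _) _) (k`!%:R^-1) ((-1) ^+ k) => p f e.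
transitivity ((k.+1%:R / k.+1%:R) * ((k%:R - c) * (p * f * e))); first by ring.
by rewrite divff // mul1r.
Qed.

Lemma expN_coefS k : k.+1%:R * expN_coef k.+1 = - expN_coef k.
Proof.
rewrite /expN_coef factS natrM invfM exprS.
transitivity ((k.+1%:R / k.+1%:R) * - ((-1) ^+ k / k`!%:R) : K); first by ring.
by rewrite divff // mul1r.
Qed.

Lemma rec_unique n (g h p : nat -> K) : p 0%N = h 0%N ->
  (forall k, (k < n)%N -> k.+1%:R * p k.+1 = g k * p k) ->
  (forall k, (k < n)%N -> k.+1%:R * h k.+1 = g k * h k) ->
  forall k, (k <= n)%N -> p k = h k.
Proof.
move=> E0 Ep Eh; elim=> // k IHk kn.
by apply: (mulfI (char0 k)); rewrite Ep // Eh // IHk // ltnW.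
Qed.

Lemma pow_coef_mul c c' k :
  \sum_(j < k.+1) pow_coef c j * pow_coef c' (k - j) = pow_coef (c + c') k.
Proof.
pose h k := \sum_(j < k.+1) pow_coef c j * pow_coef c' (k - j).
apply: (@rec_unique k (fun k => k%:R - (c + c')) (pow_coef (c + c')) h) => //.
- by rewrite /h big_ord_recl big_ord0 !pow_coef0 mulr1 addr0.
- move=> l _; rewrite /h.
  transitivity (\sum_(j < l.+2) (j%:R * pow_coef c j) * pow_coef c' (l.+1 - j) +
      \sum_(j < l.+2) pow_coef c j * ((l.+1 - j)%:R * pow_coef c' (l.+1 - j))).
    rewrite -big_split mulr_sumr; apply: eq_bigr => j _ /=.
    by rewrite natrB -1?ltnS //; ring.
  rewrite big_ord_recl mul0r mul0r add0r [X in _ + X]big_ord_recr /=.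
  rewrite subnn mul0r mulr0 addr0 -big_split /= mulr_sumr.
  apply: eq_bigr => j _; rewrite /bump /= add1n subSS.
  have jl : (j <= l)%N by rewrite -ltnS.
  by rewrite subSn // !pow_coefS natrB //; ring.
- by move=> l _; rewrite pow_coefS.
Qed.

Lemma pow_coef_expN1 k : pow_coef (- 1) k = 1.
Proof.
apply: (@rec_unique k (fun l => l%:R + 1) (fun _ => 1) (pow_coef (-1))) => //.
- by rewrite pow_coef0.
- by move=> l _; rewrite pow_coefS opprK.
- by move=> l _; rewrite natr1.
Qed.

Lemma pow_coef_exp0 k : pow_coef 0 k = (k == 0)%N%:R.
Proof.
rewrite /pow_coef; case: k => [|k]; first by rewrite big_ord0 fact0 expr0 divr1 mulr1.
by rewrite big_ord_recl subr0 !mul0r.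
Qed.

(** The quotient of two complementary Wronskians, c being the exponent when
    m = N.  It is the full Wronskian, times (1 - t)^r' when m = N. *)
Definition dual_ratio (N m : nat) (c : K) k : K :=
  if m == N then pow_coef c k else if m.+1 == N then expN_coef k else (k == 0)%N%:R.

Section DualSums.
Variables (r r' n : nat).

(** [duality], with the full Wronskian computed from its recurrence. *)
Lemma star_sum_convolution (m : nat) (z : 'I_(r + r') -> K) (a : 'I_m -> K) k :
  (forall b b' (k : nat), b != b' -> z b - z b' + k%:R != 0) ->
  (m <= r + r')%N -> (k <= n)%N ->
  (star_sum z a n (@lshift r r'))`_k =
  \sum_(j < k.+1)
     dual_ratio (r + r') m (\sum_i a i - \sum_b z b + r'%:R) j
     * (mut_sum z a n (@rshift r r'))`_(k - j).
Proof.
move=> z_generic m_le; rewrite -ltnS => kn.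
have D := duality (n := n) a char0 z_generic m_le.
have id_inj : injective (@id 'I_(r + r')) by [].
pose B c : {poly K} := \poly_(k < n.+1) pow_coef c k.
have BM c c' : eq_upto n.+1 (B c * B c') (B (c + c')).
  move=> l ln; rewrite coefM coef_poly ln -pow_coef_mul; apply: eq_bigr => j _.
  have jl := ltn_ord j.
  rewrite !coef_poly (leq_ltn_trans (leq_subr _ _) ln).
  by rewrite (leq_ltn_trans _ ln) -1?ltnS.
have BX c l : eq_upto n.+1 (B c ^+ l) (B (c *+ l)).
  elim: l => [|l IHl] j jn.
    by rewrite expr0 mulr0n coef1 coef_poly jn pow_coef_exp0.
  by rewrite exprS mulrS -(BM _ _ _ jn); apply: eq_uptoM jn.
move: D; set L := star_sum z a n (@lshift r r'); set R' := mut_sum _ _ _ _.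
set W := star_sum z a n id.
set u := \poly_(_ < _) _ => D.
have unfold p : (forall j, (j <= n)%N -> p j = W`_j) -> u = 1 ->
    L`_k = \sum_(j < k.+1) p j * R'`_(k - j).
  move=> pW u1; have := D k kn; rewrite u1 expr1n mulr1 => <-.
  rewrite coefM; apply: eq_bigr => j _; rewrite pW //.
  by rewrite -ltnS (leq_trans (ltn_ord j) kn).
have W0 : W`_0 = 1 by rewrite coef0_star_sum.
rewrite /dual_ratio; case: eqP => [mN|/eqP mN].
  subst m.
  have WE : eq_upto n.+1 W (B (\sum_i a i - \sum_b z b)).
    move=> j jn; rewrite coef_poly jn.
    apply: (@rec_unique n (fun k => k%:R - (\sum_i a i - \sum_b z b)) (pow_coef _)
      (fun j => W`_j)) => //.
    - by rewrite pow_coef0.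
    - by move=> l ln; rewrite wronskian_rec_eq.
    - by move=> l ln; rewrite pow_coefS.
  have uE : u = B (- 1).
    by apply/polyP => j; rewrite !coef_poly eqxx pow_coef_expN1.
  have LE : eq_upto n.+1 L (B (\sum_i a i - \sum_b z b + r'%:R) * R').
    move=> j jn.
    transitivity ((L * (u ^+ r' * B r'%:R))`_j).
      rewrite -[L in LHS]mulr1; apply: eq_uptoM jn => // i ilt.
      transitivity ((B (- 1 *+ r') * B r'%:R)`_i).
        by rewrite (BM _ _ _ ilt) mulNrn addNr coef_poly ilt pow_coef_exp0 coef1.
      by apply: eq_uptoM ilt => // l ln; rewrite uE BX.
    transitivity (((W * R') * B r'%:R)`_j).
      by rewrite mulrA; apply: eq_uptoM jn => // i ilt; rewrite D.
    rewrite mulrAC; apply: eq_uptoM jn => // i ilt.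
    rewrite -(BM _ _ _ ilt); apply: eq_uptoM ilt => // l ln; exact: WE.
  rewrite (LE _ kn) coefM; apply: eq_bigr => j _; rewrite coef_poly.
  by rewrite (leq_ltn_trans _ kn) // -ltnS.
have mN' : (m < r + r')%N by rewrite ltn_neqAle mN.
have u1 : u = 1.
  by apply/polyP => j; rewrite coef_poly (negPf mN) coef1; case: j => // j; rewrite if_same.
have WE l : (l < n)%N ->
    l.+1%:R * W`_l.+1 = - ((m.+1 == r + r')%N%:R * W`_l).
  exact: wronskian_rec_lt.
case: eqP WE => mE WE.
  apply: (unfold expN_coef) => // j jn.
  apply: (@rec_unique n (fun k => - 1) (fun j => W`_j) expN_coef) => //.
  - by rewrite W0 /expN_coef expr0 fact0 divr1.
  - by move=> l ln; rewrite expN_coefS mulN1r.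
  - by move=> l ln; rewrite /= WE // mul1r mulN1r.
apply: (unfold (fun j => (j == 0)%N%:R)) => // j jn.
apply: (@rec_unique n (fun k => 0) (fun j => W`_j) (fun j => (j == 0)%N%:R)) => //.
- by move=> l ln; rewrite mulr0 mul0r.
- by move=> l ln; rewrite /= WE // !mul0r oppr0.
Qed.

End DualSums.
End Binomial.


(** * Brackets at generic arguments and at 0 *)
Section Brackets.
Variable K : fieldType.
Hypothesis char0 : forall k, k.+1%:R != 0 :> K.

Definition nonint (y : K) := forall i : int, y + i%:~R != 0.
Definition ibracket (y : K) i := (bracket y i)^-1.

Lemma nonintN y : nonint y -> nonint (- y).
Proof.
by move=> yi i; rewrite -(opprK i) rmorphN -opprD oppr_eq0 yi.
Qed.

Lemma nonint_nat y k : nonint y -> y + k%:R != 0.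
Proof. by move/(_ (Posz k)). Qed.

Lemma bracket0 (y : K) : bracket y 0 = 1.
Proof. by rewrite /= big_geq. Qed.

(** The case y = 0 is allowed: the convention 1 / [0]_i = 0 for i < 0 is the
    one that keeps this recurrence true across the pole. *)
Lemma ibracket_pred y i : (forall k, y + k.+1%:R != 0) ->
  ibracket y (i - 1) = ibracket y i * (y + i%:~R).
Proof.
move=> yk; case: i => [[|k]|k]; rewrite /ibracket.
- by rewrite sub0r bracket0 /= big_nat1 subr0 invrK invr1 mul1r addr0.
- by rewrite intS addrAC subrr add0r /= [in RHS]big_nat_recr //= invfM mulfVK //.
- rewrite (_ : Negz k - 1 = Negz k.+1); last by rewrite !NegzE -addn1; lia.
  by rewrite /= !invrK big_nat_recr //= NegzE rmorphN.
Qed.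

Lemma ibracket_sub y i d : (forall k, y + k.+1%:R != 0) ->
  ibracket y (i - d%:Z) = ibracket y i * ((-1) ^+ d * poch (- (y + i%:~R)) d).
Proof.
move=> yk; elim: d => [|d IHd]; first by rewrite subr0 expr0 poch0 !mulr1.
have -> : i - d.+1%:Z = i - d%:Z - 1 by lia.
rewrite ibracket_pred // IHd.
rewrite exprS pochS rmorphB /= -!mulrA; congr (_ * _).
rewrite -pmulrn; ring.
Qed.

Lemma ibracket_add y i d : (forall l, y + i%:~R + l.+1%:R != 0) ->
  (forall k, y + k.+1%:R != 0) ->
  ibracket y (i + d%:Z) = ibracket y i / poch (1 + (y + i%:~R)) d.
Proof.
move=> yi yk; elim: d => [|d IHd]; first by rewrite addr0 poch0 divr1.
have yd : 1 + (y + i%:~R) + d%:R != 0 by rewrite addrAC nat1r addrC.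
rewrite pochS invfM mulrA -IHd; apply: (mulIf yd); rewrite mulfVK //.
have -> : i + d%:Z = (i + d.+1%:Z) - 1 by lia.
by rewrite ibracket_pred // rmorphD /= -pmulrn -natr1; congr (_ * _); ring.
Qed.

Lemma bracket_neq0 (y : K) i : nonint y -> bracket y i != 0.
Proof.
move=> yi; case: i => k /=; last rewrite invr_eq0.
  by rewrite big_add1 big_mkord; apply/prodf_neq0 => l _; rewrite nonint_nat.
rewrite big_mkord; apply/prodf_neq0 => l _.
by have := yi (- l%:Z); rewrite rmorphN.
Qed.

Lemma bracket_add (y : K) i d : nonint y ->
  bracket y (i + d%:Z) = bracket y i * poch (1 + (y + i%:~R)) d.
Proof.
move=> yi; apply: invr_inj; rewrite invfM -[LHS]/(ibracket _ _).
rewrite ibracket_add // => l; last exact: nonint_nat.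
by have := yi (i + l.+1%:Z); rewrite rmorphD /= addrA.
Qed.

(** The reflection formula of the Gamma function, [y]_i being
    Gamma (y + i + 1) / Gamma (y + 1). *)
Lemma bracket_opp (y : K) i : nonint y ->
  bracket y i * bracket (- y) (- i) = (-1) ^ i * ((y + i%:~R) / y).
Proof.
wlog: y i / 0 <= i => [H yi|].
  case: (lerP 0 i) => i0; first exact: H.
  have := H (- y) (- i); rewrite oppr_ge0 ltW // => /(_ isT (nonintN yi)).
  rewrite !opprK mulrC => ->.
  by rewrite rmorphN -opprD invrN mulrNN -exprz_inv invrN1.
case: i => // k _ yi.
have y0 : y != 0 by have := yi 0; rewrite addr0.
elim: k => [|k IHk]; first by rewrite oppr0 !bracket0 expr0z addr0 divff.
have yk : y + k%:R != 0 by exact: nonint_nat.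
have E1 := bracket_add k 1 yi.
have E2 := @ibracket_pred (- y) (- k%:Z).
have E2' := E2 (fun l => nonint_nat l.+1 (nonintN yi)).
rewrite (_ : Posz k.+1 = k%:Z + 1%:Z) ?opprD; last by lia.
rewrite E1 /poch big_ord1 addr0.
rewrite -[bracket (- y) _]invrK -/(ibracket _ _) E2' /ibracket invfM invrK.
rewrite rmorphN -opprD -pmulrn invrN.
transitivity ((bracket y k * bracket (- y) (- k%:Z)) * - ((1 + (y + k%:R)) / (y + k%:R))).
  by ring.
rewrite IHk -PoszD addn1 -!exprnP exprS -!pmulrn -natr1.
move: (_ ^+ _) => e; field; by rewrite y0 yk.
Qed.

End Brackets.

Section Gauge.
Variable K : fieldType.
Hypothesis char0 : forall k, k.+1%:R != 0 :> K.

Definition gauge q (x : 'I_q -> K) (n : 'I_q -> int) :=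
  \prod_I \prod_(J | I != J) bracket (x I - x J) (n I - n J).

(** The two factors of each pair of roots combine by reflection. *)
Lemma gauge_vandermonde q (x : 'I_q -> K) n :
  (forall I J, I != J -> nonint (x I - x J)) ->
  gauge x n = (\prod_I ((-1) ^ n I) ^+ q.-1) *
              (vandermonde (fun I => x I + (n I)%:~R) / vandermonde x).
Proof.
move=> x_gen.
have split2 (F : 'I_q -> 'I_q -> K) : \prod_I \prod_(J | I != J) F I J =
    \prod_(I < q) \prod_(J < q | (I < J)%N) (F I J * F J I).
  transitivity (\prod_(I < q) ((\prod_(J < q | (I < J)%N) F I J) *
                                (\prod_(J < q | (J < I)%N) F I J))).
    apply: eq_bigr => I _; rewrite (bigID (fun J : 'I_q => (I < J)%N)) /=.
    by congr (_ * _); apply: eq_bigl => J; rewrite -val_eqE /=; case: ltngtP.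
  rewrite big_split /= [X in _ * X](exchange_big_dep xpredT) //= -big_split /=.
  by apply: eq_bigr => I _; rewrite -big_split.
have -> : \prod_I ((-1) ^ n I) ^+ q.-1 =
    \prod_(I < q) \prod_(J < q | (I < J)%N) ((-1) ^ n I * (-1) ^ n J) :> K.
  rewrite -(split2 (fun I J => (-1) ^ n I)); apply: eq_bigr => I _.
  rewrite prodr_const; congr (_ ^+ _).
  rewrite (@eq_card _ _ (predC1 I)) ?cardC1 ?card_ord // => J.
  by rewrite !inE eq_sym.
rewrite /gauge split2 /vandermonde -prodf_div -big_split; apply: eq_bigr => I _ /=.
rewrite -prodf_div -big_split; apply: eq_bigr => J IJ /=.
have IJn : I != J by rewrite -val_eqE ltn_eqF.
rewrite -[x J - x I]opprB -[n J - n I]opprB bracket_opp //; last exact: x_gen.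
congr (_ * _).
  rewrite expfzDr ?oppr_eq0 ?oner_eq0 //; congr (_ * _).
  by rewrite -exprz_inv invrN1.
by rewrite invrN mulrN -mulNr; congr (_ * _); rewrite rmorphB /=; ring.
Qed.

End Gauge.

(** * The central factors as terms of dual Wronskians *)

(** Roots at nodes 6 and 7 are indexed by B, with those of weights in C_5
    first; roots at nodes 3 and 4 are indexed by A. *)
Section DualTerms.
Variable K : fieldType.
Hypothesis char0 : forall k, k.+1%:R != 0 :> K.
Variables (r r' m : nat) (xB : 'I_(r + r') -> K) (nB : 'I_(r + r') -> int).
Variables (xA : 'I_m -> K) (nA : 'I_m -> int).
Hypothesis B_gen : forall b b', b != b' -> nonint (xB b - xB b').
Hypothesis A_gen : forall j b k, xA j - xB b + k.+1%:R != 0.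
Hypothesis A_gen' : forall j (J : 'I_r'), nonint (xA j - xB (rshift r J)).
Hypothesis r_gt0 : (0 < r)%N.
Hypothesis r'_gt0 : (0 < r')%N.

Let zB b := xB b + (nB b)%:~R.
Let zA j := xA j + (nA j)%:~R.
Let l (I : 'I_r) : 'I_(r + r') := lshift r' I.
Let rho (J : 'I_r') : 'I_(r + r') := rshift r J.

Definition star_center (d : 'I_r -> nat) : K :=
  gauge (xB \o l) (fun I => nB (l I) + (d I)%:Z) *
  (\prod_j \prod_I ibracket (xA j - xB (l I)) (nA j - (nB (l I) + (d I)%:Z))) *
  (\prod_I \prod_b ibracket (xB (l I) - xB b) (nB (l I) + (d I)%:Z - nB b)).

Definition mut_center (d : 'I_r' -> nat) : K :=
  gauge (xB \o rho) (fun J => nB (rho J) - (d J)%:Z) *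
  (\prod_b \prod_J ibracket (xB b - xB (rho J)) (nB b - (nB (rho J) - (d J)%:Z))) *
  (\prod_j \prod_b ibracket (xA j - xB b) (nA j - nB b)) *
  (\prod_j \prod_J bracket (xA j - xB (rho J)) (nA j - (nB (rho J) - (d J)%:Z))).

Definition center0 := star_center (fun=> 0%N).
(** The sign in t = - (-1)^r' q_5. *)
Definition dual_sign : K := - (-1) ^+ r'.

Lemma gauge_inv q (f : 'I_q -> 'I_(r + r')) (n : 'I_q -> int) : injective f ->
  gauge (xB \o f) n *
   \prod_I \prod_J ibracket (xB (f I) - xB (f J)) (n I - n J) = 1.
Proof.
move=> f_inj; rewrite /gauge -big_split big1 //= => I _.
rewrite [X in _ * X](bigD1 I) //= !subrr /ibracket bracket0 invr1 mul1r.
rewrite [X in _ * X](eq_bigl (fun J => I != J)) => [|J]; last by rewrite eq_sym.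
rewrite -big_split big1 //= => J IJ; rewrite divff //.
by apply/bracket_neq0/B_gen; rewrite (inj_eq f_inj).
Qed.

Let starA := \prod_j \prod_I ibracket (xA j - xB (l I)) (nA j - nB (l I)).
Let starB := \prod_I \prod_b ibracket (xB (l I) - xB b) (nB (l I) - nB b).
Let mutA := \prod_j \prod_J bracket (xA j - xB (rho J)) (nA j - nB (rho J)).
Let mutB := \prod_b \prod_J ibracket (xB b - xB (rho J)) (nB b - nB (rho J)).
Let mutAB := \prod_j \prod_b ibracket (xA j - xB b) (nA j - nB b).

(** Only the brackets between the two halves of B and those between A and the
    first half survive on either side. *)
Lemma center0_eq :
  gauge (xB \o rho) (nB \o rho) * mutB * mutAB * mutA =
  gauge (xB \o l) (nB \o l) * starA * starB.
Proof.
pose mid := \prod_(I < r) \prod_(J < r')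
  ibracket (xB (l I) - xB (rho J)) (nB (l I) - nB (rho J)).
have Gl : gauge (xB \o l) (nB \o l) *
    (\prod_I \prod_J ibracket (xB (l I) - xB (l J)) (nB (l I) - nB (l J))) = 1.
  exact/gauge_inv/lshift_inj.
have Gr : gauge (xB \o rho) (nB \o rho) *
    (\prod_I \prod_J ibracket (xB (rho I) - xB (rho J)) (nB (rho I) - nB (rho J))) = 1.
  exact/gauge_inv/rshift_inj.
have -> : mutB = mid * \prod_I \prod_J
    ibracket (xB (rho I) - xB (rho J)) (nB (rho I) - nB (rho J)).
  by rewrite /mutB big_split_ord.
have -> : starB = (\prod_I \prod_J
    ibracket (xB (l I) - xB (l J)) (nB (l I) - nB (l J))) * mid.
  by rewrite /mid /starB -big_split; apply: eq_bigr => I _; rewrite big_split_ord.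
have AB : mutAB * mutA = starA.
  rewrite /mutAB /mutA /starA -big_split; apply: eq_bigr => j _ /=.
  rewrite big_split_ord -mulrA -big_split /= [X in _ * X]big1 ?mulr1 // => J _.
  by rewrite mulVf // bracket_neq0.
rewrite -AB; transitivity (mutAB * mutA * mid); last first.
by have := congr1 (fun x => x * (mutAB * mutA * mid)) Gl; rewrite mul1r => <-; ring.
by have := congr1 (fun x => x * (mutAB * mutA * mid)) Gr; rewrite mul1r => <-; ring.
Qed.

(** Degrees are measured from those at nodes 6 and 7. *)
Lemma gauge_shift q (f : 'I_q -> 'I_(r + r')) (n : 'I_q -> int) :
  injective f ->
  gauge (xB \o f) n = gauge (xB \o f) (nB \o f) *
    ((\prod_I ((-1) ^ (n I - nB (f I))) ^+ q.-1) *
     (vandermonde (fun I => xB (f I) + (n I)%:~R) / vandermonde (zB \o f))).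
Proof.
move=> f_inj.
have f_gen I J : I != J -> nonint ((xB \o f) I - (xB \o f) J).
  by move=> IJ; apply: B_gen; rewrite (inj_eq f_inj).
rewrite !gauge_vandermonde //.
have z0 : vandermonde (zB \o f) != 0.
  apply/prodf_neq0 => I _; apply/prodf_neq0 => J IJ.
  have /B_gen /(_ (nB (f J) - nB (f I))) : f J != f I.
    by rewrite (inj_eq f_inj) -val_eqE gtn_eqF.
  by rewrite rmorphB /= /zB opprD addrACA.
have -> : \prod_I ((-1) ^ n I) ^+ q.-1 = (\prod_I ((-1) ^ (nB \o f) I) ^+ q.-1) *
    (\prod_I ((-1) ^ (n I - nB (f I))) ^+ q.-1) :> K.
  rewrite -big_split; apply: eq_bigr => I _ /=.
  by rewrite -exprMn -expfzDr ?oppr_eq0 ?oner_eq0 // addrC subrK.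
rewrite (_ : vandermonde (fun I => (xB \o f) I + ((nB \o f) I)%:~R) = vandermonde (zB \o f)) //.
rewrite (_ : vandermonde (fun I => (xB \o f) I + (n I)%:~R) =
  vandermonde (fun I => xB (f I) + (n I)%:~R)) //.
by rewrite -[LHS]mulr1 -(divff z0); ring.
Qed.

Lemma prod_sign_pow q (d : 'I_q -> nat) (e : nat) :
  \prod_I (((-1) ^+ d I) ^+ e : K) = ((-1) ^+ e) ^+ (\sum_I d I).
Proof.
by rewrite expr_sum; apply: eq_bigr => I _; rewrite -!exprM mulnC.
Qed.

(** A shift d I contributes the signs (-1)^(r - 1) from the gauge factors and
    (-1)^m from the arrows into the centre, whose product is that of
    [dual_sign] and of the hypergeometric equation. *)
Lemma star_center_term (d : 'I_r -> nat) : star_center d =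
  center0 * dual_sign ^+ (\sum_I d I) *
  (\prod_I star_coef zB zA (l I) (d I) *
   (vandermonde (fun I => zB (l I) + (d I)%:R) / vandermonde (zB \o l))).
Proof.
have constE : center0 = gauge (xB \o l) (nB \o l) * starA * starB.
  rewrite /center0 /star_center; congr (_ * _ * _).
  - by congr gauge; apply: funext => I; rewrite addr0.
  - by apply: eq_bigr => j _; apply: eq_bigr => I _; rewrite addr0.
  - by apply: eq_bigr => I _; apply: eq_bigr => b _; rewrite addr0.
have gaugeE : gauge (xB \o l) (fun I => nB (l I) + (d I)%:Z) =
    gauge (xB \o l) (nB \o l) * (((-1) ^+ r.-1) ^+ (\sum_I d I) *
     (vandermonde (fun I => zB (l I) + (d I)%:R) / vandermonde (zB \o l))).
  rewrite gauge_shift; last exact: lshift_inj.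
  congr (_ * (_ * (_ / _))).
    by rewrite -prod_sign_pow; apply: eq_bigr => I _; rewrite addrC addKr.
  by congr vandermonde; apply: funext => I; rewrite rmorphD /= /zB addrA.
have AE : \prod_j \prod_I ibracket (xA j - xB (l I)) (nA j - (nB (l I) + (d I)%:Z)) =
    starA * (((-1) ^+ m) ^+ (\sum_I d I) * \prod_I \prod_j poch (zB (l I) - zA j) (d I)).
  rewrite -prod_sign_pow -big_split /starA exchange_big [in RHS]exchange_big.
  rewrite -big_split; apply: eq_bigr => I _ /=.
  rewrite -[X in _ ^+ X](card_ord m) -prodr_const -!big_split; apply: eq_bigr => j _ /=.
  rewrite opprD addrA ibracket_sub; last exact: A_gen.
  by rewrite /zB /zA rmorphB /=; congr (_ * (_ * poch _ _)); ring.
have BE : \prod_I \prod_b ibracket (xB (l I) - xB b) (nB (l I) + (d I)%:Z - nB b) =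
    starB / \prod_I \prod_b poch (1 + (zB (l I) - zB b)) (d I).
  rewrite /starB -prodf_div; apply: eq_bigr => I _.
  rewrite -prodf_div; apply: eq_bigr => b _.
  have zE : xB (l I) - xB b + (nB (l I) - nB b)%:~R = zB (l I) - zB b.
    by rewrite /zB rmorphB /=; ring.
  rewrite addrAC ibracket_add => [||k]; first by rewrite zE.
    move=> k; have [->|bI] := eqVneq (l I) b; first by rewrite !subrr !add0r.
    have := B_gen bI (nB (l I) - nB b + k.+1%:Z).
    by rewrite rmorphD /= addrA.
  have [->|bI] := eqVneq (l I) b; first by rewrite !subrr add0r.
  exact/nonint_nat/B_gen.
rewrite /star_center gaugeE AE BE constE.
have sgnE : ((-1) ^+ r.-1) ^+ (\sum_I d I) * ((-1) ^+ m) ^+ (\sum_I d I) =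
    dual_sign ^+ (\sum_I d I) * \prod_I parity_sign K (r + r') m ^+ d I.
  rewrite prodrXr -!exprMn; congr (_ ^+ _).
  rewrite /dual_sign /parity_sign -[in RHS](prednK r_gt0) -!exprD addSn addSn exprS.
  rewrite mulN1r mulrNN -!exprD -signr_odd -[RHS]signr_odd; congr (_ ^+ _).
  by rewrite !oddD; do 3!case: odd.
rewrite /star_coef big_split big_split /= prodfV.
transitivity (gauge (xB \o l) (nB \o l) * starA * starB * 
  (((-1) ^+ r.-1) ^+ (\sum_I d I) * ((-1) ^+ m) ^+ (\sum_I d I)) *
  (\prod_I \prod_j poch (zB (l I) - zA j) (d I) /
   \prod_I \prod_b poch (1 + (zB (l I) - zB b)) (d I) *
   (vandermonde (fun I => zB (l I) + (d I)%:R) / vandermonde (zB \o l)))); first by ring.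
rewrite sgnE; ring.
Qed.

Lemma mut_center_term (d : 'I_r' -> nat) : mut_center d =
  center0 * dual_sign ^+ (\sum_I d I) *
  (\prod_I mut_coef zB zA (rho I) (d I) *
   (vandermonde (fun I => zB (rho I) - (d I)%:R) / vandermonde (zB \o rho))).
Proof.
have constE : center0 = gauge (xB \o rho) (nB \o rho) * mutB * mutAB * mutA.
  rewrite center0_eq /center0 /star_center; congr (_ * _ * _).
  - by congr gauge; apply: funext => I; rewrite addr0.
  - by apply: eq_bigr => j _; apply: eq_bigr => I _; rewrite addr0.
  - by apply: eq_bigr => I _; apply: eq_bigr => b _; rewrite addr0.
have gaugeE : gauge (xB \o rho) (fun J => nB (rho J) - (d J)%:Z) =
    gauge (xB \o rho) (nB \o rho) * (((-1) ^+ r'.-1) ^+ (\sum_J d J) *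
     (vandermonde (fun J => zB (rho J) - (d J)%:R) / vandermonde (zB \o rho))).
  rewrite gauge_shift; last exact: rshift_inj.
  congr (_ * (_ * (_ / _))).
    rewrite -prod_sign_pow; apply: eq_bigr => J _.
    by rewrite addrC addKr -exprz_inv invrN1.
  by congr vandermonde; apply: funext => I; rewrite rmorphB /= /zB addrA.
have AE : \prod_j \prod_J bracket (xA j - xB (rho J)) (nA j - (nB (rho J) - (d J)%:Z)) =
    mutA * \prod_J \prod_j poch (1 + (zA j - zB (rho J))) (d J).
  rewrite [X in _ * X]exchange_big -big_split; apply: eq_bigr => j _ /=.
  rewrite -big_split; apply: eq_bigr => J _ /=.
  rewrite opprB addrCA addrC bracket_add //.
  by rewrite /zB /zA rmorphB /=; congr (_ * poch _ _); ring.
have BE : \prod_b \prod_J ibracket (xB b - xB (rho J)) (nB b - (nB (rho J) - (d J)%:Z)) =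
    mutB / \prod_J \prod_b poch (1 + (zB b - zB (rho J))) (d J).
  rewrite [X in _ / X]exchange_big -prodf_div; apply: eq_bigr => b _.
  rewrite -prodf_div; apply: eq_bigr => J _.
  have zE : xB b - xB (rho J) + (nB b - nB (rho J))%:~R = zB b - zB (rho J).
    by rewrite /zB rmorphB /=; ring.
  rewrite opprB addrCA addrC ibracket_add => [||k]; first by rewrite zE.
    move=> k; have [->|bJ] := eqVneq b (rho J); first by rewrite !subrr !add0r.
    have := B_gen bJ (nB b - nB (rho J) + k.+1%:Z).
    by rewrite rmorphD /= addrA.
  have [->|bJ] := eqVneq b (rho J); first by rewrite !subrr add0r.
  exact/nonint_nat/B_gen.
rewrite /mut_center gaugeE AE BE constE -/mutAB.
have -> : dual_sign = (-1) ^+ r'.-1.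
  by rewrite /dual_sign -[in LHS](prednK r'_gt0) exprS mulN1r opprK.
by rewrite /mut_coef prodf_div; ring.
Qed.

End DualTerms.


(** * Sums and products over the nodes and the arrows *)

Lemma perm_star_nodes : perm_eq (index_enum star_node) star_nodes.
Proof.
apply: uniq_perm; first exact: index_enum_uniq.
  by rewrite /= !inE; do ?[case: eqP => //].
by move=> i; rewrite mem_index_enum; case: i; rewrite !inE !eqxx ?orbT.
Qed.

Lemma perm_star_arrows : perm_eq (index_enum star_arrow) star_arrows.
Proof.
apply: uniq_perm; first exact: index_enum_uniq.
  by rewrite /= !inE; do ?[case: eqP => //].
by move=> i; rewrite mem_index_enum; case: i; rewrite !inE !eqxx ?orbT.
Qed.

Lemma perm_mut_arrows : perm_eq (index_enum mut_arrow) mut_arrows.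
Proof.
apply: uniq_perm; first exact: index_enum_uniq.
  by rewrite /= !inE; do ?[case: eqP => //].
by move=> i; rewrite mem_index_enum; case: i; rewrite !inE !eqxx ?orbT.
Qed.

Lemma big_gauge_node (R : Type) (idx : R) (op : Monoid.com_law idx)
    (F : star_node -> R) :
  \big[op/idx]_(i | ~~ star_framed i) F i =
  op (F v1) (op (F v2) (op (F v3) (op (F v4) (op (F v5) (op (F v6) (F v7)))))).
Proof.
by rewrite (perm_big _ perm_star_nodes) !big_cons big_nil /= Monoid.mulm1.
Qed.

Lemma sum_star_node (A : nmodType) (F : star_node -> A) :
  \sum_i F i = F v1 + F v2 + F v3 + F v4 + F v5 + F v6 + F v7 + F v8 + F v9.
Proof.
by rewrite (perm_big _ perm_star_nodes) /= !big_cons big_nil addr0 !addrA.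
Qed.

Lemma big_star_arrow (R : Type) (idx : R) (op : Monoid.com_law idx)
    (F : star_arrow -> R) :
  \big[op/idx]_(a | predT a) F a =
  op (F a13) (op (F a24) (op (F a35) (op (F a45) (op (F a56) (op (F a57)
    (op (F a68) (F a79))))))).
Proof.
by rewrite (perm_big _ perm_star_arrows) !big_cons big_nil /= Monoid.mulm1.
Qed.

Lemma big_mut_arrow (R : Type) (idx : R) (op : Monoid.com_law idx)
    (F : mut_arrow -> R) :
  \big[op/idx]_(b | mut_kept b) F b =
  op (F b13) (op (F b24) (op (F b65) (op (F b75) (op (F b36) (op (F b37)
    (op (F b46) (op (F b47) (op (F b68) (F b79))))))))).
Proof.
by rewrite (perm_big _ perm_mut_arrows) !big_cons big_nil /= Monoid.mulm1.
Qed.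

(** * Semistability of the torus fixed points *)

Section PolynomialFunctions.
Variable C : numClosedFieldType.

(** Regular functions on the affine line minus the origin that extend to the
    line; the value at 0 is irrelevant. *)
Definition poly_on (f : C -> C) := exists p : {poly C}, forall t, t != 0 -> f t = p.[t].
Definition poly_mx m n (F : C -> 'M[C]_(m, n)) := forall i j, poly_on (fun t => F t i j).

Lemma poly_on_cst a : poly_on (fun=> a).
Proof. by exists a%:P => t _; rewrite hornerC. Qed.

Lemma poly_onD f g : poly_on f -> poly_on g -> poly_on (fun t => f t + g t).
Proof. by move=> [p fp] [q gq]; exists (p + q) => t t0; rewrite hornerD fp ?gq. Qed.

Lemma poly_onM f g : poly_on f -> poly_on g -> poly_on (fun t => f t * g t).
Proof. by move=> [p fp] [q gq]; exists (p * q) => t t0; rewrite hornerM fp ?gq. Qed.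

Lemma poly_on_sum (I : Type) (s : seq I) (P : pred I) (F : I -> C -> C) :
  (forall i, P i -> poly_on (F i)) -> poly_on (fun t => \sum_(i <- s | P i) F i t).
Proof.
move=> FP; elim: s => [|i s IHs].
  by have [p pE] := poly_on_cst 0; exists p => t t0; rewrite big_nil; exact: pE.
have [p pE] := IHs; case Pi: (P i); last first.
  by exists p => t t0; rewrite big_cons Pi; exact: pE.
have [q qE] := poly_onD (FP i Pi) IHs.
by exists q => t t0; rewrite big_cons Pi -qE.
Qed.

Lemma poly_on_prod (I : Type) (s : seq I) (P : pred I) (F : I -> C -> C) :
  (forall i, P i -> poly_on (F i)) -> poly_on (fun t => \prod_(i <- s | P i) F i t).
Proof.
move=> FP; elim: s => [|i s IHs].
  by have [p pE] := poly_on_cst 1; exists p => t t0; rewrite big_nil; exact: pE.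
have [p pE] := IHs; case Pi: (P i); last first.
  by exists p => t t0; rewrite big_cons Pi; exact: pE.
have [q qE] := poly_onM (FP i Pi) IHs.
by exists q => t t0; rewrite big_cons Pi -qE.
Qed.

Lemma poly_on_exp f (k : int) : 0 <= k -> poly_on f -> poly_on (fun t => f t ^ k).
Proof.
by case: k => // k _ [p fp]; exists (p ^+ k) => t t0; rewrite horner_exp -fp.
Qed.

Lemma eq_poly_on f g : (forall t, t != 0 -> f t = g t) -> poly_on f -> poly_on g.
Proof. by move=> fg [p fp]; exists p => t t0; rewrite -fg ?fp. Qed.

(** If k < 0, the polynomial 'X^(- k) p - 1 would have all nonzero scalars as
    roots and the value -1 at 0. *)
Lemma poly_on_exponent f (k : int) :
  poly_on f -> (forall t, t != 0 -> f t = t ^ k) -> 0 <= k.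
Proof.
move=> [p fp] fk; case: k fk => // k fk; exfalso.
have E : p * 'X^(k.+1) - 1 = 0.
  pose s := [seq i.+1%:R : C | i <- iota 0 (size (p * 'X^(k.+1) - 1)%R)].
  apply: (@roots_geq_poly_eq0 _ _ s).
  - apply/allP => _ /mapP[i _ ->]; have i0 : i.+1%:R != 0 :> C by rewrite pnatr_eq0.
    rewrite /root !hornerE -fp // fk // NegzE -exprnN.
    by rewrite mulVf ?subrr // expf_neq0.
  - by rewrite map_inj_uniq ?iota_uniq // => i j /eqP; rewrite eqr_nat => /eqP[].
  - by rewrite size_map size_iota.
have := congr1 (horner^~ 0) E; rewrite !hornerE expr0n /= mulr0 sub0r.
by move/eqP; rewrite oppr_eq0 oner_eq0.
Qed.

Lemma poly_mx_cst m n (A : 'M[C]_(m, n)) : poly_mx (fun=> A).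
Proof. by move=> i j; exact: poly_on_cst. Qed.

Lemma poly_mxM m n p (F : C -> 'M[C]_(m, n)) (G : C -> 'M[C]_(n, p)) :
  poly_mx F -> poly_mx G -> poly_mx (fun t => F t *m G t).
Proof.
move=> FP GP i j; apply: (@eq_poly_on (fun t => \sum_k F t i k * G t k j)).
  by move=> t _; rewrite mxE.
by apply: poly_on_sum => k _; apply: poly_onM.
Qed.

Lemma poly_mxD m n (F G : C -> 'M[C]_(m, n)) :
  poly_mx F -> poly_mx G -> poly_mx (fun t => F t + G t).
Proof.
move=> FP GP i j; apply: (@eq_poly_on (fun t => F t i j + G t i j)).
  by move=> t _; rewrite mxE.
exact: poly_onD.
Qed.

Lemma poly_on_det m (F : C -> 'M[C]_m) : poly_mx F -> poly_on (fun t => \det (F t)).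
Proof.
move=> FP; apply: poly_on_sum => s _; apply: poly_onM; first exact: poly_on_cst.
exact: poly_on_prod.
Qed.

Lemma eq_poly_mx m n (F G : C -> 'M[C]_(m, n)) :
  (forall t, t != 0 -> F t = G t) -> poly_mx F -> poly_mx G.
Proof. by move=> FG FP i j; apply: eq_poly_on (FP i j) => t t0; rewrite FG. Qed.

Lemma poly_mx_absorb m n (F : C -> 'M[C]_m) (A : 'M[C]_(m, n)) (G : C -> 'M[C]_n) :
  (forall t, t != 0 -> G t \in unitmx) -> poly_mx G ->
  poly_mx (fun t => F t *m A *m invmx (G t)) -> poly_mx (fun t => F t *m A).
Proof.
move=> Gu GP FP; apply: eq_poly_mx (poly_mxM FP GP) => t t0.
by rewrite mulmxKV ?Gu.
Qed.

Lemma poly_mx_cancel m n (F : C -> 'M[C]_m) (A : 'M[C]_(m, n)) (B : 'M[C]_(n, m)) :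
  A *m B = 1%:M -> poly_mx (fun t => F t *m A) -> poly_mx F.
Proof.
move=> AB FP; apply: eq_poly_mx (poly_mxM FP (poly_mx_cst B)) => t t0.
by rewrite -mulmxA AB mulmx1.
Qed.

Lemma poly_mx_cancel2 m n n' (F : C -> 'M[C]_m) (A : 'M[C]_(m, n))
   (B : 'M[C]_(n, m)) (A' : 'M[C]_(m, n')) (B' : 'M[C]_(n', m)) :
  A *m B + A' *m B' = 1%:M ->
  poly_mx (fun t => F t *m A) -> poly_mx (fun t => F t *m A') -> poly_mx F.
Proof.
move=> AB FP FP'.
apply: eq_poly_mx (poly_mxD (poly_mxM FP (poly_mx_cst B))
  (poly_mxM FP' (poly_mx_cst B'))) => t t0.
by rewrite -!mulmxA -mulmxDr AB mulmx1.
Qed.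

End PolynomialFunctions.

(** Sylvester's identity, from two products of block matrices. *)
Lemma det_1_mulmx_comm (K : comNzRingType) m n (X : 'M[K]_(m, n)) (Y : 'M[K]_(n, m)) :
  \det (1%:M + X *m Y) = \det (1%:M + Y *m X).
Proof.
have E1 : block_mx 1%:M (- X) Y 1%:M *m block_mx 1%:M X 0 1%:M =
    block_mx 1%:M 0 Y (1%:M + Y *m X).
  by rewrite mulmx_block !mulmx1 !mul1mx !mulmx0 !addr0 subrr addrC.
have E2 : block_mx 1%:M X 0 1%:M *m block_mx 1%:M (- X) Y 1%:M =
    block_mx (1%:M + X *m Y) 0 Y 1%:M.
  by rewrite mulmx_block !mulmx1 !mul1mx !mul0mx !add0r addNr.
have := congr1 determinant E1; have := congr1 determinant E2.
by rewrite !det_mulmx !det_lblock !det_ublock !det1 !mul1r !mulr1 => <- <-.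
Qed.


Section Inclusion.
Variables (K : comNzRingType) (L : finType).

(** The maps of weight spaces at a torus fixed point. *)
Definition incl m n (c : 'I_m -> L) (c' : 'I_n -> L) : 'M[K]_(m, n) :=
  \matrix_(I, J) (c I == c' J)%:R.

Lemma incl_mul m n p (c : 'I_m -> L) (c' : 'I_n -> L) (c'' : 'I_p -> L) :
  injective c' -> incl c c' *m incl c' c'' =
  \matrix_(I, J) ((c I \in codom c') && (c I == c'' J))%:R.
Proof.
move=> c_inj; apply/matrixP => I J; rewrite !mxE.
under eq_bigr do rewrite !mxE -natrM mulnb.
case: (boolP (c I \in codom c')) => [/codomP[k Ek]|nc].
  rewrite (bigD1 k) //= big1 ?addr0 ?Ek ?eqxx // => k' k'k.
  by rewrite ?Ek (inj_eq c_inj) eq_sym (negPf k'k).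
rewrite big1 // => k _; case: eqP => // Ek.
by case/negP: nc; rewrite Ek codom_f.
Qed.

Lemma incl_mul1 m n (c : 'I_m -> L) (c' : 'I_n -> L) :
  injective c -> injective c' -> {subset codom c <= codom c'} ->
  incl c c' *m incl c' c = 1%:M.
Proof.
move=> c_inj c'_inj cc'; rewrite incl_mul //; apply/matrixP => I J.
by rewrite !mxE cc' ?codom_f // (inj_eq c_inj).
Qed.

Lemma incl_mul1_sum m n p (c : 'I_m -> L) (c' : 'I_n -> L) (c'' : 'I_p -> L) :
  injective c -> injective c' -> injective c'' ->
  {subset codom c <= [predU codom c' & codom c'']} ->
  [disjoint codom c' & codom c''] ->
  incl c c' *m incl c' c + incl c c'' *m incl c'' c = 1%:M.
Proof.
move=> c_inj c'_inj c''_inj cc' dis; rewrite !incl_mul //; apply/matrixP => I J.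
rewrite !mxE (inj_eq c_inj) -natrD.
have := cc' _ (codom_f c I); rewrite inE.
have := disjointFr dis (x := c I).
by case: (_ \in codom c') => [->|_] //=; [rewrite addn0|move=> ->].
Qed.

Lemma incl_mul0 m n p (c : 'I_m -> L) (c' : 'I_n -> L) (c'' : 'I_p -> L) :
  injective c' -> [disjoint codom c & codom c''] -> incl c c' *m incl c' c'' = 0.
Proof.
move=> c_inj dis; rewrite incl_mul //; apply/matrixP => I J; rewrite !mxE.
case: eqP => [E|]; last by rewrite andbF.
by have := disjointFr dis (codom_f c I); rewrite E codom_f.
Qed.

End Inclusion.

Section OneParameter.
Variables (C : numClosedFieldType) (Q : quiver) (M : node Q -> nat).
Variable g : C -> forall i, 'M[C]_(M i).
Hypothesis g_sub : @one_param_subgroup Q M C g.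

Lemma one_param_unit t i : t != 0 -> g t i \in unitmx.
Proof.
move=> t0; case: g_sub => _ g1 gM _.
suff: g t i *m g t^-1 i = 1%:M by case/mulmx1_unit.
by rewrite -gM ?invr_eq0 // mulfV.
Qed.

Lemma one_param_framed i : framed i -> poly_mx (fun t => g t i).
Proof.
move=> fi; case: g_sub => _ _ _ gf.
by apply: eq_poly_mx (@poly_mx_cst _ _ _ 1%:M) => t t0; rewrite gf.
Qed.

Lemma limit_absorb x (a : arrow Q) : limit_exists g x ->
  poly_mx (fun t => g t (tgt a)) -> poly_mx (fun t => g t (src a) *m x a).
Proof.
move=> lim gP; apply: poly_mx_absorb gP _ => [t t0|I J].
  exact: one_param_unit.
exact: lim.
Qed.

End OneParameter.

Section StarPoint.
Variables (C : numClosedFieldType) (L : finType).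
Variables (N : star_node -> nat) (c : forall i, 'I_(N i) -> L).
Arguments c : clear implicits.
Hypothesis c_inj : forall i, injective (c i).
Variable sigma : star_node -> int.

Definition star_point : rep (Q := star) N C :=
  fun a => incl C (c (star_src a)) (c (star_tgt a)).

(** Going from the framed nodes down to nodes 1 and 2, the existence of the
    limit forces every component of the subgroup to be polynomial in t, as the
    matrices of the point have right inverses.  The character is then a
    polynomial that is a power of t. *)
Lemma star_point_semistable :
  (forall a, star_src a != v5 ->
     {subset codom (c (star_src a)) <= codom (c (star_tgt a))}) ->
  {subset codom (c v5) <= [predU codom (c v6) & codom (c v7)]} ->
  [disjoint codom (c v6) & codom (c v7)] ->
  star_phase sigma -> semistable (Q := star) sigma star_point.
Proof.
move=> sub sub5 dis pos g g_sub lim k.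
have P8 : poly_mx (fun t => g t v8) := @one_param_framed _ _ _ _ g_sub v8 isT.
have P9 : poly_mx (fun t => g t v9) := @one_param_framed _ _ _ _ g_sub v9 isT.
have step (a : star_arrow) : star_src a <> v5 ->
    poly_mx (fun t => g t (star_tgt a)) -> poly_mx (fun t => g t (star_src a)).
  move=> /eqP a5 Pt; have H := @limit_absorb _ _ _ _ g_sub _ a lim Pt.
  have E := incl_mul1 C (@c_inj (star_src a)) (@c_inj (star_tgt a)) (sub _ a5).
  exact (@poly_mx_cancel C _ _ (fun t => g t (star_src a)) _ _ E H).
have P6 : poly_mx (fun t => g t v6) by apply: (step a68).
have P7 : poly_mx (fun t => g t v7) by apply: (step a79).
have P5 : poly_mx (fun t => g t v5).
  exact: (poly_mx_cancel2 (incl_mul1_sum C (@c_inj v5) (@c_inj v6) (@c_inj v7) sub5 dis)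
    (@limit_absorb _ _ _ _ g_sub _ a56 lim P6)
    (@limit_absorb _ _ _ _ g_sub _ a57 lim P7)).
have P3 : poly_mx (fun t => g t v3) by apply: (step a35).
have P4 : poly_mx (fun t => g t v4) by apply: (step a45).
have P1 : poly_mx (fun t => g t v1) by apply: (step a13).
have P2 : poly_mx (fun t => g t v2) by apply: (step a24).
apply: poly_on_exponent; apply: poly_on_prod => i fi.
apply: poly_on_exp; first by rewrite ltW // pos.
by apply: poly_on_det; case: i fi.
Qed.

End StarPoint.

Section MutPoint.
Variables (C : numClosedFieldType) (L : finType).
Variables (M : star_node -> nat) (c : forall i, 'I_(M i) -> L).
Arguments c : clear implicits.
Hypothesis c_inj : forall i, injective (c i).
Variable sigma : star_node -> int.

Definition mut_point : rep (Q := mut) M C :=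
  fun a => if mut_kept a then incl C (c (mut_src a)) (c (mut_tgt a)) else 0.

(** As in [star_point_semistable], all the components but g_5 are polynomial.
    The arrows 6 -> 5 and 7 -> 5 show moreover that det g_6 det g_7 / det g_5
    is polynomial, and the character is a product of nonnegative powers of
    determinants and of this quotient: the exponents of det g_6, det g_7 and
    the quotient are sigma_5 + sigma_6, sigma_5 + sigma_7 and - sigma_5. *)
Lemma mut_point_semistable :
  {subset codom (c v1) <= codom (c v3)} ->
  {subset codom (c v2) <= codom (c v4)} ->
  {subset codom (c v6) <= codom (c v8)} ->
  {subset codom (c v7) <= codom (c v9)} ->
  {subset codom (c v3) <= [predU codom (c v6) & codom (c v7)]} ->
  {subset codom (c v4) <= [predU codom (c v6) & codom (c v7)]} ->
  {subset codom (c v5) <= [predU codom (c v6) & codom (c v7)]} ->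
  [disjoint codom (c v6) & codom (c v7)] ->
  mut_phase sigma -> semistable (Q := mut) sigma mut_point.
Proof.
move=> s13 s24 s68 s79 s3 s4 s5 dis [pos neg5 pos6 pos7] g g_sub lim k.
have P8 : poly_mx (fun t => g t v8) := @one_param_framed _ _ _ _ g_sub v8 isT.
have P9 : poly_mx (fun t => g t v9) := @one_param_framed _ _ _ _ g_sub v9 isT.
have lima (a : mut_arrow) := @limit_absorb _ _ _ _ g_sub _ a lim.
have P6 : poly_mx (fun t => g t v6).
  exact: (poly_mx_cancel (incl_mul1 C (@c_inj v6) (@c_inj v8) s68) (lima b68 P8)).
have P7 : poly_mx (fun t => g t v7).
  exact: (poly_mx_cancel (incl_mul1 C (@c_inj v7) (@c_inj v9) s79) (lima b79 P9)).
have P3 : poly_mx (fun t => g t v3).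
  exact: (poly_mx_cancel2 (incl_mul1_sum C (@c_inj v3) (@c_inj v6) (@c_inj v7) s3 dis)
    (lima b36 P6) (lima b37 P7)).
have P4 : poly_mx (fun t => g t v4).
  exact: (poly_mx_cancel2 (incl_mul1_sum C (@c_inj v4) (@c_inj v6) (@c_inj v7) s4 dis)
    (lima b46 P6) (lima b47 P7)).
have P1 : poly_mx (fun t => g t v1).
  exact: (poly_mx_cancel (incl_mul1 C (@c_inj v1) (@c_inj v3) s13) (lima b13 P3)).
have P2 : poly_mx (fun t => g t v2).
  exact: (poly_mx_cancel (incl_mul1 C (@c_inj v2) (@c_inj v4) s24) (lima b24 P4)).
(* Since Y X = 1, det (1 + X (g5^-1 - 1) Y) = det g5^-1. *)
pose D t := block_mx (g t v6) 0 0 (g t v7).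
pose X : 'M[C]_(M v6 + M v7, M v5) := col_mx (incl C (c v6) (c v5)) (incl C (c v7) (c v5)).
pose Y : 'M[C]_(M v5, M v6 + M v7) := row_mx (incl C (c v5) (c v6)) (incl C (c v5) (c v7)).
have YX : Y *m X = 1%:M.
  by rewrite mul_row_col incl_mul1_sum.
have PD : poly_mx D.
  move=> i j; rewrite -(splitK i) -(splitK j) /unsplit /D.
  case: (fintype.split i) => {}i; case: (fintype.split j) => {}j.
  - by apply: eq_poly_on (P6 i j) => t _; rewrite block_mxEul.
  - by apply: eq_poly_on (poly_on_cst 0) => t _; rewrite block_mxEur mxE.
  - by apply: eq_poly_on (poly_on_cst 0) => t _; rewrite block_mxEdl mxE.
  - by apply: eq_poly_on (P7 i j) => t _; rewrite block_mxEdr.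
have PDX : poly_mx (fun t => D t *m X *m invmx (g t v5)).
  move=> i j; rewrite -(splitK i) /unsplit; case: (fintype.split i) => {}i.
    have [p pE] := lim b65 i j; exists p => t t0; rewrite -pE // /D /X.
    rewrite mul_block_col !mul0mx addr0 add0r mul_col_mx col_mxEu //.
  have [p pE] := lim b75 i j; exists p => t t0; rewrite -pE // /D /X.
  by rewrite mul_block_col !mul0mx addr0 add0r mul_col_mx col_mxEd.
have Pdet : poly_on (fun t => \det (g t v6) * \det (g t v7) * (\det (g t v5))^-1).
  apply: (@eq_poly_on _ (fun t => \det (D t + (D t *m X *m invmx (g t v5) - D t *m X) *m Y))).
    move=> t t0.
    have -> : D t + (D t *m X *m invmx (g t v5) - D t *m X) *m Y =
        D t *m (1%:M + X *m ((invmx (g t v5) - 1%:M) *m Y)).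
      by rewrite mulmxDr mulmx1 !mulmxA mulmxBr mulmx1.
    rewrite det_mulmx det_1_mulmx_comm -mulmxA YX mulmx1 addrC subrK.
    by rewrite /D det_ublock det_inv.
  apply: poly_on_det; apply: poly_mxD => //; apply: poly_mxM; last exact: poly_mx_cst.
  apply: poly_mxD => //.
  have := poly_mxM PD (poly_mx_cst (- X)).
  by apply: eq_poly_mx => t _; rewrite mulmxN.
apply: poly_on_exponent.
apply: (@eq_poly_on _ (fun t =>
   \det (g t v1) ^ sigma v1 * \det (g t v2) ^ sigma v2 *
   \det (g t v3) ^ sigma v3 * \det (g t v4) ^ sigma v4 *
   \det (g t v6) ^ (sigma v5 + sigma v6) * \det (g t v7) ^ (sigma v5 + sigma v7) *
   (\det (g t v6) * \det (g t v7) * (\det (g t v5))^-1) ^ (- sigma v5))).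
  move=> t t0; rewrite /character big_gauge_node /=.
  have d0 i : \det (g t i) != 0.
    by have := one_param_unit g_sub i t0; rewrite unitmxE unitfE.
  rewrite !expfzMl !expfzDr // exprz_inv opprK.
  transitivity (\det (g t v1) ^ sigma v1 * \det (g t v2) ^ sigma v2 *
   \det (g t v3) ^ sigma v3 * \det (g t v4) ^ sigma v4 * \det (g t v5) ^ sigma v5 *
   \det (g t v6) ^ sigma v6 * \det (g t v7) ^ sigma v7 *
   (\det (g t v6) ^ (sigma v5) * \det (g t v6) ^ (- sigma v5)) *
   (\det (g t v7) ^ (sigma v5) * \det (g t v7) ^ (- sigma v5))); first by ring.
  by rewrite -!expfzDr // subrr !expr0z; ring.
have Pexp i m : 0 < m -> poly_mx (fun t => g t i) -> poly_on (fun t => \det (g t i) ^ m).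
  by move=> m0 Pi; apply/poly_on_exp/poly_on_det => //; exact: ltW.
have [p1 p2 p3 p4] : [/\ 0 < sigma v1, 0 < sigma v2, 0 < sigma v3 & 0 < sigma v4].
  by split; apply: pos => //; rewrite !inE; do ?[case: eqP => //].
apply: poly_onM; last by apply: poly_on_exp => //; rewrite oppr_ge0 ltW.
do 5![apply: poly_onM; last exact: Pexp].
exact: Pexp.
Qed.

End MutPoint.


(** * Terms that vanish off the effective degrees *)
(** The third factor has no constant term, so to first order only its own
    variation counts, multiplied by A B = 0. *)
Lemma first_order_trace0 (K : comNzRingType) m n p (A A' : 'M[K]_(m, n))
    (B B' : 'M[K]_(n, p)) (D : 'M[K]_(p, m)) : A *m B = 0 ->
  (\tr ((map_mx polyC A + 'X *: map_mx polyC A') *m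
        (map_mx polyC B + 'X *: map_mx polyC B') *m
        (map_mx polyC 0 + 'X *: map_mx polyC D)))`_1 = 0.
Proof.
move=> AB0; have at0 k l (E E' : 'M[K]_(k, l)) :
    map_mx (horner_eval 0) (map_mx polyC E + 'X *: map_mx polyC E') = E.
  apply/matrixP => i j; rewrite !mxE /horner_eval.
  by rewrite hornerD hornerM hornerX mul0r !hornerC addr0.
rewrite map_mx0 add0r -scalemxAr mxtraceZ coefXM /= -horner_coef0.
rewrite -[_.[0]]/(horner_eval 0 _) -trace_map_mx !map_mxM !at0 AB0 mul0mx.
exact: mxtrace0.
Qed.

Lemma I_term_arrow (K : fieldType) (Q : quiver) (M : node Q -> nat)
    (x : forall i, 'I_(M i) -> K) (arrows : pred (arrow Q)) rels n a I J :
  I_term x arrows rels n != 0 -> arrows a -> x (src a) I = x (tgt a) J ->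
  n (tgt a) J <= n (src a) I.
Proof.
move=> nz Pa xE; case: lerP => // lt_n; case/negP: nz.
rewrite /I_term (bigD1 a) //= (bigD1 I) //= (bigD1 J) //= xE subrr.
case E: (n (src a) I - n (tgt a) J) => [k|k]; first by exfalso; lia.
by rewrite /= big_nat_recl // subrr mul0r invr0 invr0 !(mul0r, mulr0).
Qed.

Section Effective.
Variables (R : realType) (K : fieldType) (L : finType) (xi : L -> K).

Lemma star_effective (N : star_node -> nat) (c : forall i, 'I_(N i) -> L)
    sigma (n : @degrees star N) :
  (forall i, injective (@c i)) ->
  (forall a, star_src a != v5 ->
     {subset codom (@c (star_src a)) <= codom (@c (star_tgt a))}) ->
  {subset codom (@c v5) <= [predU codom (@c v6) & codom (@c v7)]} ->
  [disjoint codom (@c v6) & codom (@c v7)] ->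
  star_phase sigma ->
  (forall i I, star_framed i -> n i I = 0) ->
  @I_term K star N (fun i I => xi (c i I)) predT [::] n != 0 ->
  @effective star N R[i] sigma setT n.
Proof.
move=> c_inj sub sub5 dis pos nf nz; split; first exact: nf.
exists (star_point R[i] c); split => //; first exact: star_point_semistable.
move=> a I J lt_n; rewrite mxE; case: eqP => // E.
have := @I_term_arrow _ _ _ _ _ _ _ a I J nz isT (congr1 xi E).
by rewrite leNgt lt_n.
Qed.

Lemma mut_effective (M : star_node -> nat) (c : forall i, 'I_(M i) -> L)
    sigma (n : @degrees mut M) :
  (forall i, injective (@c i)) ->
  {subset codom (@c v1) <= codom (@c v3)} ->
  {subset codom (@c v2) <= codom (@c v4)} ->
  {subset codom (@c v6) <= codom (@c v8)} ->
  {subset codom (@c v7) <= codom (@c v9)} ->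
  {subset codom (@c v3) <= [predU codom (@c v6) & codom (@c v7)]} ->
  {subset codom (@c v4) <= [predU codom (@c v6) & codom (@c v7)]} ->
  {subset codom (@c v5) <= [predU codom (@c v6) & codom (@c v7)]} ->
  [disjoint codom (@c v6) & codom (@c v7)] ->
  [disjoint codom (@c v3) & codom (@c v5)] ->
  [disjoint codom (@c v4) & codom (@c v5)] ->
  mut_phase sigma ->
  (forall i I, star_framed i -> n i I = 0) ->
  @I_term K mut M (fun i I => xi (c i I)) mut_kept mut_relations n != 0 ->
  @effective mut M R[i] sigma (@critical M R[i]) n.
Proof.
move=> c_inj s13 s24 s68 s79 s3 s4 s5 dis dis3 dis4 ph nf nz; split; first exact: nf.
exists (mut_point R[i] c); split.
- move=> v; rewrite /potential !coefD.
  do 4![rewrite first_order_trace0 ?add0r //; last exact: incl_mul0].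
- exact: mut_point_semistable.
- move=> a I J lt_n; rewrite /mut_point.
  case Ka: (mut_kept a); last by rewrite mxE.
  rewrite mxE; case: eqP => // E.
  have := @I_term_arrow _ _ _ _ _ _ _ a I J nz Ka (congr1 xi E).
  by rewrite leNgt lt_n.
Qed.

End Effective.


(** * Degree vectors as functions of the weights *)
Lemma fsum_image (K : nmodType) (T : finType) (U : choiceType) (h : T -> U)
    (P : pred T) (D : set U) (F : U -> K) :
  {in P &, injective h} ->
  (forall t, P t -> F (h t) <> 0 -> D (h t)) ->
  (forall u, D u -> F u <> 0 -> exists2 t, P t & u = h t) ->
  \sum_(u \in D) F u = \sum_(t | P t) F (h t).
Proof.
move=> h_inj hD cov; rewrite fsbig_mkcond.
pose r := [seq h t | t <- enum P].
have r_uniq : uniq r.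
  rewrite map_inj_in_uniq ?enum_uniq // => s t.
  by rewrite !mem_enum; exact: h_inj.
rewrite (_ : setT = [set` xpredT]%classic); last first.
  by apply/seteqP; split.
rewrite -(@bigfs _ _ _ _ r) //; last first.
  move=> u _ nr; rewrite /patch; case: ifP => // /set_mem Du.
  apply: contrapT => /(cov _ Du)[t Pt ut].
  by case/negP: nr; rewrite ut; apply: map_f; rewrite mem_enum.
rewrite big_map big_enum_cond; apply: eq_big => [t|t]; rewrite ?andbT // => Pt.
rewrite /patch; case: ifPn => // /negP nD.
apply: contrapT => E; apply: nD; apply: mem_set.
by apply: hD => // /esym.
Qed.

Lemma fsum_nat (K : nmodType) n (F : nat -> K) :
  (forall k, (n < k)%N -> F k = 0) ->
  \sum_(k \in [set: nat]%classic) F k = \sum_(k < n.+1) F k.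
Proof.
move=> F0; apply: (fsum_image (h := val)) => // [i j _ _|k _ nz].
  exact: val_inj.
have kn : (k < n.+1)%N by rewrite ltnNge; apply/negP => /F0.
by exists (Ordinal kn).
Qed.

Section Labels.
Variables (L : finType) (M : star_node -> nat) (C : star_node -> {set L}).
Variable c : forall i, 'I_(M i) -> L.
Hypothesis labels : root_labels C c.

Lemma labels_inj i : injective (@c i). Proof. by case: (labels i). Qed.

Lemma labels_codom i : codom (@c i) =i C i.
Proof.
case: (labels i) => _ -> f; apply/codomP/imsetP => [[I ->]|[I _ ->]]; by exists I.
Qed.

Lemma labels_mem i I : @c i I \in C i.
Proof. by rewrite -labels_codom codom_f. Qed.

Lemma big_labels (R : Type) (idx : R) (op : Monoid.com_law idx) i (F : L -> R) :
  \big[op/idx]_(I < M i) F (c I) = \big[op/idx]_(f in C i) F f.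
Proof.
have [c_inj ->] := labels i; rewrite big_imset //=.
by move=> I J _ _; apply: c_inj.
Qed.

(** A function of the roots at a node, as a function of their weights that
    vanishes at the other weights. *)
Definition push i (n : 'I_(M i) -> int) (f : L) : int := \sum_(I | c I == f) n I.

Lemma pushE i n I : @push i n (c I) = n I.
Proof.
rewrite /push (big_pred1 I) // => J; apply/eqP/eqP => [|-> //].
exact: labels_inj.
Qed.

Lemma push_notin i n f : f \notin C i -> @push i n f = 0.
Proof.
move=> nf; rewrite /push big_pred0 // => I; apply/eqP => E.
by case/negP: nf; rewrite -E labels_mem.
Qed.

Definition lift_degrees (nu : star_node -> L -> int) :
    {dffun forall i : star_node, {ffun 'I_(M i) -> int}} :=
  [ffun i => [ffun I => nu i (c I)]].

End Labels.

Section Truncation.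
Variables (L : finType) (n : nat).
(** Degrees at the nodes other than the centre, as functions of the weights:
    in this form they do not depend on the numberings of the roots, which
    differ on the two sides. *)
Definition outer := {ffun star_node -> {ffun L -> 'I_n.+1}}.
Definition is_outer (i : star_node) :=
  match i with v5 | v8 | v9 => false | _ => true end.

(** The degree at node 6 or 7 of the weight f.  The weight sets of these nodes
    are disjoint, so one of the summands is 0. *)
Definition degB (o : outer) f : nat := (o v6 f + o v7 f)%N.

Definition node_degree (o : outer) (delta : L -> int) i f : int :=
  match i with
  | v5 => (degB o f)%:Z + delta f
  | v8 | v9 => 0
  | _ => (o i f)%:Z
  end.

Variable C : star_node -> {set L}.
Definition supported (o : outer) :=
  [forall i, forall f, (o i f != ord0) ==> (is_outer i && (f \in C i))].

End Truncation.

Section Cover.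
Variables (L : finType) (M : star_node -> nat) (C : star_node -> {set L}).
Variable c : forall i, 'I_(M i) -> L.
Hypothesis labels : root_labels C c.
Variables (s : int) (n : nat).
Hypothesis s_unit : s * s = 1.

Definition center_degree (d : {ffun 'I_(M v5) -> 'I_n.+1}) (f : L) : int :=
  s * @push L M c v5 (fun I => (d I)%:Z) f.

(** s is 1 on the star side and -1 on the mutated side. *)
Definition assemble (t : outer L n * {ffun 'I_(M v5) -> 'I_n.+1}) :=
  lift_degrees c (node_degree t.1 (center_degree t.2)).

Lemma assemble_inj : {in [pred t | supported C t.1] &, injective assemble}.
Proof.
move=> [o d] [o' d'] /= so so' /ffunP E.
have {}E i (I : 'I_(M i)) : node_degree o (center_degree d) i (c I) =
    node_degree o' (center_degree d') i (c I).
  by have /ffunP/(_ I) := E i; rewrite !ffunE.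
have oE : o = o'.
  apply/ffunP => i; apply/ffunP => f.
  move/forallP/(_ i)/forallP/(_ f)/implyP: so => so.
  move/forallP/(_ i)/forallP/(_ f)/implyP: so' => so'.
  have [fC|nf] := boolP (is_outer i && (f \in C i)).
    case/andP: fC => io; rewrite -(labels_codom labels) => /codomP[I fI].
    have := E i I; rewrite fI; move: (c I) => g.
    by case: i io {so so' I fI} => //= _ [] /val_inj.
  have -> : o i f = ord0 by apply/eqP; apply: contraNT nf => /so.
  by apply/esym/eqP; apply: contraNT nf => /so'.
rewrite oE; congr (_, _); apply/ffunP => I; apply: val_inj => /=.
have := E v5 I; rewrite oE /= /center_degree !(pushE labels) => /addrI.
by move/(congr1 ( *%R s)); rewrite !mulrA s_unit !mul1r => -[].
Qed.

Lemma assemble_cover (u : {dffun forall i : star_node, {ffun 'I_(M i) -> int}}) :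
  (forall i I, star_framed i -> u i I = 0) ->
  (forall i I, is_outer i -> 0 <= u i I <= n%:Z) ->
  (forall I, 0 <= s * (u v5 I - (push c (u v6) (c I) + push c (u v7) (c I))) <= n%:Z) ->
  exists2 t, supported C t.1 & u = assemble t.
Proof.
move=> uf uo u5.
pose o : outer L n := [ffun i => [ffun f =>
  if is_outer i && (f \in C i) then inord `|push c (u i) f|%N else ord0]].
pose d : {ffun 'I_(M v5) -> 'I_n.+1} := [ffun I => inord
  `|(s * (u v5 I - (push c (u v6) (c I) + push c (u v7) (c I))))%R|%N].
have oE i f : is_outer i -> (o i f)%:Z = push c (u i) f.
  move=> io; rewrite !ffunE io /=; case: ifP => [|/negbT fC]; last by rewrite (push_notin labels).
  rewrite -(labels_codom labels) => /codomP[I ->]; rewrite (pushE labels).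
  have /andP[u0 un] := uo i I io.
  by rewrite inordK ?gez0_abs //; lia.
exists (o, d).
  apply/forallP => i; apply/forallP => f; apply/implyP; rewrite !ffunE.
  by case: ifP.
apply/ffunP => i; apply/ffunP => I; rewrite !ffunE /=.
case: i I => I; rewrite /node_degree; try exact: uf; try by rewrite oE ?(pushE labels).
rewrite /degB PoszD !oE // /center_degree (pushE labels) /d ffunE.
have /andP[d0 dn] := u5 I.
rewrite inordK; last by lia.
by rewrite gez0_abs // mulrA s_unit mul1r; ring.
Qed.

End Cover.


(** * The terms as products over weights *)
Section LabelForm.
Variables (K : fieldType) (L : finType) (xi : L -> K).

Definition gauge_set (A : {set L}) (nu : L -> int) : K :=
  \prod_(f in A) \prod_(g in A | f != g) bracket (xi f - xi g) (nu f - nu g).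
Definition arrow_set (A B : {set L}) (nu mu : L -> int) : K :=
  \prod_(f in A) \prod_(g in B) ibracket (xi f - xi g) (nu f - mu g).
Definition relation_set (A B : {set L}) (nu mu : L -> int) : K :=
  \prod_(f in A) \prod_(g in B) bracket (xi f - xi g) (nu f - mu g).

Variables (M : star_node -> nat) (C : star_node -> {set L}).
Variable c : forall i, 'I_(M i) -> L.
Hypothesis labels : root_labels C c.
Variable nu : star_node -> L -> int.

Lemma gauge_set_labels i :
  gauge_set (C i) (nu i) = gauge (fun I => xi (@c i I)) (fun I => nu i (c I)).
Proof.
rewrite /gauge_set -(big_labels labels) /gauge; apply: eq_bigr => I _.
rewrite big_mkcondr -(big_labels labels) [RHS]big_mkcond; apply: eq_bigr => J _.
by rewrite (inj_eq (labels_inj labels (i := i))).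
Qed.

Lemma arrow_set_labels i j :
  arrow_set (C i) (C j) (nu i) (nu j) =
  \prod_I \prod_J (bracket (xi (@c i I) - xi (@c j J)) (nu i (c I) - nu j (c J)))^-1.
Proof.
rewrite /arrow_set -(big_labels labels); apply: eq_bigr => I _.
by rewrite -(big_labels labels).
Qed.

Lemma relation_set_labels i j :
  relation_set (C i) (C j) (nu i) (nu j) =
  \prod_I \prod_J bracket (xi (@c i I) - xi (@c j J)) (nu i (c I) - nu j (c J)).
Proof.
rewrite /relation_set -(big_labels labels); apply: eq_bigr => I _.
by rewrite -(big_labels labels).
Qed.

Let x i I := xi (@c i I).
Let Gs i := gauge_set (C i) (nu i).
Let As i j := arrow_set (C i) (C j) (nu i) (nu j).
Let Rs i j := relation_set (C i) (C j) (nu i) (nu j).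

Lemma gauge_lift i : \prod_I \prod_(J | I != J)
  bracket (x I - x J) (lift_degrees c nu i I - lift_degrees c nu i J) = Gs i.
Proof.
rewrite /Gs gauge_set_labels; apply: eq_bigr => I _; apply: eq_bigr => J _.
by rewrite !ffunE.
Qed.

Lemma arrow_lift i j : \prod_I \prod_J
  (bracket (@x i I - @x j J) (lift_degrees c nu i I - lift_degrees c nu j J))^-1 = As i j.
Proof.
rewrite /As arrow_set_labels; apply: eq_bigr => I _; apply: eq_bigr => J _.
by rewrite !ffunE.
Qed.

Lemma relation_lift i j : \prod_I \prod_J
  bracket (@x i I - @x j J) (lift_degrees c nu i I - lift_degrees c nu j J) = Rs i j.
Proof.
rewrite /Rs relation_set_labels; apply: eq_bigr => I _; apply: eq_bigr => J _.
by rewrite !ffunE.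
Qed.

Lemma star_I_term_label : @I_term K star M x predT [::] (lift_degrees c nu) =
  (Gs v1 * Gs v2 * Gs v3 * Gs v4 * Gs v6 * Gs v7 *
   As v1 v3 * As v2 v4 * As v6 v8 * As v7 v9) *
  (Gs v5 * (As v3 v5 * As v4 v5) * (As v5 v6 * As v5 v7)).
Proof.
rewrite /I_term big_nil mulr1 big_gauge_node big_star_arrow /= !gauge_lift !arrow_lift.
by ring.
Qed.

Lemma mut_I_term_label : @I_term K mut M x mut_kept mut_relations (lift_degrees c nu) =
  (Gs v1 * Gs v2 * Gs v3 * Gs v4 * Gs v6 * Gs v7 *
   As v1 v3 * As v2 v4 * As v6 v8 * As v7 v9) *
  (Gs v5 * (As v6 v5 * As v7 v5) *
   (As v3 v6 * As v3 v7 * (As v4 v6 * As v4 v7)) * (Rs v3 v5 * Rs v4 v5)).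
Proof.
rewrite /I_term !big_cons big_nil mulr1 big_gauge_node big_mut_arrow /=.
rewrite !gauge_lift !arrow_lift !relation_lift.
by ring.
Qed.

End LabelForm.


(** * The identity for a fixed outer part *)
Section Center.
Variables (K : fieldType) (L : finType) (xi : L -> K).
Hypothesis char0 : forall k, k.+1%:R != 0 :> K.
Hypothesis xi_gen : forall f g, f != g -> nonint (xi f - xi g).
Variables (N : star_node -> nat) (C : star_node -> {set L}).
Variables (c : forall i, 'I_(N i) -> L) (c' : forall i, 'I_(mut_rank N i) -> L).
Hypothesis c_labels : root_labels C c.
Hypothesis c'_labels : root_labels (mut_fixed_point C) c'.
Hypothesis C35 : C v3 \subset C v5.
Hypothesis C45 : C v4 \subset C v5.
Hypothesis C567 : C v5 \subset C v6 :|: C v7.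
Hypothesis C67 : [disjoint C v6 & C v7].
Hypothesis N5_gt0 : (0 < N v5)%N.
Hypothesis N5_lt : (N v5 < N v6 + N v7)%N.
Hypothesis N34_le : (N v3 + N v4 <= N v6 + N v7)%N.
Variables (n : nat) (o : outer L n).

Let r := N v5.
Let r' := mut_rank N v5.
Let m := (N v3 + N v4)%N.

(** The weights of nodes 6 and 7, listed through the numberings of C_5 and of
    its complement. *)
Definition labB (b : 'I_(r + r')) : L :=
  match fintype.split b with inl i => c i | inr i => @c' v5 i end.
Definition labA (j : 'I_m) : L :=
  match fintype.split j with inl i => @c v3 i | inr i => @c v4 i end.
Definition degA (j : 'I_m) : int :=
  match fintype.split j with inl i => (o v3 (@c v3 i))%:Z | inr i => (o v4 (@c v4 i))%:Z end.

Lemma labBl I : labB (lshift r' I) = c I.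
Proof. by rewrite /labB -[lshift _ _]/(unsplit (inl I)) unsplitK. Qed.
Lemma labBr J : labB (rshift r J) = c' J.
Proof. by rewrite /labB -[rshift _ _]/(unsplit (inr J)) unsplitK. Qed.
Lemma labAl I : labA (lshift (N v4) I) = c I.
Proof. by rewrite /labA -[lshift _ _]/(unsplit (inl I)) unsplitK. Qed.
Lemma labAr I : labA (rshift (N v3) I) = c I.
Proof. by rewrite /labA -[rshift _ _]/(unsplit (inr I)) unsplitK. Qed.
Lemma degAl I : degA (lshift (N v4) I) = o v3 (c I).
Proof. by rewrite /degA -[lshift _ _]/(unsplit (inl I)) unsplitK. Qed.
Lemma degAr I : degA (rshift (N v3) I) = o v4 (c I).
Proof. by rewrite /degA -[rshift _ _]/(unsplit (inr I)) unsplitK. Qed.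

(** Both sides range over C_6 and C_7 together, as C_5 and the mutated weight
    set are complementary there. *)
Lemma big_mutation (R : Type) (idx : R) (op : Monoid.com_law idx) (F : L -> R) :
  op (\big[op/idx]_(f in C v5) F f) (\big[op/idx]_(f in mut_fixed_point C v5) F f) =
  op (\big[op/idx]_(f in C v6) F f) (\big[op/idx]_(f in C v7) F f).
Proof.
transitivity (\big[op/idx]_(f in C v6 :|: C v7) F f).
  by rewrite [RHS](big_setID (C v5)) /= (finset.setIidPr C567).
by rewrite -bigU //=; apply: eq_bigl => f; rewrite !inE.
Qed.

Lemma big_labB (R : Type) (idx : R) (op : Monoid.com_law idx) (F : L -> R) :
  \big[op/idx]_b F (labB b) =
  op (\big[op/idx]_(f in C v6) F f) (\big[op/idx]_(f in C v7) F f).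
Proof.
rewrite big_split_ord /=.
under eq_bigr do rewrite labBl; under [X in op _ X]eq_bigr do rewrite labBr.
by rewrite (big_labels c_labels) (big_labels c'_labels) big_mutation.
Qed.

Lemma big_labA (R : Type) (idx : R) (op : Monoid.com_law idx) (F : L -> int -> R) :
  \big[op/idx]_j F (labA j) (degA j) =
  op (\big[op/idx]_(f in C v3) F f (o v3 f)) (\big[op/idx]_(f in C v4) F f (o v4 f)).
Proof.
rewrite big_split_ord /=.
under eq_bigr do rewrite labAl degAl; under [X in op _ X]eq_bigr do rewrite labAr degAr.
rewrite (@big_labels _ _ _ _ c_labels _ _ op v3 (fun f => F f (o v3 f))).
by rewrite (@big_labels _ _ _ _ c_labels _ _ op v4 (fun f => F f (o v4 f))).
Qed.

Lemma labB_inj : injective labB.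
Proof.
have dis I J : @c v5 I <> @c' v5 J.
  move=> E; have := labels_mem c'_labels J; rewrite /= -E inE => /andP[/negP[]].
  exact: (labels_mem c_labels I).
move=> b b'; rewrite -[b]splitK -[b']splitK /unsplit.
case: (fintype.split b) => I; case: (fintype.split b') => J; rewrite ?labBl ?labBr.
- by move/(labels_inj c_labels) => ->.
- by move/dis.
- by move/esym/dis.
- by move/(labels_inj c'_labels) => ->.
Qed.

Lemma labA_mem j : labA j \in C v5.
Proof.
rewrite -[j]splitK /unsplit; case: (fintype.split j) => I; rewrite ?labAl ?labAr.
  apply: (fintype.subsetP C35); exact: (labels_mem c_labels I).
apply: (fintype.subsetP C45); exact: (labels_mem c_labels I).
Qed.

Let xB b := xi (labB b).
Let nB b : int := degB o (labB b).
Let xA j := xi (labA j).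

Lemma B_gen b b' : b != b' -> nonint (xB b - xB b').
Proof. by move=> bb'; apply: xi_gen; rewrite (inj_eq labB_inj). Qed.

Lemma A_gen j b k : xA j - xB b + k.+1%:R != 0.
Proof.
rewrite /xA /xB; have [->|jb] := eqVneq (labA j) (labB b).
  by rewrite subrr add0r.
exact/nonint_nat/xi_gen.
Qed.

Lemma A_gen' j (J : 'I_r') : nonint (xA j - xB (rshift r J)).
Proof.
apply: xi_gen; apply: contraTneq (labA_mem j) => ->; rewrite labBr.
by have := labels_mem c'_labels J; rewrite /= inE => /andP[].
Qed.

Definition star_center_set (delta : L -> int) :=
  gauge_set xi (C v5) (node_degree o delta v5) *
  (arrow_set xi (C v3) (C v5) (node_degree o delta v3) (node_degree o delta v5) *
   arrow_set xi (C v4) (C v5) (node_degree o delta v4) (node_degree o delta v5)) *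
  (arrow_set xi (C v5) (C v6) (node_degree o delta v5) (node_degree o delta v6) *
   arrow_set xi (C v5) (C v7) (node_degree o delta v5) (node_degree o delta v7)).

Let C' := mut_fixed_point C.

Definition mut_center_set (delta : L -> int) :=
  gauge_set xi (C' v5) (node_degree o delta v5) *
  (arrow_set xi (C v6) (C' v5) (node_degree o delta v6) (node_degree o delta v5) *
   arrow_set xi (C v7) (C' v5) (node_degree o delta v7) (node_degree o delta v5)) *
  (arrow_set xi (C v3) (C v6) (node_degree o delta v3) (node_degree o delta v6) *
   arrow_set xi (C v3) (C v7) (node_degree o delta v3) (node_degree o delta v7) *
  (arrow_set xi (C v4) (C v6) (node_degree o delta v4) (node_degree o delta v6) *
   arrow_set xi (C v4) (C v7) (node_degree o delta v4) (node_degree o delta v7))) *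
  (relation_set xi (C v3) (C' v5) (node_degree o delta v3) (node_degree o delta v5) *
   relation_set xi (C v4) (C' v5) (node_degree o delta v4) (node_degree o delta v5)).

Hypothesis o_supp : supported C o.

Lemma o_out i f : f \notin C i -> o i f = 0%N :> nat.
Proof.
move=> nf; have /forallP/(_ i)/forallP/(_ f) := o_supp.
by rewrite (negPf nf) andbF implybF negbK => /eqP ->.
Qed.

Lemma degB6 f : f \in C v6 -> degB o f = o v6 f.
Proof.
by move=> f6; rewrite /degB (@o_out v7) ?addn0 // (disjointFr C67 f6).
Qed.

Lemma degB7 f : f \in C v7 -> degB o f = o v7 f.
Proof.
by move=> f7; rewrite /degB (@o_out v6) // (disjointFl C67 f7).
Qed.

Lemma star_center_setE (d : {ffun 'I_r -> 'I_n.+1}) :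
  star_center_set (center_degree c 1 d) = star_center xB nB xA degA (fun I => d I).
Proof.
have deg5 I : node_degree o (center_degree c 1 d) v5 (c I) = nB (lshift r' I) + (d I)%:Z.
  by rewrite /node_degree /nB labBl /center_degree (pushE c_labels) mul1r.
rewrite /star_center_set /star_center; congr (_ * _ * _).
- rewrite (gauge_set_labels xi c_labels).
  by congr gauge; apply: funext => I; rewrite ?deg5 /comp /xB ?labBl.
- rewrite (big_labA _ (fun f e => \prod_I
    ibracket (xi f - xB (lshift r' I)) (e - (nB (lshift r' I) + (d I)%:Z)))).
  congr (_ * _); apply: eq_bigr => f _; rewrite -(big_labels c_labels); apply: eq_bigr => I _;
  by rewrite deg5 /xB labBl.
- rewrite /arrow_set -big_split -(big_labels c_labels); apply: eq_bigr => I _ /=.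
  rewrite (big_labB _ (fun g => ibracket (xB (lshift r' I) - xi g)
    (nB (lshift r' I) + (d I)%:Z - (degB o g)%:Z))).
  congr (_ * _); apply: eq_bigr => g gC; rewrite -/(node_degree o _ v5 _) deg5 /xB labBl //.
    by rewrite degB6.
  by rewrite degB7.
Qed.

Lemma mut_center_setE (d : {ffun 'I_r' -> 'I_n.+1}) :
  mut_center_set (center_degree c' (-1) d) = mut_center xB nB xA degA (fun I => d I).
Proof.
have deg5 J : node_degree o (center_degree c' (-1) d) v5 (c' J) = nB (rshift r J) - (d J)%:Z.
  by rewrite /node_degree /nB labBr /center_degree (pushE c'_labels) mulN1r.
rewrite /mut_center_set /mut_center; congr (_ * _ * _ * _).
- rewrite (gauge_set_labels xi c'_labels).
  by congr gauge; apply: funext => I; rewrite ?deg5 /comp /xB ?labBr.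
- rewrite exchange_big [arrow_set _ (C v6) _ _ _]exchange_big.
  rewrite [arrow_set _ (C v7) _ _ _]exchange_big.
  rewrite -big_split -[C' v5]/(mut_fixed_point C v5) -(big_labels c'_labels).
  apply: eq_bigr => J _ /=.
  rewrite (big_labB _ (fun g => ibracket (xi g - xB (rshift r J))
    ((degB o g)%:Z - (nB (rshift r J) - (d J)%:Z)))).
  congr (_ * _); apply: eq_bigr => g gC; rewrite -/(node_degree o _ v5 _) deg5 /xB labBr //.
    by rewrite degB6.
  by rewrite degB7.
- rewrite (big_labA _ (fun f e => \prod_b ibracket (xi f - xB b) (e - nB b))).
  rewrite /arrow_set -!big_split; congr (_ * _); apply: eq_bigr => f _ /=;
  rewrite (big_labB _ (fun g => ibracket (xi f - xi g) (_ - (degB o g)%:Z)));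
  congr (_ * _); apply: eq_bigr => g gC; first [by rewrite degB6 | by rewrite degB7].
- rewrite (big_labA _ (fun f e => \prod_J
    bracket (xi f - xB (rshift r J)) (e - (nB (rshift r J) - (d J)%:Z)))).
  congr (_ * _); apply: eq_bigr => f _; rewrite -[C' v5]/(mut_fixed_point C v5);
  rewrite -(big_labels c'_labels); apply: eq_bigr => I _;
  by rewrite deg5 /xB labBr.
Qed.

(** The sum of the a_j minus the sum of the z_f, plus N_5'. *)
Definition central_charge : K :=
  \sum_(f in C v3) (xi f + (o v3 f)%:R) + \sum_(f in C v4) (xi f + (o v4 f)%:R)
  - (\sum_(f in C v6) (xi f + (o v6 f)%:R) + \sum_(f in C v7) (xi f + (o v7 f)%:R))
  + r'%:R.

Lemma center_identity k : (k <= n)%N ->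
  \sum_(d : {ffun 'I_r -> 'I_n.+1} | (\sum_b d b == k)%N)
     star_center_set (center_degree c 1 d) =
  \sum_(j < k.+1) (dual_sign K r' ^+ j * dual_ratio (N v6 + N v7) m central_charge j) *
    \sum_(d : {ffun 'I_r' -> 'I_n.+1} | (\sum_b d b == k - j)%N)
     mut_center_set (center_degree c' (-1) d).
Proof.
move=> kn.
have rr' : (r + r' = N v6 + N v7)%N by rewrite /r /r' /= subnKC // ltnW.
have r'_gt0 : (0 < r')%N by rewrite /r' /= subn_gt0.
pose zB b := xB b + (nB b)%:~R; pose zA j := xA j + (degA j)%:~R.
have z_gen b b' (l : nat) : b != b' -> zB b - zB b' + l%:R != 0.
  move=> bb'; suff -> : zB b - zB b' + l%:R =
      xB b - xB b' + (nB b - nB b' + l%:Z)%:~R by apply: B_gen.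
  by rewrite /zB !rmorphD rmorphN /=; ring.
have m_le : (m <= r + r')%N by rewrite rr'.
have ccE : \sum_i zA i - \sum_b zB b + r'%:R = central_charge.
  rewrite (big_labA _ (fun f e => xi f + e%:~R)).
  rewrite (big_labB _ (fun f => xi f + (degB o f)%:~R)) /central_charge.
  congr (_ - (_ + _) + _); apply: eq_bigr => f fC; first by rewrite degB6.
  by rewrite degB7.
pose K0 := center0 xB nB xA degA; pose eta := dual_sign K r'.
have SE : \sum_(d : {ffun 'I_r -> 'I_n.+1} | (\sum_b d b == k)%N)
     star_center_set (center_degree c 1 d) = K0 * eta ^+ k * (star_sum zB zA n (@lshift r r'))`_k.
  rewrite coef_multisum mulr_sumr; apply: eq_bigr => d /eqP dk.
  by rewrite star_center_setE (star_center_term char0 nB degA B_gen A_gen N5_gt0) dk.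
rewrite SE (star_sum_convolution char0 zA z_gen m_le kn) mulr_sumr.
apply: eq_bigr => j _.
have ME : \sum_(d : {ffun 'I_r' -> 'I_n.+1} | (\sum_b d b == k - j)%N)
     mut_center_set (center_degree c' (-1) d) =
     K0 * eta ^+ (k - j) * (mut_sum zB zA n (@rshift r r'))`_(k - j).
  rewrite coef_multisum mulr_sumr; apply: eq_bigr => d /eqP dk.
  by rewrite mut_center_setE (mut_center_term char0 nB degA B_gen A_gen' r'_gt0) dk.
have -> : eta ^+ k = eta ^+ (k - j) * eta ^+ j.
  by rewrite -exprD subnK // -ltnS.
by rewrite ME ccE -rr' -/eta; ring.
Qed.

End Center.


(** * Regrouping sums by degree *)
Section Convolution.
Variables (K : fieldType) (n : nat).

Lemma convolution_sum (phi x y : nat -> K) :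
  (forall k, (n < k)%N -> phi k = 0) ->
  \sum_(k < n.+1) (\sum_(i < k.+1) x i * y (k - i)%N) * phi k =
  \sum_(i < n.+1) x i * \sum_(j < n.+1) y j * phi (i + j)%N.
Proof.
move=> phi0.
transitivity (\sum_(k < n.+1) \sum_(i < n.+1 | (i <= k)%N) x i * (y (k - i)%N * phi k)).
  apply: eq_bigr => k _; rewrite mulr_suml.
  rewrite (big_ord_widen_cond n.+1 xpredT (fun i => x i * y (k - i)%N * phi k)) //.
  by apply: eq_big => [i|i _]; rewrite ?ltnS // mulrA.
rewrite (exchange_big_dep xpredT) //=; apply: eq_bigr => i _.
rewrite -mulr_sumr; congr (_ * _).
rewrite -(big_mkord xpredT (fun j => y j * phi (i + j)%N)).
rewrite (@big_cat_nat _ _ _ (n.+1 - i)) ?leq_subr //=.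
rewrite [X in _ = _ + X]big_nat_cond [X in _ = _ + X]big1 ?addr0; last first.
  by move=> j; rewrite andbT => /andP[jn _]; rewrite phi0 ?mulr0 //; lia.
rewrite -(big_mkord (fun k => i <= k)%N (fun k => y (k - i)%N * phi k)).
have i_le : (i <= n.+1)%N by rewrite ltnW.
rewrite (@big_cat_nat _ _ _ i) //= [X in X + _]big_nat_cond [X in X + _]big1 ?add0r; last first.
  by move=> j; lia.
rewrite -{1}[i : nat]add0n big_addn.
by apply: eq_big => [j|j _]; rewrite ?leq_addl // addnK addnC.
Qed.

Lemma triple_convolution (phi p b M S a : nat -> K) :
  (forall k, (n < k)%N -> phi k = 0) ->
  (forall k, (k <= n)%N -> S k = \sum_(i < k.+1) a i * M (k - i)%N) ->
  (forall i, (i <= n)%N -> a i = \sum_(j < i.+1) p j * b (i - j)%N) ->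
  \sum_(k < n.+1) S k * phi k =
  \sum_(j < n.+1) p j * \sum_(k < n.+1) M k * \sum_(l < n.+1) b l * phi (j + k + l)%N.
Proof.
move=> phi0 SE aE.
under eq_bigr => k _ do rewrite SE -1?ltnS //.
rewrite convolution_sum //.
under eq_bigr => i _ do rewrite aE -1?ltnS //.
rewrite (convolution_sum (phi := fun i => \sum_(j < n.+1) M j * phi (i + j)%N)).
  apply: eq_bigr => j _; congr (_ * _).
  under eq_bigr do rewrite mulr_sumr; rewrite exchange_big /=.
  apply: eq_bigr => k _; rewrite mulr_sumr; apply: eq_bigr => l _.
  by rewrite mulrCA addnAC.
by move=> i ni; rewrite big1 // => j _; rewrite phi0 ?mulr0 // ltn_addr.
Qed.

(** The hypothesis on phi makes the truncation of the degree harmless. *)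
Lemma degree_partition (T : finType) (deg : T -> nat) (phi : nat -> K) (X : T -> K) :
  (forall k, (n < k)%N -> phi k = 0) ->
  \sum_d X d * phi (deg d) =
  \sum_(k < n.+1) (\sum_(d | deg d == k) X d) * phi k.
Proof.
move=> phi0; under [RHS]eq_bigr do rewrite mulr_suml big_mkcond.
rewrite exchange_big; apply: eq_bigr => d _ /=.
have [dn|dn] := ltnP (deg d) n.+1.
  rewrite (bigD1 (Ordinal dn)) //= eqxx big1 ?addr0 // => k /eqP kd.
  by case: eqP => // dk; case: kd; apply: val_inj; rewrite /= dk.
rewrite phi0 // mulr0 big1 // => k _; case: eqP => // dk.
by have := ltn_ord k; rewrite -dk ltnNge dn.
Qed.

End Convolution.

Lemma le_sum_term q (F : 'I_q -> int) i : (forall j, 0 <= F j) -> F i <= \sum_j F j.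
Proof. by move=> F0; rewrite (bigD1 i) //= lerDl sumr_ge0. Qed.


(** * Genericity of the equivariant parameters and Kahler variables *)
Section EquivariantField.
Variables (R : realType) (L : nat).

Lemma equiv_char0 k : k.+1%:R != 0 :> equiv_field R L.
Proof.
rewrite -(rmorph_nat (@FracField.tofrac {mpoly R[i][L]})) tofrac_eq0.
by rewrite -(rmorph_nat (@mpolyC L R[i])) mpolyC_eq0 pnatr_eq0.
Qed.

Lemma lambda_nonint (f g : 'I_L) : f != g -> nonint (lambda R f - lambda R g).
Proof.
move=> fg i; rewrite /lambda -(rmorph_int (@FracField.tofrac {mpoly R[i][L]})).
rewrite -rmorphB -rmorphD tofrac_eq0.
apply/eqP => /(congr1 (mcoeff U_(f)%MM)).
rewrite -(rmorph_int (@mpolyC L R[i])) mcoeffD mcoeffB !mcoeffX mcoeffC mcoeff0.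
rewrite eqxx eq_mnm1 eq_sym (negPf fg) mnm1_eq0 mulr0 subr0 addr0.
by move/eqP; rewrite oner_eq0.
Qed.

End EquivariantField.

Section KahlerVariables.
Variables (K : fieldType) (q' : star_node -> kahler_var star_node).
Hypothesis kmonE : forall i, kmon (q' i) = kmon (kahler_mut i).

Lemma kahler_monomial (D : expo star_node) j :
  (\sum_i kmon (q' i) *~ D i) j =
  match j with v5 => D v6 + D v7 - D v5 | _ => D j end.
Proof.
rewrite sum_ffunE sum_star_node !ffunMzE !kmonE /=.
case: j; rewrite !ffunE /= ?eqxx; (do ?[case: eqP => // _]);
  by rewrite !mulrzz /=; lia.
Qed.

End KahlerVariables.


Lemma expoD (T : finType) (a b : expo T) j : (a + b) j = a j + b j.
Proof. exact: ffunE. Qed.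

(** * The I-functions as finite sums *)
Section Assembly.
Variables (R : realType) (N : star_node -> nat) (sigma sigma' : star_node -> int).
Variable C : star_node -> {set 'I_(N v8 + N v9)}.
Variables (c : forall i, 'I_(N i) -> 'I_(N v8 + N v9)).
Variables (c' : forall i, 'I_(mut_rank N i) -> 'I_(N v8 + N v9)).
Hypothesis sigma_phase : star_phase sigma.
Hypothesis sigma'_phase : mut_phase sigma'.
Hypothesis C_fixed : star_fixed_point C.
Hypothesis c_labels : root_labels C c.
Hypothesis c'_labels : root_labels (mut_fixed_point C) c'.

Let L := 'I_(N v8 + N v9).
Let K := equiv_field R (N v8 + N v9).
Let xi : L -> K := @lambda R (N v8 + N v9).
Let C' := mut_fixed_point C.

Lemma C67_disjoint : [disjoint C v6 & C v7].
Proof.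
case: C_fixed => _ _ _ [s6 s7] [E8 E9].
apply/pred0P => f /=; apply/negP => /andP[/(fintype.subsetP s6) + /(fintype.subsetP s7)].
rewrite E8 E9 => /imsetP[i _ ->] /imsetP[j _ /eqP].
by rewrite eq_lrshift.
Qed.

Lemma C_sub i j : (i, j) \in [:: (v1, v3); (v3, v5); (v2, v4); (v4, v5); (v6, v8); (v7, v9)] ->
  {subset C i <= C j}.
Proof.
case: C_fixed => _ [s1 s2 s3 s4] _ [s6 s7] _.
by rewrite !inE => /or4P[||| /or3P[]] /eqP[-> ->]; apply/fintype.subsetP.
Qed.

Lemma C5_sub : C v5 \subset C v6 :|: C v7. Proof. by case: C_fixed. Qed.


Section Truncated.
Variables (n : nat).
Implicit Types (o : outer L n) (e : expo star_node).

Definition base o : int := \sum_(f in C v5) (degB o f)%:Z.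

(** The exponent of the variables q in the terms with outer part o and total
    shift k.  The change of variables is the one for which it is the same on
    both sides, see [star_total_degree] and [mut_total_degree]. *)
Definition exponent o (k : nat) : expo star_node :=
  [ffun j => match j with
             | v5 => base o + k%:Z
             | v8 | v9 => 0
             | _ => \sum_(f in C j) (o j f)%:Z
             end].

(** The exponent that the change of variables with binomial factors
    contributes to the terms with outer part o. *)
Definition charge o : int :=
  \sum_(f in C v3) (o v3 f)%:Z + \sum_(f in C v4) (o v4 f)%:Z
  - (\sum_(f in C v6) (o v6 f)%:Z + \sum_(f in C v7) (o v7 f)%:Z).

Lemma exponentD o k l : exponent o (k + l) = exponent o k + qvar v5 *+ l.
Proof.
apply/ffunP => j; rewrite expoD ffunMnE !ffunE.
case: j; rewrite ?eqxx; (do ?[case: eqP => // _]);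
  by rewrite ?mul0rn ?addr0 // PoszD addrA natz.
Qed.

Lemma exponent_large o e k : e v5 <= n%:Z -> (n < k)%N -> e <> exponent o k.
Proof.
move=> en nk E; move: en; rewrite E ffunE.
have : 0 <= base o by apply: sumr_ge0.
lia.
Qed.

Lemma sum_Posz q (F : 'I_q -> nat) : \sum_I (F I)%:Z = (\sum_I F I)%N%:Z.
Proof. by rewrite (big_morph Posz PoszD (erefl _)). Qed.

Lemma total_degree_assemble (M : star_node -> nat)
    (g : forall i, 'I_(M i) -> L) s o d (i : star_node) :
  \sum_I assemble g s (o, d) i I = \sum_I node_degree o (center_degree g s d) i (@g i I).
Proof. by apply: eq_bigr => I _; rewrite !ffunE. Qed.

Lemma star_total_degree o (d : {ffun 'I_(N v5) -> 'I_n.+1}) :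
  @total_degree star N (assemble c 1 (o, d)) = exponent o (\sum_b d b).
Proof.
apply/ffunP => j; rewrite [LHS]ffunE [LHS]total_degree_assemble ffunE.
case: j; rewrite /node_degree; try by rewrite big1.
  1-4, 6-7: by rewrite (big_labels c_labels _ _ (fun f => (o _ f)%:Z)).
rewrite big_split /= (big_labels c_labels _ _ (fun f => (degB o f)%:Z)) -sum_Posz.
congr (_ + _); apply: eq_bigr => I _.
by rewrite /center_degree (pushE c_labels) mul1r.
Qed.

Lemma degB_mutation o : supported C o ->
  \sum_(f in C v6) (o v6 f)%:Z + \sum_(f in C v7) (o v7 f)%:Z =
  base o + \sum_(f in C' v5) (degB o f)%:Z.
Proof.
move=> so; rewrite (big_mutation C5_sub C67_disjoint).
congr (_ + _); apply: eq_bigr => f fC.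
  by rewrite (degB6 C67_disjoint so).
by rewrite (degB7 C67_disjoint so).
Qed.

Lemma mut_total_degree o (d : {ffun 'I_(mut_rank N v5) -> 'I_n.+1}) q' :
  (forall i, kmon (q' i) = kmon (kahler_mut i)) -> supported C o ->
  \sum_i kmon (q' i) *~ @total_degree mut (mut_rank N) (assemble c' (-1) (o, d)) i =
  exponent o (\sum_b d b).
Proof.
move=> kmonE so; apply/ffunP => j; rewrite kahler_monomial //.
have outE (i : star_node) : is_outer i ->
    @total_degree mut (mut_rank N) (assemble c' (-1) (o, d)) i = \sum_(f in C i) (o i f)%:Z.
  move=> io; rewrite ffunE.
  transitivity (\sum_I node_degree o (center_degree c' (-1) d) i (@c' i I)).
    exact: total_degree_assemble.
  rewrite (_ : C i = C' i); last by case: i io.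
  by case: i io => // _; rewrite (big_labels c'_labels _ _ (fun f => (o _ f)%:Z)).
rewrite [RHS]ffunE; case: j; try exact: outE.
  2-3: by rewrite ffunE big1 // => I _; rewrite !ffunE.
rewrite (outE v6) // (outE v7) // degB_mutation // ffunE [X in _ - X]total_degree_assemble.
have -> : \sum_I node_degree o (center_degree c' (-1) d) v5 (@c' v5 I) =
    \sum_(f in C' v5) (degB o f)%:Z + \sum_I center_degree c' (-1) d (@c' v5 I).
  by rewrite -(big_labels c'_labels _ v5 (fun f => (degB o f)%:Z)) -big_split.
rewrite -sum_Posz.
have -> : \sum_I center_degree c' (-1) d (@c' v5 I) = - \sum_(I < mut_rank N v5) (d I)%:Z.
  by rewrite -sumrN; apply: eq_bigr => I _; rewrite /center_degree (pushE c'_labels) mulN1r.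
by rewrite opprD opprK addrA addrK.
Qed.

Lemma mut_charge o (d : {ffun 'I_(mut_rank N v5) -> 'I_n.+1}) :
  \sum_i kbin (kahler_mut_binomial i) *
     @total_degree mut (mut_rank N) (assemble c' (-1) (o, d)) i = charge o.
Proof.
have outE (i : star_node) : is_outer i ->
    @total_degree mut (mut_rank N) (assemble c' (-1) (o, d)) i = \sum_(f in C i) (o i f)%:Z.
  move=> io; rewrite ffunE.
  transitivity (\sum_I node_degree o (center_degree c' (-1) d) i (@c' i I)).
    exact: total_degree_assemble.
  rewrite (_ : C i = C' i); last by case: i io.
  by case: i io => // _; rewrite (big_labels c'_labels _ _ (fun f => (o _ f)%:Z)).
rewrite sum_star_node /= !mul0r !mul1r !mulN1r.
by rewrite (outE v3) // (outE v4) // (outE v6) // (outE v7) // /charge; ring.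
Qed.


(** The shift of the centre is irrelevant here and is set to 0. *)
Definition common o : K :=
  let nu0 := node_degree o (fun=> 0) in
  gauge_set xi (C v1) (nu0 v1) * gauge_set xi (C v2) (nu0 v2) *
  gauge_set xi (C v3) (nu0 v3) * gauge_set xi (C v4) (nu0 v4) *
  gauge_set xi (C v6) (nu0 v6) * gauge_set xi (C v7) (nu0 v7) *
  arrow_set xi (C v1) (C v3) (nu0 v1) (nu0 v3) *
  arrow_set xi (C v2) (C v4) (nu0 v2) (nu0 v4) *
  arrow_set xi (C v6) (C v8) (nu0 v6) (nu0 v8) *
  arrow_set xi (C v7) (C v9) (nu0 v7) (nu0 v9).

Let x (i : star_node) (I : 'I_(N i)) : K := xi (c I).
Let x' (i : star_node) (I : 'I_(mut_rank N i)) : K := xi (c' I).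

Lemma star_I_term_assemble o (d : {ffun 'I_(N v5) -> 'I_n.+1}) :
  @I_term K star N x predT [::] (assemble c 1 (o, d)) =
  common o * star_center_set xi C o (center_degree c 1 d).
Proof. exact: star_I_term_label. Qed.

Lemma mut_I_term_assemble o (d : {ffun 'I_(mut_rank N v5) -> 'I_n.+1}) :
  @I_term K mut (mut_rank N) x' mut_kept mut_relations (assemble c' (-1) (o, d)) =
  common o * mut_center_set xi C o (center_degree c' (-1) d).
Proof. exact: mut_I_term_label. Qed.

Lemma codom_sub (M : star_node -> nat) (D : star_node -> {set L})
    (g : forall i, 'I_(M i) -> L) (lg : root_labels D g) i j :
  {subset D i <= D j} -> {subset codom (@g i) <= codom (@g j)}.
Proof. by move=> s f; rewrite !(labels_codom lg) => /s. Qed.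

Lemma star_sub a : star_src a != v5 -> {subset C (star_src a) <= C (star_tgt a)}.
Proof. by case: a => //= n5; first [by case/eqP: n5 | apply: C_sub; rewrite !inE !eqxx ?orbT]. Qed.

Lemma star_effective_of_term (u : @degrees star N) :
  (forall i I, star_framed i -> u i I = 0) ->
  @I_term K star N x predT [::] u != 0 ->
  @effective star N R[i] sigma setT u.
Proof.
have cE i : codom (@c i) =i C i by exact: (labels_codom c_labels).
move=> uf nz; apply: (@star_effective R K L xi N c) => //.
- by move=> i; exact: (labels_inj c_labels).
- by move=> a a5; apply: (codom_sub c_labels); apply: star_sub.
- move=> f; rewrite inE !(labels_codom c_labels) => /(fintype.subsetP C5_sub).
  by rewrite inE.
- by rewrite (eq_disjoint (cE v6)) (eq_disjoint_r (cE v7)) C67_disjoint.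
Qed.

Lemma mut_effective_of_term (u : @degrees mut (mut_rank N)) :
  (forall i I, star_framed i -> u i I = 0) ->
  @I_term K mut (mut_rank N) x' mut_kept mut_relations u != 0 ->
  @effective mut (mut_rank N) R[i] sigma' (@critical (mut_rank N) R[i]) u.
Proof.
have sub67 i f : {subset C i <= C v5} -> f \in C i -> (f \in C v6) || (f \in C v7).
  by move=> s /s/(fintype.subsetP C5_sub); rewrite inE.
have cE i : codom (@c' i) =i C' i by exact: (labels_codom c'_labels).
have s35 : {subset C v3 <= C v5} by apply: C_sub; rewrite !inE !eqxx ?orbT.
have s45 : {subset C v4 <= C v5} by apply: C_sub; rewrite !inE !eqxx ?orbT.
have dis5 i : {subset C i <= C v5} -> [disjoint C i & C' v5].
  move=> s; apply/pred0P => f /=; apply/negP => /andP[/s f5].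
  by rewrite inE f5.
move=> uf nz; apply: (@mut_effective R K L xi (mut_rank N) c') => //.
- by move=> i; exact: (labels_inj c'_labels).
1-4: by apply: (codom_sub c'_labels); apply: C_sub; rewrite !inE !eqxx ?orbT.
- by move=> f; rewrite inE !cE; apply: sub67.
- by move=> f; rewrite inE !cE; apply: sub67.
- by move=> f; rewrite inE !cE !inE => /andP[].
- by rewrite (eq_disjoint (cE v6)) (eq_disjoint_r (cE v7)) C67_disjoint.
- by rewrite (eq_disjoint (cE v3)) (eq_disjoint_r (cE v5)) dis5.
- by rewrite (eq_disjoint (cE v4)) (eq_disjoint_r (cE v5)) dis5.
Qed.

(** Along 1 -> 3 -> 5 -> 6 -> 8 and the parallel paths, the degrees of a
    nonzero term decrease to 0, so they are nonnegative and each is bounded by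
    the total degree at its node. *)
Lemma star_cover e (u : @degrees star N) :
  (forall i, e i <= n%:Z) ->
  (forall i I, star_framed i -> u i I = 0) ->
  @I_term K star N x predT [::] u != 0 -> e = total_degree u ->
  exists2 t, supported (n := n) C t.1 & u = assemble c 1 t.
Proof.
move=> en uf nz eE.
have term a I J : c I = c J -> u (star_tgt a) J <= u (star_src a) I.
  by move=> E; exact: (@I_term_arrow K star N x predT [::] u a I J nz isT (congr1 xi E)).
have step a : star_src a != v5 -> (forall J, 0 <= u (star_tgt a) J) ->
    forall I, 0 <= u (star_src a) I.
  move=> a5 u0 I; have := star_sub a5 (labels_mem c_labels I).
  rewrite -(labels_codom c_labels) => /codomP[J E].
  exact: le_trans (u0 J) (term a I J E).
have ne (i : star_node) : i <> v5 -> i != v5 by move/eqP.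
have u6 : forall I, 0 <= u v6 I by apply: (step a68) => [|J]; [exact: ne | rewrite uf].
have u7 : forall I, 0 <= u v7 I by apply: (step a79) => [|J]; [exact: ne | rewrite uf].
pose p f := push c (i := v6) (u v6) f + push c (i := v7) (u v7) f.
have p5 (I : 'I_(N v5)) : 0 <= p (c I) <= u v5 I.
  have := fintype.subsetP C5_sub _ (labels_mem c_labels I); rewrite inE => /orP[] fC.
    rewrite /p (@push_notin _ _ _ _ c_labels v7) ?(disjointFr C67_disjoint fC) // addr0.
    move: fC; rewrite -(labels_codom c_labels) => /codomP[J E].
    by rewrite E (pushE c_labels) u6 (term a56 I J E).
  rewrite /p (@push_notin _ _ _ _ c_labels v6) ?(disjointFl C67_disjoint fC) // add0r.
  move: fC; rewrite -(labels_codom c_labels) => /codomP[J E].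
  by rewrite E (pushE c_labels) u7 (term a57 I J E).
have u5 (I : 'I_(N v5)) : 0 <= u v5 I by case/andP: (p5 I); apply: le_trans.
have u3 : forall I, 0 <= u v3 I by apply: (step a35) => //; exact: ne.
have u4 : forall I, 0 <= u v4 I by apply: (step a45) => //; exact: ne.
have u1 : forall I, 0 <= u v1 I by apply: (step a13) => //; exact: ne.
have u2 : forall I, 0 <= u v2 I by apply: (step a24) => //; exact: ne.
have un (i : star_node) : (forall I, 0 <= u i I) -> forall I, u i I <= n%:Z.
  move=> u0 I; apply: le_trans (le_sum_term I u0) _.
  by have := en i; rewrite eE ffunE.
apply: (assemble_cover c_labels) => // [i I io|I].
  by case: i I io => // I _; rewrite un // ?u1 ?u2 ?u3 ?u4 ?u6 ?u7.
rewrite mul1r subr_ge0; case/andP: (p5 I) => p0 pu; rewrite pu /=.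
apply: le_trans (un v5 u5 I); rewrite lerBlDr lerDl; exact: p0.
Qed.

(** The central degrees may be negative, but they are at most those at nodes
    6 and 7, and the differences add up to at most the exponent of q_5. *)
Lemma mut_cover e (u : @degrees mut (mut_rank N)) :
  (forall i, e i <= n%:Z) ->
  (forall i I, star_framed i -> u i I = 0) ->
  @I_term K mut (mut_rank N) x' mut_kept mut_relations u != 0 ->
  (forall i, is_outer i -> total_degree u i = e i) ->
  total_degree u v6 + total_degree u v7 - total_degree u v5 <= e v5 ->
  exists2 t, supported (n := n) C' t.1 & u = assemble c' (-1) t.
Proof.
move=> en uf nz eE e5.
have term (a : mut_arrow) I J : mut_kept a -> c' I = c' J ->
    u (mut_tgt a) J <= u (mut_src a) I.
  move=> ka E.
  exact: (@I_term_arrow K mut _ x' mut_kept mut_relations u a I J nz ka (congr1 xi E)).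
have step (a : mut_arrow) : mut_kept a -> {subset C' (mut_src a) <= C' (mut_tgt a)} ->
    (forall J, 0 <= u (mut_tgt a) J) -> forall I, 0 <= u (mut_src a) I.
  move=> ka s u0 I; have := s _ (labels_mem c'_labels I).
  rewrite -(labels_codom c'_labels) => /codomP[J E].
  exact: le_trans (u0 J) (term a I J ka E).
have u6 : forall I, 0 <= u v6 I.
  by apply: (step b68) => // [|J]; [apply: C_sub; rewrite !inE !eqxx ?orbT | rewrite uf].
have u7 : forall I, 0 <= u v7 I.
  by apply: (step b79) => // [|J]; [apply: C_sub; rewrite !inE !eqxx ?orbT | rewrite uf].
have s35 : {subset C v3 <= C v5} by apply: C_sub; rewrite !inE !eqxx ?orbT.
have s45 : {subset C v4 <= C v5} by apply: C_sub; rewrite !inE !eqxx ?orbT.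
pose p f := push c' (i := v6) (u v6) f + push c' (i := v7) (u v7) f.
have p6 J : p (@c' v6 J) = u v6 J.
  rewrite /p (pushE c'_labels) (push_notin c'_labels) ?addr0 //.
  by rewrite /= (disjointFr C67_disjoint (labels_mem c'_labels (i := v6) J)).
have p7 J : p (@c' v7 J) = u v7 J.
  rewrite /p (pushE c'_labels) (push_notin c'_labels) ?add0r //.
  by rewrite /= (disjointFl C67_disjoint (labels_mem c'_labels (i := v7) J)).
have cover67 f : f \in C v5 \/ f \in C' v5 ->
    (exists J, f = @c' v6 J) \/ (exists J, f = @c' v7 J).
  have E : f \in C v5 \/ f \in C' v5 -> (f \in C' v6) || (f \in C' v7).
    case=> [/(fintype.subsetP C5_sub)|]; first by rewrite inE.
    by rewrite /C' /= !inE => /andP[].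
  move/E; rewrite -!(labels_codom c'_labels) => /orP[] /codomP[J ->]; [left|right];
    by exists J.
have u3 I : 0 <= u v3 I.
  have [|[J E]|[J E]] := cover67 (@c' v3 I); first by left; apply: s35 (labels_mem c'_labels I).
    exact: le_trans (u6 J) (term b36 I J isT E).
  exact: le_trans (u7 J) (term b37 I J isT E).
have u4 I : 0 <= u v4 I.
  have [|[J E]|[J E]] := cover67 (@c' v4 I); first by left; apply: s45 (labels_mem c'_labels I).
    exact: le_trans (u6 J) (term b46 I J isT E).
  exact: le_trans (u7 J) (term b47 I J isT E).
have u1 : forall I, 0 <= u v1 I.
  by apply: (step b13) => //; apply: C_sub; rewrite !inE !eqxx ?orbT.
have u2 : forall I, 0 <= u v2 I.
  by apply: (step b24) => //; apply: C_sub; rewrite !inE !eqxx ?orbT.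
have un (i : star_node) : is_outer i -> (forall I, 0 <= u i I) ->
    forall I, u i I <= n%:Z.
  move=> io u0 I; apply: le_trans (le_sum_term I u0) _.
  by have := eE i io; rewrite ffunE => ->.
have p5 (J : 'I_(mut_rank N v5)) : 0 <= p (c' J) - u v5 J.
  rewrite subr_ge0.
  have [|[I E]|[I E]] := cover67 (@c' v5 J); first by right; apply: (labels_mem c'_labels J).
    by rewrite E p6 (term b65 I J isT (esym E)).
  by rewrite E p7 (term b75 I J isT (esym E)).
have p0 f : f \in C v5 -> 0 <= p f.
  by move=> f5; have [|[I ->]|[I ->]] := cover67 f; [left|rewrite p6|rewrite p7].
have total : \sum_J (p (@c' v5 J) - u v5 J) <= n%:Z.
  apply: le_trans (en v5); apply: le_trans e5.
  have S6 : total_degree u v6 = \sum_(f in C v6) p f.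
    rewrite ffunE -(big_labels c'_labels _ v6 p); apply: eq_bigr => I _; by rewrite p6.
  have S7 : total_degree u v7 = \sum_(f in C v7) p f.
    rewrite ffunE -(big_labels c'_labels _ v7 p); apply: eq_bigr => I _; by rewrite p7.
  rewrite S6 S7 -(big_mutation C5_sub C67_disjoint) -(big_labels c'_labels _ v5 p).
  rewrite [total_degree u v5]ffunE sumrB -addrA lerDr.
  exact: sumr_ge0.
apply: (assemble_cover c'_labels) => // [i I io|J].
  by case: i I io => // I _; rewrite un // ?u1 ?u2 ?u3 ?u4 ?u6 ?u7.
rewrite mulN1r opprB -/(p _) p5 /=.
exact: le_trans (le_sum_term J p5) total.
Qed.

Definition star_center_sum o k : K :=
  \sum_(d : {ffun 'I_(N v5) -> 'I_n.+1} | (\sum_b d b == k)%N)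
     star_center_set xi C o (center_degree c 1 d).

Definition mut_center_sum o k : K :=
  \sum_(d : {ffun 'I_(mut_rank N v5) -> 'I_n.+1} | (\sum_b d b == k)%N)
     mut_center_set xi C o (center_degree c' (-1) d).

Lemma star_series e : (forall i, e i <= n%:Z) ->
  star_I_function sigma x e =
  \sum_(o : outer L n | supported C o) common o *
    \sum_(k < n.+1) star_center_sum o k * (e == exponent o k)%:R.
Proof.
move=> en; rewrite /star_I_function /I_function.
rewrite (fsum_image (h := assemble c 1 (n := n)) (P := [pred t | supported C t.1])).
- transitivity (\sum_(o : outer L n | supported C o)
    \sum_(d : {ffun 'I_(N v5) -> 'I_n.+1})
    @I_term K star N x predT [::] (assemble c 1 (o, d)) *
    monomial K (@total_degree star N (assemble c 1 (o, d))) e).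
    by rewrite pair_big /=; apply: eq_big => [[o d]|[o d] _] //=; rewrite andbT.
  apply: eq_bigr => o so.
  rewrite -(degree_partition (phi := fun k => (e == exponent o k)%:R)
    (fun d : {ffun 'I_(N v5) -> 'I_n.+1} => \sum_b d b)%N).
    rewrite mulr_sumr; apply: eq_bigr => d _.
    by rewrite star_I_term_assemble star_total_degree mulrA.
  by move=> k nk; case: eqP => // /(exponent_large (en v5) nk).
- exact: (assemble_inj c_labels).
- move=> [o d] /= so nz; apply: star_effective_of_term.
    by move=> i I fi; rewrite !ffunE; case: i I fi.
  by apply/eqP => E; apply: nz; rewrite E mul0r.
- move=> u [uf _] nz.
  have nz1 : @I_term K star N x predT [::] u != 0.
    by apply/eqP => E; apply: nz; rewrite E mul0r.
  apply: (star_cover en) => //.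
  by apply/eqP; apply: contra_notT nz => /negPf E; rewrite /monomial E mulr0.
Qed.

Lemma supported_mut o : supported C' o = supported C o.
Proof. by apply: eq_forallb => i; apply: eq_forallb => f; case: i. Qed.

(** The integer kappa is 0 for the monomial change of variables and 1 for the
    one with binomial factors. *)
Lemma mut_series (eps : K) q' (kappa : int) e :
  (forall i, kmon (q' i) = kmon (kahler_mut i)) ->
  (forall i, kbin (q' i) = kappa * kbin (kahler_mut_binomial i)) ->
  (forall i, e i <= n%:Z) ->
  mut_I_function sigma' x' eps q' e =
  \sum_(o : outer L n | supported C o) common o *
    \sum_(k < n.+1) mut_center_sum o k *
      \sum_(l < n.+1) binomial_series eps (kappa * charge o)%:~R l *
        (e == exponent o (k + l))%:R.
Proof.
move=> kmonE kbinE en; rewrite /mut_I_function /I_function.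
have phi0 o k : (n < k)%N -> (e == exponent o k)%:R = 0 :> K.
  by move=> nk; case: eqP => // /(exponent_large (en v5) nk).
rewrite (fsum_image (h := assemble c' (-1) (n := n)) (P := [pred t | supported C t.1])).
- transitivity (\sum_(o : outer L n | supported C o)
    \sum_(d : {ffun 'I_(mut_rank N v5) -> 'I_n.+1})
    @I_term K mut (mut_rank N) x' mut_kept mut_relations (assemble c' (-1) (o, d)) *
    kahler_power v5 eps q' (@total_degree mut (mut_rank N) (assemble c' (-1) (o, d))) e).
    by rewrite pair_big /=; apply: eq_big => [[o d]|[o d] _] //=; rewrite andbT.
  apply: eq_bigr => o so.
  rewrite -(degree_partition (phi := fun k => \sum_(l < n.+1)
      binomial_series eps (kappa * charge o)%:~R l * (e == exponent o (k + l))%:R)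
    (fun d : {ffun 'I_(mut_rank N v5) -> 'I_n.+1} => \sum_b d b)%N).
    rewrite mulr_sumr; apply: eq_bigr => d _.
    rewrite mut_I_term_assemble -mulrA; congr (_ * (_ * _)).
    rewrite /kahler_power mut_total_degree //.
    have -> : \sum_i kbin (q' i) *
        @total_degree mut (mut_rank N) (assemble c' (-1) (o, d)) i = kappa * charge o.
      rewrite -(mut_charge o d) mulr_sumr; apply: eq_bigr => i _.
      by rewrite kbinE mulrA.
    rewrite /mul_pseries /monomial.
    have subE l : (e - qvar v5 *+ l == exponent o (\sum_b d b)) =
        (e == exponent o (\sum_b d b + l)).
      by rewrite subr_eq exponentD.
    under eq_fsbigr => l _ do rewrite subE.
    apply: fsum_nat => l nl; rewrite phi0 ?mulr0 //.
    exact: leq_trans nl (leq_addl _ _).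
  move=> k nk; rewrite big1 // => l _; rewrite phi0 ?mulr0 //.
  exact: leq_trans nk (leq_addr _ _).
- move=> t t' st st'; apply: (assemble_inj c'_labels); rewrite ?inE ?supported_mut //.
- move=> [o d] /= so nz; apply: mut_effective_of_term.
    by move=> i I fi; rewrite !ffunE; case: i I fi.
  by apply/eqP => E; apply: nz; rewrite E mul0r.
- move=> u [uf _] nz.
  have nz1 : @I_term K mut (mut_rank N) x' mut_kept mut_relations u != 0.
    by apply/eqP => E; apply: nz; rewrite E mul0r.
  have [l El] : exists l : nat,
      e - qvar v5 *+ l = \sum_i kmon (q' i) *~ @total_degree mut (mut_rank N) u i.
    apply: contrapT => nE; apply: nz; rewrite /kahler_power /mul_pseries fsbig1 ?mulr0 //.
    move=> l _; rewrite /monomial; case: eqP => [E|]; last by rewrite mulr0.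
    by case: nE; exists l.
  have eE j : e j = (if j == v5 then l%:Z else 0) +
      let D := @total_degree mut (mut_rank N) u in
      match j with v5 => D v6 + D v7 - D v5 | _ => D j end.
    have /eqP := El; rewrite subr_eq => /eqP ->.
    rewrite expoD kahler_monomial // ffunMnE addrC; congr (_ + _).
    by rewrite ffunE; case: eqP; rewrite ?mul0rn ?natz.
  have [t st ut] : exists2 t, supported (n := n) C' t.1 & u = assemble c' (-1) t.
    apply: (mut_cover en) => // [i io|].
      by rewrite eE; case: i io => //= _; case: eqP => // _; rewrite add0r.
    by rewrite (eE v5) eqxx lerDr.
  by exists t => //; rewrite /= -supported_mut.
Qed.

End Truncated.

End Assembly.


(** * The mutation identities *)
Lemma binomial_series_pow_coef (K : fieldType) (eps c : K) k :
  binomial_series eps c k = (- eps) ^+ k * pow_coef c k.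
Proof.
have -> : binomial_series eps c k =
    (\prod_(j < k) (c - j%:R)) / k`!%:R * ((- eps) ^+ k * (-1) ^+ k).
  by rewrite -exprMn mulrN1 opprK.
by rewrite /pow_coef mulrCA.
Qed.

Section Mutation.
Variables (R : realType) (N : star_node -> nat) (sigma sigma' : star_node -> int).
Variable C : star_node -> {set 'I_(N v8 + N v9)}.
Variables (c : forall i, 'I_(N i) -> 'I_(N v8 + N v9)).
Variables (c' : forall i, 'I_(mut_rank N i) -> 'I_(N v8 + N v9)).
Hypothesis N_gt0 : forall i, (0 < N i)%N.
Hypothesis N5_lt : (N v5 < N v6 + N v7)%N.
Hypothesis N34_le : (N v3 + N v4 <= N v6 + N v7)%N.
Hypothesis sigma_phase : star_phase sigma.
Hypothesis sigma'_phase : mut_phase sigma'.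
Hypothesis C_fixed : star_fixed_point C.
Hypothesis c_labels : root_labels C c.
Hypothesis c'_labels : root_labels (mut_fixed_point C) c'.

Let L := 'I_(N v8 + N v9).
Let K := equiv_field R (N v8 + N v9).
Let xi : L -> K := @lambda R (N v8 + N v9).
Let x (i : star_node) (I : 'I_(N i)) : K := xi (c I).
Let x' (i : star_node) (I : 'I_(mut_rank N i)) : K := xi (c' I).
Let eps : K := (-1) ^+ mut_rank N v5.

(** For each outer part the central sums are compared by [center_identity];
    the hypothesis says that the quotient of the dual Wronskians, in the
    variable q_5, is the prefactor p times the binomial series produced by the
    change of variables. *)
Lemma mutation_identity (p : nat -> K) q' (kappa : int) :
  (forall i, kmon (q' i) = kmon (kahler_mut i)) ->
  (forall i, kbin (q' i) = kappa * kbin (kahler_mut_binomial i)) ->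
  (forall n (o : outer L n) i,
     (- eps) ^+ i * dual_ratio (N v6 + N v7) (N v3 + N v4)
                      (central_charge xi N C o) i =
     \sum_(j < i.+1) p j * binomial_series eps (kappa * charge C o)%:~R (i - j)) ->
  forall e, star_I_function sigma x e =
            mul_pseries v5 p (mut_I_function sigma' x' eps q') e.
Proof.
move=> kmonE kbinE ratioE e.
pose n := (\max_i `|e i|%N)%N.
have en i : e i <= n%:Z.
  apply: le_trans (ler_norm _) _; rewrite -abszE lez_nat.
  exact: (leq_bigmax (F := fun i => `|e i|%N) i).
have enj j i : (e - qvar v5 *+ j) i <= n%:Z.
  apply: le_trans (en i); rewrite expoD -mulNrn ffunMnE ffunE gerDl.
  by rewrite ffunE mulNrn oppr_le0 mulrn_wge0.
have phi0 o k : (n < k)%N -> (e == exponent (n := n) C o k)%:R = 0 :> K.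
  by move=> nk; case: eqP => // /(exponent_large (en v5) nk).
have subE o j k : (e - qvar v5 *+ j == exponent (n := n) C o k) =
    (e == exponent C o (k + j)).
  by rewrite subr_eq exponentD.
rewrite (star_series R sigma_phase C_fixed c_labels en).
have mutE j := mut_series sigma'_phase C_fixed c'_labels eps kmonE kbinE (enj j).
rewrite /mul_pseries (fsum_nat (n := n)); last first.
  move=> j nj; rewrite mutE big1 ?mulr0 // => o _.
  rewrite big1 ?mulr0 // => k _; rewrite big1 ?mulr0 // => l _.
  by rewrite subE phi0 ?mulr0 // (leq_trans nj) // leq_addl.
under [RHS]eq_bigr do rewrite mutE mulr_sumr.
rewrite exchange_big /=; apply: eq_bigr => o so.
case: (C_fixed) => _ [s13 s35 s24 s45] s567 _ _.
rewrite (triple_convolution (phi := fun k => (e == exponent C o k)%:R)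
  (p := p) (b := binomial_series eps (kappa * charge C o)%:~R)
  (M := mut_center_sum R C c' o)
  (a := fun i => (- eps) ^+ i * dual_ratio (N v6 + N v7) (N v3 + N v4)
                      (central_charge xi N C o) i)).
- rewrite mulr_sumr; apply: eq_bigr => j _; rewrite mulrCA; congr (_ * (_ * _)).
  apply: eq_bigr => k _; congr (_ * _); apply: eq_bigr => l _.
  by rewrite subE -[(j + k + l)%N]addnA [(j + _)%N]addnC.
- exact: phi0.
- move=> k kn; apply: center_identity => //.
  + exact: equiv_char0.
  + exact: lambda_nonint.
  + exact: C67_disjoint.
- by move=> i _; apply: ratioE.
Qed.

(** The exponent splits into the one of the prefactor and [charge]. *)
Lemma central_chargeE n (o : outer L n) :
  central_charge xi N C o =
  (\sum_A @x v3 A + \sum_A @x v4 A - (\sum_B @x v6 B + \sum_B @x v7 B)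
    + (mut_rank N v5)%:R) + (charge C o)%:~R.
Proof.
rewrite /central_charge /charge !big_split /= /x.
rewrite !(big_labels c_labels _ _ xi) !rmorphB !rmorphD !rmorph_sum /=.
by ring.
Qed.

Lemma mul_pseries1 (F : series star_node K) e :
  mul_pseries v5 (fun k => (k == 0)%N%:R) F e = F e.
Proof.
rewrite /mul_pseries (fsum_nat (n := 0)) ?big_ord1 ?mul1r ?mulr0n ?subr0 //.
by case=> // k _; rewrite mul0r.
Qed.

End Mutation.

Theorem theorem1p3 (R : realType) (N : star_node -> nat)
    (sigma sigma' : star_node -> int)
    (C : star_node -> {set 'I_(N v8 + N v9)})
    (c : forall i, 'I_(N i) -> 'I_(N v8 + N v9))
    (c' : forall i, 'I_(mut_rank N i) -> 'I_(N v8 + N v9))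
    (N_gt0 : forall i, (0 < N i)%N)
    (N_arrow : forall a : star_arrow,
       star_src a != v5 -> (N (star_src a) < N (star_tgt a))%N)
    (N5_lt : (N v5 < N v6 + N v7)%N)
    (N34_le : (N v3 + N v4 <= N v6 + N v7)%N)
    (sigma_phase : star_phase sigma)
    (sigma'_phase : mut_phase sigma')
    (C_fixed : star_fixed_point C)
    (c_labels : root_labels C c)
    (c'_labels : root_labels (mut_fixed_point C) c') :
  let K := equiv_field R (N v8 + N v9) in
  let x : forall i, 'I_(N i) -> K := fun i I => lambda R (c i I) in
  let x' : forall i, 'I_(mut_rank N i) -> K := fun i I => lambda R (c' i I) in
  let N5' := mut_rank N v5 in
  let eps : K := (-1) ^+ N5' in
  [/\ (N v3 + N v4 + 2 <= N v6 + N v7)%N ->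
      forall e, star_I_function sigma x e
        = mut_I_function sigma' x' eps kahler_mut e,
      (N v6 + N v7 = N v3 + N v4 + 1)%N ->
      forall e, star_I_function sigma x e
        = mul_pseries v5 (exp_series ((-1) ^+ N5'))
            (mut_I_function sigma' x' eps kahler_mut) e
    & (N v6 + N v7 = N v3 + N v4)%N ->
      forall e, star_I_function sigma x e
        = mul_pseries v5
            (binomial_series eps
               (\sum_A x v3 A + \sum_A x v4 A
                - (\sum_B x v6 B + \sum_B x v7 B) + N5'%:R))
            (mut_I_function sigma' x' eps kahler_mut_binomial) e].
Proof.
move=> K x x' N5' eps.
have char0 := @equiv_char0 R (N v8 + N v9).
have M := @mutation_identity R N sigma sigma' C c c' N_gt0 N5_lt N34_le
  sigma_phase sigma'_phase C_fixed c_labels c'_labels.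
have kbin0 i : kbin (kahler_mut i) = 0 * kbin (kahler_mut_binomial i).
  by rewrite mul0r; case: i.
have bin0 (a : nat -> K) i : \sum_(j < i.+1) a j * binomial_series eps (0 : int)%:~R (i - j) = a i.
  rewrite big_ord_recr /= subnn big1 ?add0r => [|j _].
    by rewrite binomial_series_pow_coef pow_coef0 expr0 !mulr1.
  rewrite binomial_series_pow_coef pow_coef_exp0 (_ : (i - j == 0)%N = false) ?mulr0 //.
  by have := ltn_ord j; lia.
split=> Nm e.
- rewrite (M (fun k => (k == 0)%N%:R) kahler_mut 0) ?mul_pseries1 // => n o i.
  rewrite mul0r (bin0 (fun k => (k == 0)%N%:R)) /dual_ratio ifN; last by lia.
  by rewrite ifN; [case: i => [|i]; rewrite ?mulr0 ?expr0 ?mulr1|lia].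
- rewrite (M (exp_series ((-1) ^+ N5')) kahler_mut 0) // => n o i.
  rewrite mul0r (bin0 (exp_series eps)) /dual_ratio ifN; last by lia.
  rewrite ifT; last by lia.
  by rewrite /expN_coef /exp_series mulrA -exprMn mulrN1 opprK.
- apply: (M _ kahler_mut_binomial 1) => [i|i|n o i]; first by case: i.
    by rewrite mul1r.
  rewrite mul1r /dual_ratio ifT; last by lia.
  rewrite (central_chargeE R c_labels) -pow_coef_mul // mulr_sumr; apply: eq_bigr => j _.
  have ji : (j <= i)%N by rewrite -ltnS.
  rewrite !binomial_series_pow_coef [RHS]mulrACA; congr (_ * _).
  by rewrite -exprD subnKC.
Qed.
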